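(* Let $\mathbf{k}$ be a non-empty admissible index, $r=\mathrm{dep}(\mathbf{k})$ and $s=\mathrm{dep}(\mathbf{k}^{\vee})$. Then for any integer $m \ge 1$, \[ \sum_{\substack{\mathbf{e} \in (\mathbb{Z}_{\ge 0})^{r} \\ \mathrm{wt}(\mathbf{e})=m}}\zeta_{q}^{\mathcal{S}}(\mathbf{k}+\mathbf{e})= \sum_{\substack{\mathbf{e} \in (\mathbb{Z}_{\ge 0})^{s} \\ \mathrm{wt}(\mathbf{e})=m}}\zeta_{q}^{\mathcal{S}}((\mathbf{k}^{\vee}+\mathbf{e})^{\vee}) \] in $\mathcal Z_q/(\mathcal N_q+\mathcal P_q)$, where $\mathbf k+\mathbf e$ denotes componentwise addition.
   Context: Indices: an index is a finite (possibly empty) tuple $\mathbf k=(k_1,\dots,k_r)$ of positive integers with depth $\mathrm{dep}(\mathbf k)=r$; for a tuple of non-negative integers $\mathbf e$, $\mathrm{wt}(\mathbf e)$ is the sum of entries. An index is admissible if it is empty or $k_r\ge2$. Hoffman dual: in $\mathfrak h=\mathbb Q\langle x,y\rangle$ put $z_k=yx^{k-1}$, $z_{\mathbf k}=z_{k_1}\cdots z_{k_r}$. Let $\tau$ be the automorphism of $\mathfrak h$ swapping $x$ and $y$. For non-empty $\mathbf k$ write $z_{\mathbf k}=yw$ with $w$ a monomial; $\mathbf k^\vee$ is the index with $z_{\mathbf k^\vee}=y\tau(w)$; $\varnothing^\vee=\varnothing$. $q$-side: Let $\mathcal{C}=\mathbb{Q}[\hbar]$ ($\hbar$ formal), $\mathfrak{H}=\mathcal{C}\langle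 a,b\rangle$. For $k\ge1$, $g_k=ba^k$. $A=\{\hbar b\}\cup\{ba^k\mid k\ge1\}$, $\mathcal{C}\langle A\rangle$ the $\mathcal{C}$-subalgebra generated by $1$ and $A$, $\mathfrak z$ the $\mathcal C$-span of $A$, $\widehat{\mathfrak H^0}=\mathcal C+\sum_{k\ge1}\mathcal C\langle A\rangle g_k$. Fix $q\in\mathbb{C}$, $0<|q|<1$; $\mathbb{C}$ is a $\mathcal{C}$-module with $\hbar$ acting by $1-q$; $[m]=(1-q^m)/(1-q)$; $F_q(m;\cdot):\mathfrak{z}\to\mathbb{C}$ $\mathcal{C}$-linear with $F_q(m;\hbar b)=1-q$, $F_q(m;g_k)=q^{km}/[m]^k$; $Z_{q,M}$ $\mathcal{C}$-linear on $\mathcal C\langle A\rangle$ with $Z_{q,M}(1)=1$, $Z_{q,M}(u_1\cdots u_r)=\sum_{0<m_1<\cdots<m_r<M}\prod_i F_q(m_i;u_i)$ ($u_i\in A$); $Z_q(w)=\lim_{M\to\infty}Z_{q,M}(w)$ for $w\in\widehat{\mathfrak H^0}$. $\circ_\hbar$ symmetric $\mathcal C$-bilinear on $\mathfrak z$ with $(\hbar b)\circ_\hbar(\hbar b)=\hbar\cdot\hbar b$, $(\hbar b)\circ_\hbar g_k=\hbar g_k$, $g_k\circ_\hbar g_l=g_{k+l}$; $\ast_\hbar$ on $\mathcal{C}\langle A\rangle$: $w\ast_\hbar1=1\ast_\hbar w=w$, $(wu)\ast_\hbar(w'v)=(w\ast_\hbar w'v)u+(wu\ast_\hbar w')v+(w\ast_\hbar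 w')(u\circ_\hbar v)$ ($u,v\in A$). $\psi^\ast$: the $\mathcal C$-algebra anti-involution of $\mathcal C\langle A\rangle$ with $\psi^\ast(\hbar b)=\hbar b$, $\psi^\ast(ba^k)=b(-a)^k$. $w^{\mathcal S,\ast}_\hbar(1)=1$, $w^{\mathcal S,\ast}_\hbar(u_1\cdots u_r)=\sum_{i=0}^r(u_1\cdots u_i)\ast_\hbar\psi^\ast(u_{i+1}\cdots u_r)$ ($u_j\in A$), $\mathcal C$-linear; $Z^{\mathcal S,\ast}_{q,M}=Z_{q,M}\circ w^{\mathcal S,\ast}_\hbar$. $g_{\mathbf k}=g_{k_1}\cdots g_{k_r}$, $g_\varnothing=1$; $Z_q^{\mathcal S,\ast}(g_{\mathbf k})=\lim_{M\to\infty}Z^{\mathcal S,\ast}_{q,M}(g_{\mathbf k})$ (exists). Let $\mathfrak n_0$ be the $\mathcal C$-span of $(\hbar b)^{\alpha_1}g_{\beta_1+1}\cdots(\hbar b)^{\alpha_r}g_{\beta_r+1}$ with $r\ge1$, $\alpha_i,\beta_i\ge0$ and $\alpha_s\ge1,\beta_t\ge1$ for some $1\le s\le t\le r$; $\mathfrak n=\mathfrak n_0+\hbar\widehat{\mathfrak H^0}$; $\mathfrak H^0=\mathcal C+\sum_{k\ge2}\mathcal C\langle A\rangle g_k+\mathfrak n$; $\mathcal Z_q=Z_q(\mathfrak H^0)$, $\mathcal N_q=Z_q(\mathfrak n)$, $\mathcal P_q$ the ideal of $\mathcal Z_q$ generated by $\{Z_q(g_{2k})\mid k\ge1\}$. $\zeta_q^{\mathcal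 S}(\mathbf k)$ is the class of $Z_q^{\mathcal S,\ast}(g_{\mathbf k})$ in $\mathcal Z_q/(\mathcal N_q+\mathcal P_q)$. *)

(* Defs.v *)
From mathcomp Require Import all_boot all_algebra.
From mathcomp Require Import complex.
From mathcomp Require Import boolp reals.
Set Implicit Arguments. Unset Strict Implicit. Unset Printing Implicit Defensive.
Import GRing.Theory Num.Theory.
Local Open Scope ring_scope.

Definition is_index (k : seq nat) : bool := all (fun x => 0 < x)%N k.
Definition admissible (k : seq nat) : bool :=
  if k is [::] then true else (2 <= last 0%N k)%N.

(* monomials in x,y as boolean words: true = y, false = x *)
Definition zword (k : seq nat) : seq bool :=
  flatten [seq true :: nseq x.-1 false | x <- k].

(* the index k with z_k = w, for a word w starting with y *)
Definition index_of_word (w : seq bool) : seq nat :=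
  (foldr (fun (b : bool) (acc : nat * seq nat) =>
            if b then (0%N, acc.1.+1 :: acc.2) else (acc.1.+1, acc.2))
         (0%N, [::]) w).2.

Definition hoffman_dual (k : seq nat) : seq nat :=
  match zword k with
  | [::] => [::]
  | _ :: w => index_of_word (true :: map negb w)
  end.

Definition add_index (k e : seq nat) : seq nat := [seq (p.1 + p.2)%N | p <- zip k e].

(* Letters of the alphabet A: Hb = hbar b, G k = g_k = b a^k (k >= 1).
   Distinct words in A give distinct elements of H (up to powers of hbar),
   so C<A> is the free C-module on words in A. *)
Inductive letter := Hb | G of nat.

Definition valid_letter (u : letter) : bool :=
  if u is G k then (0 < k)%N else true.

(* Elements of C<A> represented as formal C-linear combinations of words;
   coefficients in C = Q[hbar] are polynomials in hbar = 'X. *)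
Definition fsum := seq ({poly rat} * seq letter).

Definition word (w : seq letter) : fsum := [:: (1, w)].

Definition circ (u v : letter) : {poly rat} * letter :=
  match u, v with
  | Hb, Hb => ('X, Hb)
  | Hb, G k => ('X, G k)
  | G k, Hb => ('X, G k)
  | G k, G l => (1, G (k + l))
  end.

(* the harmonic-type product *_hbar on words, computed on REVERSED words
   (head = last letter):
   (w u) * (w' v) = (w * w'v) u + (w u * w') v + (w * w') (u o v) *)
Fixpoint rstar (a : seq letter) : seq letter -> fsum :=
  match a with
  | [::] => fun b => [:: (1, b)]
  | u :: a' =>
      fix rstar_b (b : seq letter) : fsum :=
        match b with
        | [::] => [:: (1, u :: a')]
        | v :: b' =>
            [seq (p.1, u :: p.2) | p <- rstar a' (v :: b')]
            ++ [seq (p.1, v :: p.2) | p <- rstar_b b']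
            ++ [seq ((circ u v).1 * p.1, (circ u v).2 :: p.2) | p <- rstar a' b']
        end
  end.

Definition star_word (w w' : seq letter) : fsum :=
  [seq (p.1, rev p.2) | p <- rstar (rev w) (rev w')].

Definition star (s t : fsum) : fsum :=
  flatten [seq [seq (c.1 * d.1 * p.1, p.2) | p <- star_word c.2 d.2] | c <- s, d <- t].

(* psi^* : anti-involution, psi(hbar b) = hbar b, psi(b a^k) = b (-a)^k = (-1)^k g_k *)
Definition psi_sign (u : letter) : nat := if u is G k then k else 0%N.
Definition psi_word (w : seq letter) : fsum :=
  [:: (((-1) ^+ (sumn (map psi_sign w)))%:P, rev w)].

Definition wS (w : seq letter) : fsum :=
  flatten [seq star (word (take i w)) (psi_word (drop i w)) | i <- iota 0 (size w).+1].

Definition wS_fsum (s : fsum) : fsum :=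
  flatten [seq [seq (c.1 * p.1, p.2) | p <- wS c.2] | c <- s].

Definition gword (k : seq nat) : seq letter := map G k.

Section QSide.
Variable R : realType.
Local Notation C := R[i].
Variable q : C.

Definition qint (m : nat) : C := (1 - q ^+ m) / (1 - q).

Definition Fq (m : nat) (u : letter) : C :=
  match u with
  | Hb => 1 - q
  | G k => q ^+ (k * m) / qint m ^+ k
  end.

Fixpoint ZqM_from (w : seq letter) (lo M : nat) : C :=
  match w with
  | [::] => 1
  | u :: w' => \sum_(lo.+1 <= m < M) Fq m u * ZqM_from w' m M
  end.

(* hbar acts as 1 - q *)
Definition ev (c : {poly rat}) : C := (map_poly (ratr : rat -> C) c).[1 - q].

Definition ZqM (s : fsum) (M : nat) : C :=
  \sum_(p <- s) ev p.1 * ZqM_from p.2 0 M.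

Definition cvgC (u : nat -> C) (l : C) : Prop :=
  forall eps : R, 0 < eps -> exists N : nat, forall n : nat, (N <= n)%N ->
    `|u n - l| < Complex eps 0.

(* the limit (junk value 0 when it does not exist) *)
Definition limC (u : nat -> C) : C :=
  match pselect (exists l, cvgC u l) with
  | left H => projT1 (cid H)
  | right _ => 0
  end.

Definition Zq (s : fsum) : C := limC (ZqM s).

Definition ZqS (k : seq nat) : C := Zq (wS (gword k)).

End QSide.

Definition in_span (P : seq letter -> Prop) (s : fsum) : Prop :=
  foldr (fun p acc => P p.2 /\ acc) True s.

(* spanning words of hat H^0 = C + sum_{k>=1} C<A> g_k *)
Definition hatH0_word (w : seq letter) : Prop :=
  all valid_letter w /\
  (w = [::] \/ exists w' k, (1 <= k)%N /\ w = rcons w' (G k)).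

(* spanning words of n_0 :
   (hbar b)^{a_1} g_{b_1+1} ... (hbar b)^{a_r} g_{b_r+1}, r >= 1,
   with a_s >= 1, b_t >= 1 for some 1 <= s <= t <= r *)
Definition n0_word (w : seq letter) : Prop :=
  exists ab : seq (nat * nat),
    ab != [::] /\
    w = flatten [seq nseq p.1 Hb ++ [:: G p.2.+1] | p <- ab] /\
    exists s t : nat, (s <= t)%N /\ (t < size ab)%N /\
      (1 <= (nth (0, 0) ab s).1)%N /\ (1 <= (nth (0, 0) ab t).2)%N.

Definition in_n (s : fsum) : Prop :=
  exists s1 s2, in_span n0_word s1 /\ in_span hatH0_word s2 /\
    s = s1 ++ [seq ('X * p.1, p.2) | p <- s2].

(* spanning words of C + sum_{k>=2} C<A> g_k *)
Definition H0_word (w : seq letter) : Prop :=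
  all valid_letter w /\
  (w = [::] \/ exists w' k, (2 <= k)%N /\ w = rcons w' (G k)).

Definition in_H0 (s : fsum) : Prop :=
  exists s1 s2, in_span H0_word s1 /\ in_n s2 /\ s = s1 ++ s2.

Section QSets.
Variable R : realType.
Local Notation C := R[i].
Variable q : C.

Definition Zq_space (z : C) : Prop := exists s, in_H0 s /\ z = Zq q s.
Definition Nq_space (z : C) : Prop := exists s, in_n s /\ z = Zq q s.
Definition Pq_ideal (z : C) : Prop :=
  exists (n : nat) (a : nat -> C) (k : nat -> nat),
    (forall i, (i < n)%N -> Zq_space (a i) /\ (1 <= k i)%N) /\
    z = \sum_(i < n) a i * Zq q (word [:: G (2 * k i)]).

Definition eq_mod_NP (x y : C) : Prop :=
  exists n p, Nq_space n /\ Pq_ideal p /\ x - y = n + p.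

Definition sum_wt (r m : nat) (f : seq nat -> C) : C :=
  \sum_(e : r.-tuple 'I_m.+1 | ((\sum_(x <- tval e) nat_of_ord x)%N == m))
     f [seq nat_of_ord x | x <- tval e].

End QSets.

(* Main.v *)
(** Write f_m = q^m / [m], S for the operator of partial sums and Y = f S. Encode an index by
    its word in x and y; then Z_q^{S,*}(g_k) is the sum, over the cuts at a letter y of the word
    z_k y, of the product of two iterated sums in which x acts as f and y as f S, the weight of
    each letter to the right of the cut being negated. The maximal runs of y in z_k y are given
    by the dual index, so that the right-hand side lengthens the runs of y, while the left-hand
    side lengthens the runs of x and amounts to giving y the weight f / (1 - T f) S, where T
    marks the weight m. A second variable R marks the position of the cut inside its run.

    The comparison has two parts. First, for the terms in which the run that is cut keeps its
    length, the two generating series agree: modulo N_q the weight f of y may be replaced by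
    f + hbar = 1 / [m] (Bradley-Zhao), for which the q-Ohno relation on each side of the cut
    holds exactly, by means of an explicit kernel intertwining the two weights; the regularising
    products that appear are infinite products of the form prod (1 - R^2 f_m^2), whose
    coefficients are, by Newton's identities, congruent to those of 1 modulo P_q. Secondly, the
    terms in which the run that is cut is lengthened vanish: a product of two iterated sums is
    the sum of their convolution, the partial fraction identity
    f_i f_j = f_(i+j) (f_i + f_j + hbar) with i + j fixed turns it, modulo N_q and up to such a
    product, into f times a difference of two convolutions, and these differences telescope
    over the runs of the word. *)
Require Import Defs.
From HB Require Import structures.
From mathcomp Require Import all_boot all_order all_algebra.
From mathcomp Require Import complex.
From mathcomp Require Import boolp classical_sets reals.
From mathcomp Require Import ring lra zify.
Set Implicit Arguments. Unset Strict Implicit. Unset Printing Implicit Defensive.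
Import Order.TTheory GRing.Theory Num.Theory.
Import Normc.
Local Open Scope ring_scope.

(** * Formal power series *)

(** The obstacle is that the two halves of a cut may end in letters [y]: their separate values then
    need not lie in Z_q, and with [f + hbar] in place of [f] they diverge. This is what the variable
    R is for. Summing over the position of the cut turns each half into a geometric series in R,
    from which a product over all indices splits off. What is left are sums ending in [x], whose
    values lie in Z_q and can be compared modulo N_q. The right half has both variables negated, so
    the two products combine into factors that involve [f_m] only through its square. The comparison
    is an identity between finite sums with a remainder, which must be shown to decay geometrically;
    hence growth rates are tracked besides membership in classes of sequences. The recursions that
    define the series all carry a factor z, so membership is proved by induction on the degree in z.
    Convolution is needed because the two halves are sums over unrelated indices: it puts them under
    one outer index, at which letters can be moved from one half to the other. *)

Definition fps (A : Type) : Type := nat -> A.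

Section FpsRing.
Variable A : comNzRingType.
Implicit Types x y z : fps A.

HB.instance Definition _ := gen_eqMixin (fps A).
HB.instance Definition _ := gen_choiceMixin (fps A).

Definition fps0 : fps A := fun _ => 0.
Definition fps_opp x : fps A := fun n => - x n.
Definition fps_add x y : fps A := fun n => x n + y n.
Definition fps1 : fps A := fun n => (n == 0%N)%:R.
(** As [fps] is a plain function type, the same product also serves as additive convolution of
    sequences of summands. *)
Definition fps_mul x y : fps A := fun n => \sum_(i < n.+1) x i * y (n - i)%N.

Lemma fps_addA : associative fps_add.
Proof. by move=> x y z; apply: funext => n; rewrite /fps_add addrA. Qed.
Lemma fps_addC : commutative fps_add.
Proof. by move=> x y; apply: funext => n; rewrite /fps_add addrC. Qed.
Lemma fps_add0 : left_id fps0 fps_add.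
Proof. by move=> x; apply: funext => n; rewrite /fps_add /fps0 add0r. Qed.
Lemma fps_addN : left_inverse fps0 fps_opp fps_add.
Proof. by move=> x; apply: funext => n; rewrite /fps_add /fps_opp /fps0 addNr. Qed.

HB.instance Definition _ :=
  GRing.isZmodule.Build (fps A) fps_addA fps_addC fps_add0 fps_addN.

Definition fps_trunc n x : {poly A} := \poly_(i < n) x i.

(** A coefficient involves only finitely many others, so commutativity and associativity are
    inherited from polynomials after truncation. *)
Lemma fps_mulE N x y n : (n < N)%N ->
  fps_mul x y n = (fps_trunc N x * fps_trunc N y)`_n.
Proof.
move=> nN; rewrite coefM; apply: eq_bigr => i _.
by rewrite !coef_poly (leq_trans (ltn_ord i) nN) (leq_ltn_trans (leq_subr _ _) nN).
Qed.

Lemma fps_mulC : commutative fps_mul.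
Proof.
by move=> x y; apply: funext => n; rewrite !(fps_mulE _ _ (ltnSn n)) mulrC.
Qed.

Lemma fps_mulA : associative fps_mul.
Proof.
move=> x y z; apply: funext => n.
have tr a b (c : {poly A}) :
    (fps_trunc n.+1 (fps_mul a b) * c)`_n = (fps_trunc n.+1 a * fps_trunc n.+1 b * c)`_n.
  rewrite !coefM; apply: eq_bigr => i _; congr (_ * _).
  by rewrite {1}/fps_trunc coef_poly ltn_ord (fps_mulE _ _ (ltn_ord i)).
rewrite [RHS](fps_mulE _ _ (ltnSn n)) tr -mulrA mulrC.
rewrite [LHS](fps_mulE _ _ (ltnSn n)) [LHS](congr1 (fun p : {poly A} => p`_n) (mulrC _ _)).
by rewrite tr.
Qed.

Lemma fps_mul1 : left_id fps1 fps_mul.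
Proof.
move=> x; apply: funext => n; rewrite /fps_mul big_ord_recl /= mul1r subn0.
by rewrite big1 ?addr0 // => i _; rewrite /fps1 /= mul0r.
Qed.

Lemma fps_mulDl : left_distributive fps_mul fps_add.
Proof.
move=> x y z; apply: funext => n; rewrite /fps_mul /fps_add -big_split /=.
by apply: eq_bigr => i _; rewrite mulrDl.
Qed.

Lemma fps1_neq0 : fps1 != 0 :> fps A.
Proof. by apply/eqP => /(congr1 (fun x => x 0%N)) /eqP; rewrite /fps1 oner_eq0. Qed.

HB.instance Definition _ :=
  GRing.Zmodule_isComNzRing.Build (fps A) fps_mulA fps_mulC fps_mul1 fps_mulDl fps1_neq0.

Lemma fpsD x y n : (x + y) n = x n + y n. Proof. by []. Qed.
Lemma fpsN x n : (- x) n = - x n. Proof. by []. Qed.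
Lemma fpsB x y n : (x - y) n = x n - y n. Proof. by []. Qed.
Lemma fps0E n : (0 : fps A) n = 0. Proof. by []. Qed.
Lemma fps1E n : (1 : fps A) n = (n == 0%N)%:R. Proof. by []. Qed.
Lemma fpsM x y n : (x * y) n = \sum_(i < n.+1) x i * y (n - i)%N. Proof. by []. Qed.
Lemma fps_sum I r (P : pred I) (F : I -> fps A) n :
  (\sum_(i <- r | P i) F i) n = \sum_(i <- r | P i) F i n.
Proof. by elim/big_rec2: _ => // i y1 y2 _ <-. Qed.

Definition fpsC (a : A) : fps A := fun n => if n == 0%N then a else 0.
Definition fpsX : fps A := fun n => (n == 1%N)%:R.

Lemma fpsC_is_zmod_morphism : zmod_morphism fpsC.
Proof. by move=> a b; apply: funext => -[|n]; rewrite fpsB //= /fpsC /= subr0. Qed.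

Lemma fpsCM a x n : (fpsC a * x) n = a * x n.
Proof.
rewrite fpsM big_ord_recl /= subn0 big1 ?addr0 // => i _.
by rewrite /fpsC /= mul0r.
Qed.

Lemma fpsC_is_monoid_morphism : monoid_morphism fpsC.
Proof.
split; first by apply: funext => -[|n].
by move=> a b; apply: funext => n; rewrite fpsCM; case: n => [|n]; rewrite /fpsC //= mulr0.
Qed.

HB.instance Definition _ := GRing.isZmodMorphism.Build A (fps A) fpsC fpsC_is_zmod_morphism.
HB.instance Definition _ := GRing.isMonoidMorphism.Build A (fps A) fpsC fpsC_is_monoid_morphism.

Lemma fpsXM x n : (fpsX * x) n = if n is n'.+1 then x n' else 0.
Proof.
case: n => [|n]; rewrite fpsM.
  by rewrite big_ord_recl big_ord0 /fpsX /= mul0r addr0.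
rewrite big_ord_recl /fpsX /= mul0r add0r big_ord_recl /= mul1r subSS subn0.
by rewrite big1 ?addr0 // => i _; rewrite /= mul0r.
Qed.

Fact fpsX_exp_gt x i n : (n < i)%N -> ((fpsX * x) ^+ i) n = 0.
Proof.
elim: i n => // i IH n ni; rewrite exprS -mulrA fpsXM.
case: n ni => // n ni; rewrite fpsM big1 // => j _.
by rewrite IH ?mulr0 //; apply: leq_ltn_trans (leq_subr _ _) _; rewrite -ltnS.
Qed.

(** The inverse of [1 - fpsX * x]. The sum may stop at [n] because the [i]-th power starts in degree
    [i]. *)
Definition fps_geom x : fps A := fun n => \sum_(i < n.+1) ((fpsX * x) ^+ i) n.

Fact fps_geom_widen x k n : (k <= n)%N ->
  fps_geom x k = \sum_(i < n.+1) ((fpsX * x) ^+ i) k.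
Proof.
move=> kn; rewrite /fps_geom (big_ord_widen n.+1 (fun i => ((fpsX * x) ^+ i) k)) //.
rewrite big_mkcond; apply: eq_bigr => i _; case: ltnP => // ki.
by rewrite fpsX_exp_gt.
Qed.

Lemma fps_geomE x : fps_geom x * (1 - fpsX * x) = 1.
Proof.
set y := fpsX * x; rewrite mulrBr mulr1; apply: funext => n; rewrite fpsB fpsM.
under eq_bigr => k _ do rewrite (@fps_geom_widen x k n) -1?ltnS // mulr_suml.
rewrite exchange_big /=.
under eq_bigr => i _ do rewrite -fpsM -exprSr.
rewrite /fps_geom -/y big_ord_recl [X in _ - X]big_ord_recr /= (@fpsX_exp_gt x n.+1 n) // addr0.
by under eq_bigr do rewrite /bump /= add1n; rewrite addrK expr0 fps1E.
Qed.

End FpsRing.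
(** * Limits and growth rates of complex sequences *)

Definition psum (A : nmodType) (phi : nat -> A) (M : nat) : A := \sum_(m < M) phi m.

Lemma psum0 (A : nmodType) (phi : nat -> A) : psum phi 0 = 0.
Proof. by rewrite /psum big_ord0. Qed.

Lemma psumS (A : nmodType) (phi : nat -> A) M : psum phi M.+1 = psum phi M + phi M.
Proof. by rewrite /psum big_ord_recr. Qed.

Lemma eq_psum (A : nmodType) (phi psi : nat -> A) :
  (forall m, phi m = psi m) -> psum phi =1 psum psi.
Proof. by move=> e M; apply: eq_bigr. Qed.

Lemma psumD (A : nmodType) (phi psi : nat -> A) M :
  psum (fun m => phi m + psi m) M = psum phi M + psum psi M.
Proof. exact: big_split. Qed.

Lemma psumZ (A : pzRingType) (c : A) (phi : nat -> A) M :
  psum (fun m => c * phi m) M = c * psum phi M.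
Proof. by rewrite /psum mulr_sumr. Qed.

(** Splitting the pairs of indices by the larger one gives the quasi-shuffle; the last term is the
    diagonal. *)
Lemma psumM (A : comPzRingType) (phi psi : nat -> A) M :
  psum phi M * psum psi M =
  psum (fun m => psum phi m * psi m + phi m * psum psi m + phi m * psi m) M.
Proof. by elim: M => [|M IH]; rewrite ?psum0 ?mulr0 // !psumS -IH; ring. Qed.

Section Growth.
Variable R : realType.
Local Notation C := R[i].
Implicit Types (phi psi u v : nat -> C) (x l : C).

Lemma normc_ge0 x : 0 <= normc x :> R.
Proof. by case: x => a b; exact: sqrtr_ge0. Qed.

Lemma normc_sum (I : Type) (r : seq I) (P : pred I) (F : I -> C) :
  normc (\sum_(i <- r | P i) F i) <= \sum_(i <- r | P i) normc (F i).
Proof.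
elim/big_rec2: _ => [|i y1 y2 _ h]; first by rewrite normc0.
by apply: le_trans (le_normcD _ _) _; rewrite lerD2l.
Qed.

Lemma normcX x n : normc (x ^+ n) = normc x ^+ n.
Proof. by elim: n => [|n IH]; rewrite ?expr0 ?normc1 // !exprS normcM IH. Qed.

Lemma cvgCP u l :
  cvgC u l <-> (forall eps : R, 0 < eps -> exists N : nat, forall n, (N <= n)%N ->
    normc (u n - l) < eps).
Proof.
by split=> h e e0; have [N hN] := h e e0; exists N => n /hN; rewrite ltcR.
Qed.

Lemma cvgC_unique u l l' : cvgC u l -> cvgC u l' -> l = l'.
Proof.
move=> /cvgCP h /cvgCP h'; apply/eqP; rewrite -subr_eq0; apply/eqP/eq0_normc.
apply/eqP; rewrite eq_le normc_ge0 andbT; apply/ler_addgt0Pr => e e0; rewrite add0r.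
have e2 : 0 < e / 2 by lra.
have [N hN] := h _ e2; have [N' hN'] := h' _ e2.
have := hN _ (leq_maxl N N'); have := hN' _ (leq_maxr N N').
set n := maxn N N'; move=> h1 h2.
have -> : l - l' = - (u n - l) + (u n - l') by ring.
by apply: le_trans (le_normcD _ _) _; rewrite normcN; lra.
Qed.

Lemma limCE u l : cvgC u l -> limC u = l.
Proof.
rewrite /limC => h; case: pselect => [e|[]]; last by exists l.
by case: (cid e) => l' /= h'; apply: cvgC_unique h' h.
Qed.

Lemma cvgC_cst x : cvgC (fun _ => x) x.
Proof. by apply/cvgCP => e e0; exists 0%N => n _; rewrite subrr normc0. Qed.

Lemma cvgCD u v l l' : cvgC u l -> cvgC v l' -> cvgC (fun n => u n + v n) (l + l').
Proof.
move=> /cvgCP h /cvgCP h'; apply/cvgCP => e e0.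
have e2 : 0 < e / 2 by lra.
have [N hN] := h _ e2; have [N' hN'] := h' _ e2; exists (maxn N N') => n.
rewrite geq_max => /andP[/hN h1 /hN' h2].
have -> : u n + v n - (l + l') = (u n - l) + (v n - l') by ring.
by apply: le_lt_trans (le_normcD _ _) _; lra.
Qed.

Lemma cvgC_bounded u l : cvgC u l -> exists2 B : R, 0 < B & forall n, normc (u n) <= B.
Proof.
move=> /cvgCP /(_ 1 ltr01)[N hN].
exists (1 + normc l + \sum_(i < N) normc (u i)).
  by have := normc_ge0 l; have : 0 <= \sum_(i < N) normc (u i) :> R
    by [apply: sumr_ge0 => i _; exact: normc_ge0]; lra.
move=> n; case: (ltnP n N) => nN.
  rewrite (bigD1 (Ordinal nN)) //=.
  have := normc_ge0 l.
  have : 0 <= \sum_(i < N | i != Ordinal nN) normc (u i) :> R.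
    by apply: sumr_ge0 => i _; exact: normc_ge0.
  by lra.
have -> : u n = (u n - l) + l by ring.
apply: le_trans (le_normcD _ _) _; have := hN _ nN.
have : 0 <= \sum_(i < N) normc (u i) :> R by apply: sumr_ge0 => i _; exact: normc_ge0.
by lra.
Qed.

Lemma cvgCM u v l l' : cvgC u l -> cvgC v l' -> cvgC (fun n => u n * v n) (l * l').
Proof.
move=> hu hv; have [B B0 hB] := cvgC_bounded hu.
move/cvgCP: hu => h; move/cvgCP: hv => h'; apply/cvgCP => e e0.
have nl := normc_ge0 l'.
have e1 : 0 < e / 2 / B by rewrite !divr_gt0.
have e2 : 0 < e / 2 / (1 + normc l') by rewrite !divr_gt0 //; lra.
have [N hN] := h _ e2; have [N' hN'] := h' _ e1; exists (maxn N N') => n.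
rewrite geq_max => /andP[/hN h1 /hN' h2].
have -> : u n * v n - l * l' = u n * (v n - l') + (u n - l) * l' by ring.
apply: le_lt_trans (le_normcD _ _) _; rewrite !normcM.
have : normc (u n) * normc (v n - l') <= B * normc (v n - l').
  by apply: ler_wpM2r; rewrite ?normc_ge0.
move: h2; rewrite ltr_pdivlMr // mulrC => h2 h3.
have : normc (u n - l) * normc l' <= normc (u n - l) * (1 + normc l').
  by apply: ler_wpM2l; rewrite ?normc_ge0 //; lra.
by move: h1; rewrite ltr_pdivlMr; lra.
Qed.

Lemma cvgC_eq u v l : u =1 v -> cvgC u l -> cvgC v l.
Proof. by move=> /funext ->. Qed.

Lemma cvgC_sum (I : Type) (r : seq I) (P : pred I) (F : I -> nat -> C) (L : I -> C) :
  (forall i, cvgC (F i) (L i)) ->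
  cvgC (fun n => \sum_(i <- r | P i) F i n) (\sum_(i <- r | P i) L i).
Proof.
move=> h; elim: r => [|i r IH].
  by rewrite big_nil; apply: cvgC_eq (cvgC_cst 0) => n; rewrite big_nil.
rewrite big_cons; case: ifP => Pi.
  by apply: cvgC_eq (cvgCD (h i) IH) => n; rewrite big_cons Pi.
by apply: cvgC_eq IH => n; rewrite big_cons Pi.
Qed.

Lemma monotone_cvg (x : nat -> R) (B : R) :
  (forall n, x n <= x n.+1) -> (forall n, x n <= B) ->
  exists l : R, forall e, 0 < e -> exists N, forall n, (N <= n)%N -> `|x n - l| < e.
Proof.
move=> inc bnd; pose E : R -> Prop := fun r => exists n, r = x n.
have hE : has_sup E.
  by split; [exists (x 0%N), 0%N | exists B => _ [n ->]].
have mono m n : (m <= n)%N -> x m <= x n.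
  by elim: n => [|n IH]; rewrite leq_eqVlt => /orP[/eqP -> //|//] /IH h; apply: le_trans h _.
exists (sup E) => e e0; have [_ [N ->] hN] := sup_adherent e0 hE.
exists N => n /mono h; have : x n <= sup E by apply: sup_upper_bound => //; exists n.
by rewrite ltr_distl; lra.
Qed.

(** The partial sums of [a n + B * t ^+ n] and of [B * t ^+ n] are both increasing and bounded; the
    series is their difference. *)
Lemma real_series_cvg (a : nat -> R) (B t : R) : 0 <= t -> t < 1 ->
  (forall n, `|a n| <= B * t ^+ n) ->
  exists l : R, forall e, 0 < e -> exists N, forall n, (N <= n)%N -> `|psum a n - l| < e.
Proof.
move=> t0 t1 h.
have B0 : 0 <= B by have := h 0%N; rewrite expr0 mulr1; apply: le_trans.
have tn n : 0 <= B * t ^+ n by rewrite mulr_ge0 // exprn_ge0.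
have gs n : psum (fun i => B * t ^+ i) n <= B * (1 - t)^-1.
  rewrite psumZ; apply: ler_wpM2l => //.
  have d0 : 0 < 1 - t by lra.
  have -> : psum (fun i => t ^+ i) n = (1 - t ^+ n) / (1 - t).
    elim: n => [|n IH]; first by rewrite psum0 expr0 subrr mul0r.
    by rewrite psumS IH exprS; field; rewrite gt_eqF.
  by rewrite ler_pdivrMr // mulVf ?gt_eqF // lerBlDr lerDl exprn_ge0.
have [l1 h1] : exists l : R, forall e, 0 < e -> exists N, forall n, (N <= n)%N ->
    `|psum (fun i => a i + B * t ^+ i) n - l| < e.
  apply: (@monotone_cvg _ (2 * (B * (1 - t)^-1))) => n.
    by rewrite psumS lerDl; have := h n; rewrite ler_norml; lra.
  apply: le_trans (_ : psum (fun i => 2 * (B * t ^+ i)) n <= _).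
    by apply: ler_sum => i _; have := h i; rewrite ler_norml; lra.
  by rewrite psumZ; have := gs n; lra.
have [l2 h2] : exists l : R, forall e, 0 < e -> exists N, forall n, (N <= n)%N ->
    `|psum (fun i => B * t ^+ i) n - l| < e.
  by apply: monotone_cvg gs => n; rewrite psumS lerDl.
exists (l1 - l2) => e e0; have e2 : 0 < e / 2 by lra.
have [N hN] := h1 _ e2; have [N' hN'] := h2 _ e2; exists (maxn N N') => n.
rewrite geq_max => /andP[/hN H1 /hN' H2]; move: H1 H2.
rewrite psumD; set x := psum a n; set y := psum _ n.
by rewrite !ltr_norml; lra.
Qed.

Lemma psum_re phi n : complex.Re (psum phi n) = psum (fun i => complex.Re (phi i)) n.
Proof. by elim: n => [|n IH]; rewrite ?psum0 // !psumS -IH; case: (psum phi n) (phi n) => a b [c d]. Qed.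

Lemma psum_im phi n : complex.Im (psum phi n) = psum (fun i => complex.Im (phi i)) n.
Proof. by elim: n => [|n IH]; rewrite ?psum0 // !psumS -IH; case: (psum phi n) (phi n) => a b [c d]. Qed.

Lemma re_le_normc x : `|complex.Re x| <= normc x.
Proof. by case: x => a b /=; rewrite -sqrtr_sqr ler_sqrt ?lerDl ?addr_ge0 ?sqr_ge0. Qed.

Lemma im_le_normc x : `|complex.Im x| <= normc x.
Proof. by case: x => a b /=; rewrite -sqrtr_sqr ler_sqrt ?lerDr ?addr_ge0 ?sqr_ge0. Qed.

Lemma normc_le_reim x : normc x <= `|complex.Re x| + `|complex.Im x|.
Proof.
case: x => a b /=; rewrite -(@ger0_norm _ (`|a| + `|b|)) ?addr_ge0 // -sqrtr_sqr.
rewrite ler_sqrt ?sqr_ge0 // sqrrD !real_normK ?num_real //.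
by have : 0 <= `|a| * `|b| by [rewrite mulr_ge0]; lra.
Qed.

Lemma series_cvg phi (B t : R) : 0 <= t -> t < 1 ->
  (forall n, normc (phi n) <= B * t ^+ n) -> exists l, cvgC (psum phi) l.
Proof.
move=> t0 t1 h.
have [l1 h1] : exists l : R, forall e, 0 < e -> exists N, forall n, (N <= n)%N ->
    `|psum (fun i => complex.Re (phi i)) n - l| < e.
  by apply: (real_series_cvg t0 t1) => n; apply: le_trans (re_le_normc _) (h n).
have [l2 h2] : exists l : R, forall e, 0 < e -> exists N, forall n, (N <= n)%N ->
    `|psum (fun i => complex.Im (phi i)) n - l| < e.
  by apply: (real_series_cvg t0 t1) => n; apply: le_trans (im_le_normc _) (h n).
exists (Complex l1 l2); apply/cvgCP => e e0; have e2 : 0 < e / 2 by lra.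
have [N hN] := h1 _ e2; have [N' hN'] := h2 _ e2; exists (maxn N N') => n.
rewrite geq_max => /andP[/hN H1 /hN' H2]; apply: le_lt_trans (normc_le_reim _) _.
move: H1 H2; rewrite -psum_re -psum_im; case: (psum phi n) => a b /=; lra.
Qed.

(* [rate r phi]: up to subexponential factors, [phi n] is at most [r ^ n]. *)
Definition rate (r : R) phi : Prop :=
  forall s : R, 1 < s -> exists B : R, forall n, normc (phi n) <= B * (s * r) ^+ n.

Lemma rate_ge0 (r s B : R) phi : (forall n, normc (phi n) <= B * (s * r) ^+ n) -> 0 <= B.
Proof. by move=> /(_ 0%N); rewrite expr0 mulr1; apply: le_trans; exact: normc_ge0. Qed.

Lemma rate0 r : 0 <= r -> rate r (fun _ => 0).
Proof. by move=> r0 s s1; exists 0 => n; rewrite normc0 mul0r. Qed.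

Lemma rate1 : rate 1 (fun _ => 1).
Proof. by move=> s s1; exists 1 => n; rewrite normc1 mul1r mulr1 exprn_ege1 // ltW. Qed.

Lemma rateD r phi psi : rate r phi -> rate r psi -> rate r (fun n => phi n + psi n).
Proof.
move=> h1 h2 s s1; have [B hB] := h1 s s1; have [B' hB'] := h2 s s1.
by exists (B + B') => n; apply: le_trans (le_normcD _ _) _; rewrite mulrDl lerD.
Qed.

Lemma rateZ r c phi : rate r phi -> rate r (fun n => c * phi n).
Proof.
move=> h s s1; have [B hB] := h s s1; exists (normc c * B) => n.
by rewrite normcM -mulrA ler_wpM2l ?normc_ge0.
Qed.

Lemma rateM r r' phi psi : 0 <= r -> 0 <= r' -> rate r phi -> rate r' psi ->
  rate (r * r') (fun n => phi n * psi n).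
Proof.
(* Each factor receives a square root of the slack [s]. *)
move=> r0 r'0 h1 h2 s s1; pose t := Num.sqrt s.
have t1 : 1 < t by rewrite -[1]sqrtr1 ltr_sqrt //; lra.
have ts : s = t * t by rewrite -expr2 sqr_sqrtr //; lra.
have [B hB] := h1 t t1; have [B' hB'] := h2 t t1; exists (B * B') => n.
rewrite normcM ts [t * t * _]mulrACA exprMn mulrACA.
by apply: ler_pM; rewrite ?normc_ge0.
Qed.

Lemma rate_le r r' phi : 0 <= r -> r <= r' -> rate r phi -> rate r' phi.
Proof.
move=> r0 rr h s s1; have [B hB] := h s s1; exists B => n; apply: le_trans (hB n) _.
have B0 := rate_ge0 hB.
have s0 : 0 <= s by lra.
by apply: ler_wpM2l => //; apply: lerXn2r; rewrite ?nnegrE ?ler_wpM2l ?mulr_ge0 //; lra.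
Qed.

Lemma nat_le_exp (s : R) : 1 < s -> exists B : R, forall n, n%:R <= B * s ^+ n.
Proof.
move=> s1; exists (s - 1)^-1 => n; have d0 : 0 < s - 1 by lra.
rewrite mulrC ler_pdivlMr //.
suff : 1 + n%:R * (s - 1) <= s ^+ n by lra.
elim: n => [|n IH]; first by rewrite expr0 mul0r addr0.
rewrite exprS -natr1; have n0 : 0 <= n%:R :> R by exact: ler0n.
have : s * (1 + n%:R * (s - 1)) <= s * s ^+ n by apply: ler_wpM2l => //; lra.
by have : 0 <= n%:R * (s - 1) * (s - 1) by [rewrite !mulr_ge0 //; lra]; nra.
Qed.

Lemma rate_psum phi : rate 1 phi -> rate 1 (psum phi).
Proof.
(* One root of the slack pays for the growth of [phi], the other for the number of terms. *)
move=> h s s1; pose t := Num.sqrt s.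
have t1 : 1 < t by rewrite -[1]sqrtr1 ltr_sqrt //; lra.
have ts : s = t * t by rewrite -expr2 sqr_sqrtr //; lra.
have [B hB] := h t t1; have [B' hB'] := nat_le_exp t1; have B0 := rate_ge0 hB.
exists (B * B') => n; apply: le_trans (normc_sum _ _ _) _.
apply: le_trans (_ : \sum_(i < n) B * t ^+ n <= _).
  apply: ler_sum => i _; apply: le_trans (hB i) _; rewrite mulr1.
  by apply: ler_wpM2l => //; rewrite ler_eXn2l // ltnW.
rewrite sumr_const card_ord -mulr_natl mulrCA mulr1 ts exprMn -[B * B' * _]mulrA.
apply: ler_wpM2l => //; rewrite mulrA; apply: ler_wpM2r => //.
by rewrite exprn_ge0 //; lra.
Qed.

Lemma rate_geom_bound (r : R) phi : 0 < r < 1 -> rate r phi ->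
  exists B t : R, [/\ 0 <= t, t < 1 & forall n, normc (phi n) <= B * t ^+ n].
Proof.
move=> /andP[r0 r1] h; pose s := (1 + r^-1) / 2.
have ri : 1 < r^-1 by rewrite invf_gt1.
have s1 : 1 < s by rewrite /s; lra.
have sr : s * r = (r + 1) / 2 by rewrite /s; field; rewrite gt_eqF.
have [B hB] := h s s1; exists B, (s * r); split => //; rewrite sr; lra.
Qed.

Lemma rate_summable r phi : 0 < r < 1 -> rate r phi -> exists l, cvgC (psum phi) l.
Proof. by move=> h /(rate_geom_bound h)[B [t [t0 t1]]]; exact: series_cvg. Qed.

Lemma geom_cvg0 (B t e : R) : 0 <= t -> t < 1 -> 0 < e ->
  exists N, forall n, (N <= n)%N -> B * t ^+ n < e.
Proof.
move=> t0 t1 e0; case: (eqVneq t 0) => [->|tn0].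
  by exists 1%N => n n0; rewrite expr0n gtn_eqF // mulr0.
have tp : 0 < t by rewrite lt_neqAle eq_sym tn0.
have ti : 1 < t^-1 by rewrite invf_gt1.
have [D hD] := nat_le_exp ti.
have [N hN] : exists N, `|B * D| / e < N%:R.
  exists (Num.Def.archi_bound (`|B * D| / e)); apply: archi_boundP.
  by rewrite divr_ge0 // ltW.
exists N => n Nn; case: (lerP B 0) => B0.
  by apply: le_lt_trans e0; rewrite mulr_le0_ge0 ?exprn_ge0.
have n0 : 0 < n%:R :> R.
  apply: lt_le_trans (_ : N%:R <= _); last by rewrite ler_nat.
  by apply: le_lt_trans hN; rewrite divr_ge0 // ltW.
have := hD n; rewrite exprVn ler_pdivlMr ?exprn_gt0 // => h.
have h1 : B * (n%:R * t ^+ n) <= `|B * D|.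
  by apply: le_trans (ler_norm _); rewrite ler_wpM2l // ltW.
have h2 : `|B * D| < n%:R * e.
  move: hN; rewrite ltr_pdivrMr // => /lt_le_trans; apply.
  by rewrite ler_wpM2r ?ler_nat // ltW.
by rewrite -(ltr_pM2l n0) mulrCA; apply: le_lt_trans h1 h2.
Qed.

Lemma rate_cvg0 r phi : 0 < r < 1 -> rate r phi -> cvgC phi 0.
Proof.
move=> h /(rate_geom_bound h)[B [t [t0 t1 hB]]]; apply/cvgCP => e e0.
have [N hN] := geom_cvg0 B t0 t1 e0; exists N => n Nn.
by rewrite subr0; apply: le_lt_trans (hB n) (hN n Nn).
Qed.

End Growth.
(** * Partial sums of words and their ideals *)

Section Classes.
Variables (R : realType) (q : R[i]).
Local Notation C := R[i].
Implicit Types (phi psi : nat -> C) (u v : letter) (p : {poly rat}).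

Definition fw (m : nat) : C := q ^+ m / qint q m.
(** Forced to vanish at 0, where [Fq] would give [1 - q] for [Hb], so that sums over [0 < m < M]
    become plain [psum]. *)
Definition lw u (m : nat) : C := if m is 0 then 0 else Fq q m u.

Lemma lw0 u : lw u 0 = 0. Proof. by []. Qed.

(** A pole replaced by the default value 0 of division; the partial fraction identities therefore
    hold for positive indices only. *)
Lemma fw0 : fw 0 = 0.
Proof. by rewrite /fw /qint expr0 subrr mul0r invr0 mulr0. Qed.

Lemma lwG k m : (0 < k)%N -> lw (G k) m = fw m ^+ k.
Proof.
case: m => [|m] k0; first by rewrite fw0 expr0n gtn_eqF.
by rewrite /= /fw [RHS]exprMn exprVn mulnC exprM.
Qed.

Lemma lwG1 m : lw (G 1) m = fw m. Proof. by rewrite lwG ?expr1. Qed.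

Lemma evD p p' : ev q (p + p') = ev q p + ev q p'.
Proof. by rewrite /ev rmorphD hornerD. Qed.
Lemma evM p p' : ev q (p * p') = ev q p * ev q p'.
Proof. by rewrite /ev rmorphM hornerM. Qed.
Lemma evN p : ev q (- p) = - ev q p.
Proof. by rewrite /ev rmorphN hornerN. Qed.
Lemma evX : ev q 'X = 1 - q.
Proof. by rewrite /ev map_polyX hornerX. Qed.
Lemma ev1 : ev q 1 = 1.
Proof. by rewrite /ev rmorph1 hornerC. Qed.
Lemma ev0 : ev q 0 = 0.
Proof. by rewrite /ev rmorph0 hornerC. Qed.
Lemma evC c : ev q c%:P = ratr c.
Proof. by rewrite /ev map_polyC hornerC. Qed.

Lemma lw_circ u v m : valid_letter u -> valid_letter v ->
  lw u m * lw v m = ev q (circ u v).1 * lw (circ u v).2 m.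
Proof.
case: u v => [|k] [|l] /= k0 l0; case: m => [|m]; rewrite ?lw0 ?mulr0 //= ?evX //.
- by rewrite mulrC.
- rewrite ev1 mul1r mulrACA -exprD -mulnDl -invfM exprD; congr (_ / _).
Qed.

Lemma circ_valid u v : valid_letter u -> valid_letter v -> valid_letter (circ u v).2.
Proof. by case: u v => [|k] [|l] //= k0 l0; rewrite addn_gt0 k0. Qed.

(** Truncated values of combinations of words, as functions of the upper bound. Only positive bounds
    count: the empty word has value 1 everywhere, while every [psum] is 0 at the bound 0. *)
Inductive W : (nat -> C) -> Prop :=
| W_one : W (fun _ => 1)
| W_scale p phi : W phi -> W (fun n => ev q p * phi n)
| W_add phi psi : W phi -> W psi -> W (fun n => phi n + psi n)
| W_letter u phi : valid_letter u -> W phi -> W (psum (fun m => lw u m * phi m))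
| W_eq phi psi : (forall M, (0 < M)%N -> phi M = psi M) -> W phi -> W psi.

(* Multiplied by [fw ^ k], the elements of [I] have null sums for [k >= 2] and those of [J]
   for [k >= 1]: beyond multiples of [hbar], [I] is spanned by the words containing [Hb], and
   [J] by the words containing [Hb] and later some [G k] with [k >= 2]. *)
Inductive I : (nat -> C) -> Prop :=
| I_hbar phi : W phi -> I (fun n => (1 - q) * phi n)
| I_Hb phi : W phi -> I (psum (fun m => lw Hb m * phi m))
| I_scale p phi : I phi -> I (fun n => ev q p * phi n)
| I_add phi psi : I phi -> I psi -> I (fun n => phi n + psi n)
| I_letter u phi : valid_letter u -> I phi -> I (psum (fun m => lw u m * phi m))
| I_eq phi psi : (forall M, (0 < M)%N -> phi M = psi M) -> I phi -> I psi.

Inductive J : (nat -> C) -> Prop :=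
| J_hbar phi : W phi -> J (fun n => (1 - q) * phi n)
| J_G k phi : (1 < k)%N -> I phi -> J (psum (fun m => lw (G k) m * phi m))
| J_scale p phi : J phi -> J (fun n => ev q p * phi n)
| J_add phi psi : J phi -> J psi -> J (fun n => phi n + psi n)
| J_letter u phi : valid_letter u -> J phi -> J (psum (fun m => lw u m * phi m))
| J_eq phi psi : (forall M, (0 < M)%N -> phi M = psi M) -> J phi -> J psi.

Record modclass (X : (nat -> C) -> Prop) : Prop := ModClass {
  mod_add : forall phi psi, X phi -> X psi -> X (fun n => phi n + psi n);
  mod_scale : forall p phi, X phi -> X (fun n => ev q p * phi n);
  mod_inh : exists phi, X phi }.

Lemma class_eq (X : (nat -> C) -> Prop) phi psi : phi =1 psi -> X phi -> X psi.
Proof. by move=> /funext ->. Qed.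

Lemma mod_zero X : modclass X -> X (fun _ => 0).
Proof.
case=> _ sc [phi /(sc 0)]; apply: class_eq => n.
by rewrite ev0 mul0r.
Qed.

Lemma mod_opp X phi : modclass X -> X phi -> X (fun n => - phi n).
Proof. by case=> _ sc _ /(sc (-1)); apply: class_eq => n; rewrite evN ev1 mulN1r. Qed.

Lemma mod_sub X phi psi : modclass X -> X phi -> X psi -> X (fun n => phi n - psi n).
Proof. by move=> mX h1 h2; apply: (mod_add mX h1); apply: mod_opp. Qed.

Lemma mod_hbar X phi : modclass X -> X phi -> X (fun n => (1 - q) * phi n).
Proof. by case=> _ sc _ /(sc 'X); apply: class_eq => n; rewrite evX. Qed.

Lemma mod_sum X (T : Type) (r : seq T) (P : pred T) (F : T -> nat -> C) :
  modclass X -> (forall i, P i -> X (F i)) -> X (fun n => \sum_(i <- r | P i) F i n).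
Proof.
move=> mX h; elim: r => [|i r IH].
  by apply: class_eq (mod_zero mX) => n; rewrite big_nil.
case Pi: (P i); last by apply: class_eq IH => n; rewrite big_cons Pi.
by apply: class_eq (mod_add mX (h i Pi) IH) => n; rewrite big_cons Pi.
Qed.

Lemma modW : modclass W.
Proof. split; [exact: W_add | exact: W_scale | by exists (fun _ => 1); exact: W_one]. Qed.
Lemma modI : modclass I.
Proof. split; [exact: I_add | exact: I_scale | by exists (fun _ => (1 - q) * 1); apply: I_hbar; exact: W_one]. Qed.
Lemma modJ : modclass J.
Proof. split; [exact: J_add | exact: J_scale | by exists (fun _ => (1 - q) * 1); apply: J_hbar; exact: W_one]. Qed.

Lemma IW phi : I phi -> W phi.
Proof.
elim=> {phi} [phi|phi|p phi _|phi psi _ h _|u phi uv _|phi psi e _].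
- exact: (mod_hbar modW).
- exact: W_letter.
- exact: W_scale.
- exact: W_add.
- exact: W_letter.
- exact: W_eq.
Qed.

Lemma JI phi : J phi -> I phi.
Proof.
elim=> {phi} [phi|k phi k1|p phi _|phi psi _ h _|u phi uv _|phi psi e _].
- exact: I_hbar.
- by apply: I_letter => /=; lia.
- exact: I_scale.
- exact: I_add.
- exact: I_letter.
- exact: I_eq.
Qed.

(** Induction on both factors along the quasi-shuffle [psumM]; [lw_circ] turns the diagonal term
    into a single letter. *)
Lemma WM phi psi : W phi -> W psi -> W (fun n => phi n * psi n).
Proof.
move=> hp; elim: hp psi => {phi} [|p phi _ IH|phi phi' _ IH _ IH'|u phi uv wphi IH|phi phi' e _ IH] psi hs.
- by apply: class_eq hs => n; rewrite mul1r.
- by apply: class_eq (W_scale p (IH _ hs)) => n; rewrite mulrA.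
- by apply: class_eq (W_add (IH _ hs) (IH' _ hs)) => n; rewrite mulrDl.
- have wl := W_letter uv wphi.
  elim: hs => {psi} [|p psi _ IHs|psi psi' _ IHs _ IHs'|v psi vv wpsi IHs|psi psi' e _ IHs].
  + by apply: class_eq wl => n; rewrite mulr1.
  + by apply: class_eq (W_scale p IHs) => n; rewrite mulrCA.
  + by apply: class_eq (W_add IHs IHs') => n; rewrite mulrDr.
  + have w1 := W_letter uv (IH _ (W_letter vv wpsi)).
    have w2 := W_letter vv IHs.
    have w3 := W_scale (circ u v).1 (W_letter (circ_valid uv vv) (IH _ wpsi)).
    apply: class_eq (W_add (W_add w2 w1) w3) => n.
    rewrite psumM -psumZ -!psumD; apply: eq_psum => m.
    have -> : lw u m * phi m * (lw v m * psi m) =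
      (lw u m * lw v m) * (phi m * psi m) by ring.
    by rewrite (lw_circ _ uv vv); ring.
  + by apply: W_eq IHs => M M0; rewrite e.
- by apply: W_eq (IH _ hs) => M M0; rewrite e.
Qed.

(** Each term of the quasi-shuffle keeps the letter [Hb], except a diagonal term that absorbs it,
    and that one leaves a factor hbar. *)
Lemma I_M phi psi : I phi -> W psi -> I (fun n => phi n * psi n).
Proof.
move=> hp; elim: hp psi => {phi} [phi wphi|phi wphi|p phi _ IH|phi phi' _ IH _ IH'|u phi uv iphi IH|phi phi' e _ IH] psi hs.
- by apply: class_eq (I_hbar (WM wphi hs)) => n; rewrite mulrA.
- elim: hs => {psi} [|p psi _ IHs|psi psi' _ IHs _ IHs'|v psi vv wpsi IHs|psi psi' e _ IHs].
  + by apply: class_eq (I_Hb wphi) => n; rewrite mulr1.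
  + by apply: class_eq (I_scale p IHs) => n; rewrite mulrCA.
  + by apply: class_eq (I_add IHs IHs') => n; rewrite mulrDr.
  + have w1 := I_Hb (WM wphi (W_letter vv wpsi)).
    have w2 := I_letter vv IHs.
    have w3 : I (fun n => (1 - q) * psum (fun m => lw v m * (phi m * psi m)) n).
      by apply: I_hbar; apply: W_letter => //; exact: WM.
    apply: class_eq (I_add (I_add w2 w1) w3) => n.
    rewrite psumM -psumZ -!psumD; apply: eq_psum => m.
    have -> : lw Hb m * phi m * (lw v m * psi m) =
      (lw Hb m * lw v m) * (phi m * psi m) by ring.
    by case: m => [|m]; rewrite ?lw0 /=; ring.
  + by apply: I_eq IHs => M M0; rewrite e.
- by apply: class_eq (I_scale p (IH _ hs)) => n; rewrite mulrA.
- by apply: class_eq (I_add (IH _ hs) (IH' _ hs)) => n; rewrite mulrDl.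
- have wl := I_letter uv iphi.
  elim: hs => {psi} [|p psi _ IHs|psi psi' _ IHs _ IHs'|v psi vv wpsi IHs|psi psi' e _ IHs].
  + by apply: class_eq wl => n; rewrite mulr1.
  + by apply: class_eq (I_scale p IHs) => n; rewrite mulrCA.
  + by apply: class_eq (I_add IHs IHs') => n; rewrite mulrDr.
  + have w1 := I_letter uv (IH _ (W_letter vv wpsi)).
    have w2 := I_letter vv IHs.
    have w3 := I_scale (circ u v).1 (I_letter (circ_valid uv vv) (IH _ wpsi)).
    apply: class_eq (I_add (I_add w2 w1) w3) => n.
    rewrite psumM -psumZ -!psumD; apply: eq_psum => m.
    have -> : lw u m * phi m * (lw v m * psi m) =
      (lw u m * lw v m) * (phi m * psi m) by ring.
    by rewrite (lw_circ _ uv vv); ring.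
  + by apply: I_eq IHs => M M0; rewrite e.
- by apply: I_eq (IH _ hs) => M M0; rewrite e.
Qed.

(** Spans of summands rather than of sums: the last letter stays visible, so that multiplication by
    another letter acts on it through [circ]. *)
Inductive lspan (P : letter -> (nat -> C) -> Prop) : (nat -> C) -> Prop :=
| lspan_zero : lspan P (fun _ => 0)
| lspan_gen u phi : P u phi -> lspan P (fun m => lw u m * phi m)
| lspan_add phi psi : lspan P phi -> lspan P psi -> lspan P (fun n => phi n + psi n)
| lspan_scale p phi : lspan P phi -> lspan P (fun n => ev q p * phi n).

Lemma modlspan P : modclass (lspan P).
Proof. split; [exact: lspan_add | exact: lspan_scale | by exists (fun _ => 0); exact: lspan_zero]. Qed.

Lemma lspan_map P P' : (forall u phi, P u phi -> P' u phi) -> forall phi, lspan P phi -> lspan P' phi.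
Proof.
move=> h phi; elim=> {phi} [|u phi hu|phi psi _ + _|p phi _].
- exact: lspan_zero.
- by apply: lspan_gen; apply: h.
- exact: lspan_add.
- exact: lspan_scale.
Qed.

Lemma lspanM P P' psi : (forall u phi, P u phi -> P' u (fun n => phi n * psi n)) ->
  forall phi, lspan P phi -> lspan P' (fun n => phi n * psi n).
Proof.
move=> h phi; elim=> {phi} [|u phi hu|phi psi' _ h1 _ h2|p phi _ h1].
- by apply: class_eq (lspan_zero _) => n; rewrite mul0r.
- by apply: class_eq (lspan_gen (h _ _ hu)) => n; rewrite mulrA.
- by apply: class_eq (lspan_add h1 h2) => n; rewrite mulrDl.
- by apply: class_eq (lspan_scale p h1) => n; rewrite mulrA.
Qed.

Lemma lspan_lw P P' v : valid_letter v ->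
  (forall u phi, P u phi -> valid_letter u /\
     P' (circ v u).2 (fun n => ev q (circ v u).1 * phi n)) ->
  forall phi, lspan P phi -> lspan P' (fun n => lw v n * phi n).
Proof.
move=> vv h phi; elim=> {phi} [|u phi hu|phi psi' _ h1 _ h2|p phi _ h1].
- by apply: class_eq (lspan_zero _) => n; rewrite mulr0.
- have [uv hu'] := h _ _ hu; apply: class_eq (lspan_gen hu') => n.
  by rewrite mulrCA !mulrA (lw_circ _ vv uv).
- by apply: class_eq (lspan_add h1 h2) => n; rewrite mulrDr.
- by apply: class_eq (lspan_scale p h1) => n; rewrite mulrCA.
Qed.

Lemma lspan_psum P X : modclass X ->
  (forall u phi, P u phi -> X (psum (fun m => lw u m * phi m))) ->
  forall phi, lspan P phi -> X (psum phi).
Proof.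
move=> mX h phi; elim=> {phi} [|u phi hu|phi psi' _ h1 _ h2|p phi _ h1].
- by apply: class_eq (mod_zero mX) => n; rewrite /psum big1.
- exact: h.
- by apply: class_eq (mod_add mX h1 h2) => n; rewrite psumD.
- by apply: class_eq (mod_scale mX p h1) => n; rewrite psumZ.
Qed.

Lemma lspan_at0 P phi : lspan P phi -> phi 0%N = 0.
Proof.
elim=> {phi} [|u phi hu|phi psi' _ h1 _ h2|p phi _ h1] //.
- by rewrite mul0r.
- by rewrite h1 h2 addr0.
- by rewrite h1 mulr0.
Qed.

Definition isHb u := if u is Hb then true else false.
Definition isG (k0 : nat) u := if u is G k then (k0 <= k)%N else false.

(* The sums of [Sc] converge, those of [S2] have values in Z_q, those of [N2] and [Nl] in N_q. *)
Definition genSt u phi := valid_letter u /\ W phi.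
Definition genSn u phi := (valid_letter u /\ I phi) \/ (isHb u /\ W phi).
Definition genSc u phi := isG 1 u /\ W phi.
Definition genS2 u phi := (isG 2 u /\ W phi) \/
  (isG 1 u /\ exists2 psi, W psi & phi = (fun n => (1 - q) * psi n)).
Definition genN2 u phi := (isG 2 u /\ I phi) \/
  (isG 1 u /\ exists2 psi, W psi & phi = (fun n => (1 - q) * psi n)).
Definition genNl u phi := (isG 2 u /\ I phi) \/ (isG 1 u /\ J phi).

Notation St := (lspan genSt).
Notation Sn := (lspan genSn).
Notation Sc := (lspan genSc).
Notation S2 := (lspan genS2).
Notation N2 := (lspan genN2).
Notation Nl := (lspan genNl).

Lemma Sc_St phi : Sc phi -> St phi.
Proof. by apply: lspan_map => -[|k] {}phi []. Qed.
Lemma S2_Sc phi : S2 phi -> Sc phi.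
Proof.
apply: lspan_map => -[|k] {}phi [[]|[]] //= => k2 w; split => //=; first by lia.
by case: w => psi w ->; exact: (mod_hbar modW).
Qed.
Lemma N2_S2 phi : N2 phi -> S2 phi.
Proof.
apply: lspan_map => -[|k] {}phi [[]|[]] //= k2 w; first by left; split => //; exact: IW.
by right.
Qed.
Lemma N2_Nl phi : N2 phi -> Nl phi.
Proof.
apply: lspan_map => -[|k] {}phi [[]|[]] //= k2 w; first by left.
by right; split => //; case: w => psi w ->; exact: J_hbar.
Qed.
Lemma Sc_hbar phi : Sc phi -> N2 (fun n => (1 - q) * phi n).
Proof.
move=> h; apply: (@class_eq _ (fun n => phi n * (1 - q))) => [n|]; first by rewrite mulrC.
apply: (lspanM (P := genSc)) h => u {}phi [uG w]; right; split => //.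
by exists phi => //; apply: funext => n; rewrite mulrC.
Qed.

Lemma St_psum phi : St phi -> W (psum phi).
Proof. by apply: lspan_psum => [|u {}phi []]; [exact: modW | exact: W_letter]. Qed.
Lemma Sn_psum phi : Sn phi -> I (psum phi).
Proof.
apply: lspan_psum => [|u {}phi [[]|[]]]; first exact: modI.
  exact: I_letter.
by case: u => // _ /I_Hb.
Qed.
Lemma Nl_psum phi : Nl phi -> J (psum phi).
Proof.
apply: lspan_psum => [|[|k] {}phi [[]|[]] //= k0 h]; first exact: modJ.
  exact: J_G.
exact: J_letter.
Qed.

Lemma StM phi psi : St phi -> W psi -> St (fun n => phi n * psi n).
Proof. by move=> + h; apply: lspanM => u {}phi [uv w]; split => //; exact: WM. Qed.
Lemma SnM phi psi : Sn phi -> W psi -> Sn (fun n => phi n * psi n).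
Proof.
move=> + h; apply: lspanM => u {}phi [[uv w]|[uv w]]; [left|right]; split => //.
  exact: I_M.
exact: WM.
Qed.
Lemma StI phi psi : St phi -> I psi -> Sn (fun n => phi n * psi n).
Proof.
move=> + h; apply: lspanM => u {}phi [uv w]; left; split => //.
by apply: class_eq (I_M h w) => n; rewrite mulrC.
Qed.
Lemma S2M phi psi : S2 phi -> W psi -> S2 (fun n => phi n * psi n).
Proof.
move=> + h; apply: lspanM => u {}phi [[uv w]|[uv [f w ->]]]; [left|right]; split => //.
  exact: WM.
by exists (fun n => f n * psi n); [exact: WM | apply: funext => n; rewrite mulrA].
Qed.
Lemma N2M phi psi : N2 phi -> W psi -> N2 (fun n => phi n * psi n).
Proof.
move=> + h; apply: lspanM => u {}phi [[uv w]|[uv [f w ->]]]; [left|right]; split => //.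
  exact: I_M.
by exists (fun n => f n * psi n); [exact: WM | apply: funext => n; rewrite mulrA].
Qed.
Lemma S2I phi psi : S2 phi -> I psi -> N2 (fun n => phi n * psi n).
Proof.
move=> + h; apply: lspanM => u {}phi [[uv w]|[uv [f w ->]]]; [left|right]; split => //.
  by apply: class_eq (I_M h w) => n; rewrite mulrC.
exists (fun n => f n * psi n); first by apply: WM => //; exact: IW.
by apply: funext => n; rewrite mulrA.
Qed.

(** The new factor merges with the last letter: g_l becomes g_(k+l) with k + l >= 2, and hbar b
    becomes hbar g_k, which lies in n. This is why words ending in [x] have values in Z_q. *)
Lemma lwG_St k phi : (0 < k)%N -> St phi -> S2 (fun n => lw (G k) n * phi n).
Proof.
move=> k0; apply: lspan_lw => // u {}phi [uv w]; split => //.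
case: u uv => [|l] l0; [right|left]; split => //=; rewrite ?evX.
- by exists phi.
- by move: l0 => /=; lia.
- by apply: W_scale.
Qed.
Lemma lwG_Sn k phi : (0 < k)%N -> Sn phi -> N2 (fun n => lw (G k) n * phi n).
Proof.
move=> k0; apply: lspan_lw => // u {}phi [[uv w]|[]]; last first.
  by case: u => // _ w; split => //; right; split => //=; exists phi; rewrite ?evX.
split => //.
case: u uv => [|l] l0; [right|left]; split => //=; rewrite ?evX.
- by exists phi => //; exact: IW.
- by move: l0 => /=; lia.
- by apply: I_scale.
Qed.

Lemma fw_W phi : W phi -> Sc (fun n => fw n * phi n).
Proof.
move=> w; apply: (@class_eq _ (fun n => lw (G 1) n * phi n)) => [n|]; first by rewrite lwG1.
exact: lspan_gen.
Qed.
Lemma fw_J phi : J phi -> Nl (fun n => fw n * phi n).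
Proof.
move=> w; apply: (@class_eq _ (fun n => lw (G 1) n * phi n)) => [n|]; first by rewrite lwG1.
by apply: lspan_gen; right.
Qed.
Lemma fw_St phi : St phi -> S2 (fun n => fw n * phi n).
Proof.
by move=> w; apply: (@class_eq _ _ _ _ (lwG_St (ltn0Sn 0) w)) => n; rewrite lwG1.
Qed.
Lemma fw_Sn phi : Sn phi -> N2 (fun n => fw n * phi n).
Proof.
by move=> w; apply: (@class_eq _ _ _ _ (lwG_Sn (ltn0Sn 0) w)) => n; rewrite lwG1.
Qed.

(* [D] is the class of summands of words, closed under multiplication by [fw];
   unlike the spans above it is stable under convolution. *)
Definition dirac (n : nat) : C := (n == 0%N)%:R.

Inductive D : (nat -> C) -> Prop :=
| D_dirac : D dirac
| D_psum phi : D phi -> D (fun n => fw n * psum phi n)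
| D_fw phi : phi 0%N = 0 -> D phi -> D (fun n => fw n * phi n)
| D_Hb phi : D phi -> D (fun n => (1 - q) * psum phi n)
| D_add phi psi : D phi -> D psi -> D (fun n => phi n + psi n)
| D_scale p phi : D phi -> D (fun n => ev q p * phi n).

Lemma modD : modclass D.
Proof. split; [exact: D_add | exact: D_scale | by exists dirac; exact: D_dirac]. Qed.

(** The summand of the empty word is [dirac], which no letter produces since letters vanish at 0; it
    is adjoined here. *)
Definition St0 phi := exists p psi, St psi /\ phi = (fun n => ev q p * dirac n + psi n).

Lemma psum_dirac M : (0 < M)%N -> psum dirac M = 1.
Proof.
case: M => // M _; rewrite /psum big_ord_recl /= big1 ?addr0 // => i _.
Qed.

Lemma modSt0 : modclass St0.
Proof.
split.
- move=> _ _ [p [f [hf ->]]] [p' [g [hg ->]]]; exists (p + p'), (fun n => f n + g n).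
  by split; [exact: lspan_add | apply: funext => n; rewrite evD; ring].
- move=> p _ [p' [f [hf ->]]]; exists (p * p'), (fun n => ev q p * f n).
  by split; [exact: lspan_scale | apply: funext => n; rewrite evM; ring].
- exists dirac, 1, (fun _ => 0); split; first exact: lspan_zero.
  by apply: funext => n; rewrite ev1 mul1r addr0.
Qed.

Lemma St_St0 phi : St phi -> St0 phi.
Proof.
by move=> h; exists 0, phi; split => //; apply: funext => n; rewrite ev0 mul0r add0r.
Qed.

Lemma St0_psum phi : St0 phi -> W (psum phi).
Proof.
move=> [p [psi [hpsi ->]]].
apply: (@W_eq (fun n => ev q p * 1 + psum psi n)) => [M M0|].
  by rewrite psumD psumZ psum_dirac.
by apply: W_add (St_psum hpsi); apply: W_scale; exact: W_one.
Qed.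

Lemma fw_dirac n : fw n * dirac n = 0.
Proof. by case: n => [|n]; rewrite ?fw0 ?mul0r // /dirac /= mulr0. Qed.

Lemma fw_St0 phi : St0 phi -> S2 (fun n => fw n * phi n).
Proof.
move=> [p [psi [hpsi ->]]]; apply: class_eq (fw_St hpsi) => n.
by rewrite mulrDr mulrCA fw_dirac mulr0 add0r.
Qed.

Lemma D_St0 phi : D phi -> St0 phi.
Proof.
elim=> {phi} [|phi _ h|phi _ _ h|phi _ h|phi psi _ h _ h'|p phi _ h].
- exists 1, (fun _ => 0); split; first exact: lspan_zero.
  by apply: funext => n; rewrite ev1 mul1r addr0.
- exact/St_St0/Sc_St/fw_W/St0_psum.
- exact/St_St0/Sc_St/S2_Sc/fw_St0.
- apply: St_St0; apply: (@class_eq _ (fun n => lw Hb n * psum phi n)) => [[|n]|].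
  + by rewrite psum0 !mulr0.
  + by [].
  + by apply: lspan_gen; split => //; exact: St0_psum.
- exact: (mod_add modSt0).
- exact: (mod_scale modSt0).
Qed.

End Classes.
(** * Convolution *)

(** Taking partial sums is multiplication by the series of all positive powers of the variable, so
    it passes through a product. *)
Lemma psum_fpsM (A : comNzRingType) (phi psi : fps A) :
  (psum (phi * psi : fps A) : fps A) = (psum phi : fps A) * psi.
Proof.
pose g : fps A := fun n => (0 < n)%N%:R.
have psumE (x : fps A) : (psum x : fps A) = g * x.
  apply: funext => n; rewrite [RHS](congr1 (fun y : fps A => y n) (mulrC _ _)) fpsM.
  rewrite big_ord_recr /= subnn /g mulr0 addr0; apply: eq_bigr => i _.
  by rewrite subn_gt0 ltn_ord mulr1.
by rewrite !psumE mulrA.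
Qed.

Lemma psum_fpsMr (A : comNzRingType) (phi psi : fps A) :
  (psum (phi * psi : fps A) : fps A) = phi * (psum psi : fps A).
Proof. by rewrite mulrC psum_fpsM mulrC. Qed.

Definition pmul (A : comNzRingType) (f phi : nat -> A) : fps A := fun n => f n * phi n.

(* The partial fraction identity [f_i f_j = f_(i+j) (f_i + f_j + h)], summed over [i + j = t]. *)
Lemma pmul_conv (A : comNzRingType) (f : nat -> A) (h : A) (a b : fps A) :
  (forall i j, (0 < i)%N -> (0 < j)%N -> f i * f j = f (i + j)%N * (f i + f j + h)) ->
  a 0%N = 0 -> b 0%N = 0 ->
  pmul f a * pmul f b =
  pmul f (a * pmul f b + pmul f a * b + fpsC h * (a * b)).
Proof.
move=> hf a0 b0; apply: funext => t; rewrite /pmul !fpsD fpsCM !fpsM.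
rewrite (mulr_sumr _ _ _ h) -!big_split mulr_sumr; apply: eq_bigr => i _ /=.
have [->|i0] := posnP i; first by rewrite a0; ring.
have [e|j0] := posnP (t - i)%N; first by rewrite e b0; ring.
have := hf _ _ i0 j0; rewrite subnKC -1?ltnS ?ltn_ord // => e.
by rewrite mulrACA e; ring.
Qed.

Section Words.
Variables (R : realType) (q : R[i]).
Local Notation C := R[i].
Hypothesis q01 : 0 < `|q| < 1.
Implicit Types (phi psi : nat -> C) (u v : letter) (p : {poly rat}).
Notation fw := (fw q).
Notation lw := (lw q).
Notation W := (W q).
Notation D := (D q).
Notation Sc := (lspan q (genSc q)).
Local Notation rho := (normc q).

Lemma rho01 : 0 < rho < 1.
Proof. by case/andP: q01 => h1 h2; move: h1 h2; rewrite ltcR -[1](rmorph1 (real_complex R)) ltcR => -> ->. Qed.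

Lemma rho_ge0 : 0 <= rho. Proof. by case/andP: rho01 => /ltW. Qed.

Lemma normc_1B n : (0 < n)%N -> 1 - rho <= normc (1 - q ^+ n).
Proof.
move=> n0; case/andP: rho01 => r0 r1.
have : normc (1 : C) <= normc (1 - q ^+ n) + normc (q ^+ n).
  by rewrite -{1}(subrK (q ^+ n) 1); exact: le_normcD.
rewrite normc1 normcX.
have : rho ^+ n <= rho by rewrite -{2}[rho]expr1; apply: ler_wiXn2l => //; exact: ltW.
by lra.
Qed.

Lemma qpow_neq1 n : (0 < n)%N -> 1 - q ^+ n != 0.
Proof.
move=> n0; apply/eqP => e; have := normc_1B n0; case/andP: rho01 => r0 r1.
by rewrite e normc0; lra.
Qed.

Lemma q_neq1 : 1 - q != 0.
Proof. by rewrite -[q]expr1; exact: qpow_neq1. Qed.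

Lemma q_neq0 : q != 0.
Proof. by apply/eqP => e; move: rho01; rewrite e normc0 ltxx. Qed.

Lemma fwM i j : (0 < i)%N -> (0 < j)%N ->
  fw i * fw j = fw (i + j) * (fw i + fw j + (1 - q)).
Proof.
move=> i0 j0; rewrite /fw /qint exprD.
have hi := qpow_neq1 i0; have hj := qpow_neq1 j0; have h1 := q_neq1.
have := @qpow_neq1 (i + j) (ltn_addr j i0); rewrite exprD => hij.
by field; rewrite hi hj h1 hij.
Qed.

Lemma rate_fw : rate rho fw.
Proof.
move=> s s1; case/andP: rho01 => r0 r1; exists (normc (1 - q) / (1 - rho)) => n.
have B0 : 0 <= normc (1 - q) / (1 - rho) by rewrite divr_ge0 ?normc_ge0 //; lra.
have sr0 : 0 <= (s * rho) ^+ n by rewrite exprn_ge0 // mulr_ge0; lra.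
have [->|n0] := posnP n; first by rewrite fw0 normc0 mulr_ge0.
rewrite /fw /qint invf_div mulrC normcM; apply: ler_pM; rewrite ?normc_ge0 //.
  rewrite normcM normcV; apply: ler_wpM2l; first exact: normc_ge0.
  by rewrite lef_pV2 ?posrE; have := normc_1B n0; lra.
rewrite normcX; apply: lerXn2r; rewrite ?nnegrE; nra.
Qed.

Lemma rate_fwX k : rate 1 (fun n => fw n ^+ k).
Proof.
elim: k => [|k IH]; first exact: rate1.
have h := rateM rho_ge0 ler01 rate_fw IH.
apply: (@rate_le _ (rho * 1)) => //; first by rewrite mulr1 rho_ge0.
  by rewrite mulr1; case/andP: rho01 => _ /ltW.
by move=> s /h [B hB]; exists B => n; rewrite exprS.
Qed.

Lemma rate_G k : (0 < k)%N -> rate rho (lw (G k)).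
Proof.
case: k => // k _; have := rateM rho_ge0 ler01 rate_fw (rate_fwX k).
by move=> h s /h [B hB]; exists B => n; rewrite lwG // exprS; move: (hB n); rewrite mulr1.
Qed.

Lemma rate_lw u : valid_letter u -> rate 1 (lw u).
Proof.
case: u => [|k] k0.
  move=> s /(rateZ (1 - q) (@rate1 R)) [B hB]; exists B => -[|n]; last first.
    by have := hB n.+1; rewrite mulr1.
  by rewrite lw0 normc0 expr0 mulr1; exact: rate_ge0 hB.
apply: rate_le rho_ge0 _ (rate_G k0).
by case/andP: rho01 => _ /ltW.
Qed.

Lemma W_rate phi : W phi -> rate 1 phi.
Proof.
elim=> {phi} [|p phi _ h|phi psi _ h _ h'|u phi uv _ h|phi psi e _ h].
- exact: rate1.
- exact: rateZ.
- exact: rateD.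
- by apply: rate_psum; have := rateM ler01 ler01 (rate_lw uv) h; rewrite mulr1.
- move=> s s1; have [B hB] := h s s1; have B0 := rate_ge0 hB.
  exists (B + normc (psi 0%N)) => -[|n].
    by rewrite expr0 mulr1 lerDr.
  rewrite -e // (le_trans (hB _)) // ler_wpM2r // ?lerDl ?normc_ge0 //.
  by rewrite exprn_ge0 //; lra.
Qed.

Lemma Sc_rate phi : Sc phi -> rate rho phi.
Proof.
elim=> {phi} [|[|k] phi [//= k0 w]|phi psi _ h _ h'|p phi _ h].
- exact/rate0/rho_ge0.
- by have := rateM rho_ge0 ler01 (rate_G k0) (W_rate w); rewrite mulr1.
- exact: rateD.
- exact: rateZ.
Qed.

Lemma Sc_cvg phi : Sc phi -> exists l, cvgC (psum phi) l.
Proof. by move=> /Sc_rate; apply: rate_summable; exact: rho01. Qed.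

(** Double induction. A [psum] in either factor comes out of the convolution; when both factors
    carry [fw], [pmul_conv] trades the two for a single one outside and at most one inside, so that
    the induction hypotheses apply. *)
Lemma D_conv (phi psi : fps C) : D phi -> D psi -> D (phi * psi : fps C).
Proof.
have mD := modD q.
pose Dz (a : fps C) := D (pmul fw a).
have step (a b : fps C) : a 0%N = 0 -> b 0%N = 0 -> Dz (a * pmul fw b) ->
    Dz (pmul fw a * b) -> Dz (fpsC (1 - q) * (a * b)) -> D (pmul fw a * pmul fw b : fps C).
  move=> a0 b0 h1 h2 h3; rewrite (pmul_conv fwM a0 b0).
  apply: class_eq (D_add (D_add h1 h2) h3) => n.
  by rewrite /pmul !fpsD !mulrDr.
have hC (a : fps C) : D a -> D (fpsC (1 - q) * a).
  by move=> h; apply: class_eq (mod_hbar mD h) => n; rewrite fpsCM.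
have Dps (a : fps C) : D a -> Dz (psum a) by exact: D_psum.
have z0 (a b : fps C) : a 0%N = 0 -> (a * b) 0%N = 0.
  by move=> e; rewrite fpsM big_ord1 e mul0r.
have z0' (a b : fps C) : b 0%N = 0 -> (a * b) 0%N = 0 by move=> e; rewrite mulrC z0.
have sl (a b : fps C) : (psum a : fps C) * b = psum (a * b : fps C) by rewrite psum_fpsM.
have sr (a b : fps C) : a * (psum b : fps C) = psum (a * b : fps C) by rewrite psum_fpsMr.
have Dfw (a : fps C) : a 0%N = 0 -> D a -> Dz a by exact: D_fw.
have Hb (a : fps C) : D a -> D (fpsC (1 - q) * (psum a : fps C)).
  by move=> h; apply: class_eq (D_Hb h) => n; rewrite fpsCM.
have DHb (a : fps C) : (fun n => (1 - q) * psum a n) = fpsC (1 - q) * (psum a : fps C) :> fps C.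
  by apply: funext => n; rewrite fpsCM.
have pz (a : fps C) : psum a 0 = 0 by exact: psum0.
move=> hphi; elim: hphi psi => {phi} [|phi hphi IH|phi p0 hphi IH|phi hphi IH|phi phi' h1 IH _ IH'|p phi _ IH] psi hpsi.
- by rewrite (_ : dirac R = 1 :> fps C) // mul1r.
- elim: hpsi => {psi} [|psi hpsi IHs|psi s0 hpsi IHs|psi hpsi IHs|psi psi' _ IHs _ IHs'|p psi _ IHs].
  + by rewrite (_ : dirac R = 1 :> fps C) // mulr1; exact: D_psum.
  + apply: (step (psum phi) (psum psi)) => //.
    * by rewrite sl; apply: (Dps _); apply: IH; exact: Dps.
    * by rewrite sr; exact: Dps.
    * by rewrite sl sr sr; apply: (Dps _); apply: Hb; exact: IH.
  + apply: (step (psum phi) psi) => //.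
    * by rewrite sl; apply: (Dps _); apply: IH; exact: D_fw.
    * by apply: Dfw; rewrite ?z0'.
    * by rewrite sl sr; apply: (Dps _); apply: hC; exact: IH.
  + by rewrite DHb mulrCA sr; apply: Hb.
  + by rewrite (_ : (fun n => psi n + psi' n) = (psi : fps C) + psi') // mulrDr; exact: D_add.
  + rewrite (_ : (fun n => ev q p * psi n) = fpsC (ev q p) * (psi : fps C)); last first.
      by apply: funext => n; rewrite fpsCM.
    by rewrite mulrCA; apply: class_eq (D_scale p IHs) => n; rewrite fpsCM.
- elim: hpsi => {psi} [|psi hpsi IHs|psi s0 hpsi IHs|psi hpsi IHs|psi psi' _ IHs _ IHs'|p psi _ IHs].
  + by rewrite (_ : dirac R = 1 :> fps C) // mulr1; exact: D_fw.
  + apply: (step phi (psum psi)) => //.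
    * by apply: Dfw; rewrite ?z0 //; apply: IH; exact: Dps.
    * by rewrite sr; exact: Dps.
    * by rewrite sr sr; apply: (Dps _); apply: hC; exact: IH.
  + apply: (step phi psi) => //.
    * by apply: Dfw; rewrite ?z0 //; apply: IH; exact: D_fw.
    * by apply: Dfw; rewrite ?z0'.
    * by apply: Dfw; rewrite ?z0' ?z0 //; apply: hC; exact: IH.
  + by rewrite DHb mulrCA sr; apply: Hb.
  + by rewrite (_ : (fun n => psi n + psi' n) = (psi : fps C) + psi') // mulrDr; exact: D_add.
  + rewrite (_ : (fun n => ev q p * psi n) = fpsC (ev q p) * (psi : fps C)); last first.
      by apply: funext => n; rewrite fpsCM.
    by rewrite mulrCA; apply: class_eq (D_scale p IHs) => n; rewrite fpsCM.
- by rewrite DHb -mulrA sl; apply: Hb; exact: IH.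
- by rewrite (_ : (fun n => phi n + phi' n) = (phi : fps C) + phi') // mulrDl; apply: D_add; [exact: IH | exact: IH'].
- rewrite (_ : (fun n => ev q p * phi n) = fpsC (ev q p) * (phi : fps C)); last first.
    by apply: funext => n; rewrite fpsCM.
  by rewrite -mulrA; apply: class_eq (D_scale p (IH _ hpsi)) => n; rewrite fpsCM.
Qed.

End Words.
(** * Membership in the spaces of values *)

Fixpoint hasG2 (w : seq letter) : bool :=
  match w with
  | [::] => false
  | Hb :: w' => hasG2 w'
  | G k :: w' => (1 < k)%N || hasG2 w'
  end.

Fixpoint HbG2 (w : seq letter) : bool :=
  match w with
  | [::] => false
  | Hb :: w' => hasG2 w' || HbG2 w'
  | G _ :: w' => HbG2 w'
  end.

Lemma hasG2_cat w w' : hasG2 (w ++ w') = hasG2 w || hasG2 w'.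
Proof. by elim: w => //= -[|k] w IH; rewrite IH ?orbA. Qed.

Lemma HbG2_rcons_G k w : (1 < k)%N -> has isHb w -> HbG2 (rcons w (G k)).
Proof.
by move=> k1; elim: w => //= -[|l] w IH //= _; rewrite -cats1 hasG2_cat /= k1 orbT.
Qed.

Lemma HbG2_rcons u w : HbG2 w -> HbG2 (rcons w u).
Proof.
elim: w => //= -[|l] w IH //= /orP[h|/IH ->]; last by rewrite orbT.
by rewrite -cats1 hasG2_cat h.
Qed.

(* The exponents (alpha_i, beta_i) of a word ending in some [G k], after [c] letters [Hb]. *)
Fixpoint blocks (w : seq letter) (c : nat) : seq (nat * nat) :=
  match w with
  | [::] => [::]
  | Hb :: w' => blocks w' c.+1
  | G k :: w' => (c, k.-1) :: blocks w' 0
  end.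

Lemma blocks_flatten w k c : all valid_letter w -> (0 < k)%N ->
  flatten [seq nseq p.1 Hb ++ [:: G p.2.+1] | p <- blocks (rcons w (G k)) c] =
  nseq c Hb ++ rcons w (G k).
Proof.
elim: w c => [|[|l] w IH] c /=; first by rewrite cats0; case: k.
  move=> vw k0; by rewrite IH //; elim: (c) => //= n <-.

move=> /andP[l0 /(IH 0%N)] + k0 => -> //.
by rewrite prednK // -catA.
Qed.

Lemma blocks_hasG2 w c : hasG2 w ->
  exists t, (t < size (blocks w c))%N /\ (1 <= (nth (0, 0) (blocks w c) t).2)%N.
Proof.
elim: w c => // -[|l] w IH c /=; first exact: IH.
case/orP => [l1|/(IH 0%N)[t ht]]; last by exists t.+1.
by exists 0%N; split => //=; lia.
Qed.

Lemma blocks_head w c : (0 < size (blocks w c))%N -> (c <= (nth (0, 0) (blocks w c) 0).1)%N.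
Proof.
elim: w c => // -[|l] w IH c //= h.
by apply: leq_trans (IH _ h).
Qed.

Lemma blocks_HbG2 w c : HbG2 w ->
  exists s t : nat, (s <= t)%N /\ (t < size (blocks w c))%N /\
      (1 <= (nth (0, 0) (blocks w c) s).1)%N /\ (1 <= (nth (0, 0) (blocks w c) t).2)%N.
Proof.
elim: w c => // -[|l] w IH c /=; last first.
  by move=> /(IH 0%N)[s [t ht]]; exists s.+1, t.+1.
case/orP => [/(@blocks_hasG2 _ c.+1)[t [ht1 ht2]]|/IH //].
exists 0%N, t; do ![split => //].
by apply: leq_trans (@blocks_head w c.+1 _) => //; apply: leq_ltn_trans ht1.
Qed.

Lemma HbG2_n0 w k : all valid_letter w -> (0 < k)%N -> HbG2 (rcons w (G k)) ->
  n0_word (rcons w (G k)).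
Proof.
move=> vw k0 /(@blocks_HbG2 _ 0)[s [t [st [ts h]]]]; exists (blocks (rcons w (G k)) 0).
split; first by move: ts; case: (blocks _ _).
split; first by rewrite blocks_flatten.
by exists s, t.
Qed.

Definition snoc (u : letter) (s : fsum) : fsum := [seq (c.1, rcons c.2 u) | c <- s].
Definition fscale (p : {poly rat}) (s : fsum) : fsum := [seq (p * c.1, c.2) | c <- s].

Lemma in_span_cat P s t : in_span P s -> in_span P t -> in_span P (s ++ t).
Proof. by elim: s => //= c s IH [h1 h2] ht; split => //; exact: IH. Qed.

Section Values.
Variables (R : realType) (q : R[i]).
Local Notation C := R[i].
Hypothesis q01 : 0 < `|q| < 1.
Implicit Types (phi psi : nat -> C) (u v : letter) (p : {poly rat}) (w : seq letter).
Notation lw := (lw q).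
Notation W := (W q).
Notation I := (I q).
Notation J := (J q).
Notation Sc := (lspan q (genSc q)).
Notation St := (lspan q (genSt q)).
Notation S2 := (lspan q (genS2 q)).
Notation N2 := (lspan q (genN2 q)).
Notation Nl := (lspan q (genNl q)).

(** The definition puts the smallest index outermost. Exchanging the summations brings the last
    letter, with the largest index, to the front, as [psum] requires. *)
Lemma ZqM_from_rcons w u lo M :
  ZqM_from q (rcons w u) lo M = \sum_(lo.+1 <= m < M) Fq q m u * ZqM_from q w lo m.
Proof.
elim: w lo => [|v w IH] lo //=.
transitivity (\sum_(lo.+1 <= a < M) \sum_(lo.+1 <= m < M | (a < m)%N)
    Fq q a v * (Fq q m u * ZqM_from q w a m)).
  apply: eq_big_nat => a /andP[la aM]; rewrite IH mulr_sumr.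
  by rewrite (big_nat_widenl _ lo.+1) // ltnW.
rewrite (exchange_big_dep_nat xpredT) //=.
apply: eq_big_nat => m /andP[lm mM]; rewrite mulr_sumr [RHS](big_nat_widen _ _ M) ?(ltnW mM) //.
by apply: eq_big => [a|a _] //; rewrite mulrCA.
Qed.

Lemma ZqM_cat s t M : ZqM q (s ++ t) M = ZqM q s M + ZqM q t M.
Proof. by rewrite /ZqM big_cat. Qed.

Lemma ZqM_scale p s M : ZqM q (fscale p s) M = ev q p * ZqM q s M.
Proof.
rewrite /ZqM big_map mulr_sumr; apply: eq_bigr => c _.
by rewrite evM mulrA.
Qed.

Lemma ZqM_snoc u s M :
  ZqM q (snoc u s) M = psum (fun m => lw u m * ZqM q s m) M.
Proof.
rewrite /ZqM /psum /snoc big_map.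
under [RHS]eq_bigr => m _ do rewrite mulr_sumr.
rewrite exchange_big /=; apply: eq_bigr => c _.
rewrite ZqM_from_rcons mulr_sumr -(big_mkord xpredT (fun m => lw u m * (ev q c.1 * ZqM_from q c.2 0 m))).
case: M => [|M]; first by rewrite !big_geq.
rewrite [RHS]big_nat_recl // lw0 mul0r add0r big_add1 /=.
by apply: eq_bigr => m _; rewrite mulrCA.
Qed.

Definition rep (P : seq letter -> bool) phi :=
  exists s : fsum, all (fun c => P c.2) s /\ forall M, (0 < M)%N -> ZqM q s M = phi M.

Lemma rep_add P phi psi : rep P phi -> rep P psi -> rep P (fun n => phi n + psi n).
Proof.
move=> [s [hs es]] [t [ht et]]; exists (s ++ t); split; first by rewrite all_cat hs.
by move=> M M0; rewrite ZqM_cat es ?et.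
Qed.

Lemma rep_scale P p phi : rep P phi -> rep P (fun n => ev q p * phi n).
Proof.
move=> [s [hs es]]; exists (fscale p s); split; first by rewrite all_map.
by move=> M M0; rewrite ZqM_scale es.
Qed.

Lemma rep_zero P : rep P (fun _ => 0).
Proof. by exists [::]; split => // M _; rewrite /ZqM big_nil. Qed.

Lemma rep_letter (P P' : seq letter -> bool) u phi : (forall w, P w -> P' (rcons w u)) ->
  rep P phi -> rep P' (psum (fun m => lw u m * phi m)).
Proof.
move=> h [s [hs es]]; exists (snoc u s); split.
  by rewrite all_map; apply: sub_all hs => c; exact: h.
move=> M _; rewrite ZqM_snoc; apply: eq_psum => -[|m]; first by rewrite lw0 !mul0r.
by rewrite es.
Qed.

Lemma rep_eq P phi psi : (forall M, (0 < M)%N -> phi M = psi M) -> rep P phi -> rep P psi.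
Proof. by move=> e [s [hs es]]; exists s; split => // M M0; rewrite es ?e. Qed.

Notation vld := (all valid_letter).

Lemma vld_rcons u w : valid_letter u -> vld w -> vld (rcons w u).
Proof. by move=> uv wv; rewrite all_rcons uv. Qed.

Lemma W_rep phi : W phi -> rep vld phi.
Proof.
elim=> {phi} [|p phi _|phi psi _ + _|u phi uv _|phi psi e _].
- exists [:: (1, [::])]; split => // M _.
  by rewrite /ZqM big_seq1 ev1 mul1r.
- exact: rep_scale.
- exact: rep_add.
- by apply: rep_letter => w; exact: vld_rcons.
- exact: rep_eq.
Qed.

(** Mirrors the shape n = n_0 + hbar times the convergent words: a first part made of words in [P],
    and a multiple of hbar. *)
Definition rep2 (P : seq letter -> bool) phi := exists phi1 phi2,
  [/\ rep P phi1, rep vld phi2 &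
  forall M, (0 < M)%N -> phi M = phi1 M + (1 - q) * phi2 M].

Lemma rep2_add P phi psi : rep2 P phi -> rep2 P psi -> rep2 P (fun n => phi n + psi n).
Proof.
move=> [f1 [f2 [h1 h2 e]]] [g1 [g2 [k1 k2 e']]].
exists (fun n => f1 n + g1 n), (fun n => f2 n + g2 n).
split; [exact: rep_add | exact: rep_add |].
by move=> M M0; rewrite e // e' //; ring.
Qed.

Lemma rep2_scale P p phi : rep2 P phi -> rep2 P (fun n => ev q p * phi n).
Proof.
move=> [f1 [f2 [h1 h2 e]]].
exists (fun n => ev q p * f1 n), (fun n => ev q p * f2 n).
split; [exact: rep_scale | exact: rep_scale |].
by move=> M M0; rewrite e //; ring.
Qed.

Lemma rep2_letter (P P' : seq letter -> bool) u phi : valid_letter u ->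
  (forall w, P w -> P' (rcons w u)) ->
  rep2 P phi -> rep2 P' (psum (fun m => lw u m * phi m)).
Proof.
move=> uv h [f1 [f2 [h1 h2 e]]].
exists (psum (fun m => lw u m * f1 m)), (psum (fun m => lw u m * f2 m)).
split; [exact: rep_letter h h1 | |].
  by apply: rep_letter h2 => w; exact: vld_rcons.
move=> M _; rewrite -psumZ -psumD; apply: eq_psum => -[|m]; first by rewrite lw0; ring.
by rewrite e //; ring.
Qed.

Lemma rep2_eq P phi psi : (forall M, (0 < M)%N -> phi M = psi M) -> rep2 P phi -> rep2 P psi.
Proof.
move=> e [f1 [f2 [h1 h2 e']]]; exists f1, f2; split => // M M0.
by rewrite -e // e'.
Qed.

Lemma rep2_hbar P phi : W phi -> rep2 P (fun n => (1 - q) * phi n).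
Proof.
move=> /W_rep h; exists (fun _ => 0), phi; split => //; first exact: rep_zero.
by move=> M _; rewrite add0r.
Qed.

Lemma rep_rep2 P phi : rep P phi -> rep2 P phi.
Proof.
move=> h; exists phi, (fun _ => 0); split => //; first exact: rep_zero.
by move=> M _; rewrite mulr0 addr0.
Qed.

Lemma I_rep phi : I phi -> rep2 (fun w => vld w && has isHb w) phi.
Proof.
elim=> {phi} [phi|phi h|p phi _|phi psi _ + _|u phi uv _|phi psi e _].
- exact: rep2_hbar.
- apply/rep_rep2/(rep_letter _ (W_rep h)) => w vw.
  by rewrite all_rcons has_rcons /= vw.
- exact: rep2_scale.
- exact: rep2_add.
- by apply: rep2_letter => // w /andP[vw hw]; rewrite all_rcons has_rcons uv vw hw orbT.
- exact: rep2_eq.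
Qed.

Lemma J_rep phi : J phi -> rep2 (fun w => vld w && HbG2 w) phi.
Proof.
elim=> {phi} [phi|k phi k1 h|p phi _|phi psi _ + _|u phi uv _|phi psi e _].
- exact: rep2_hbar.
- apply: rep2_letter (I_rep h) => [|w /andP[vw hw]]; first by rewrite /=; lia.
  by rewrite all_rcons vw HbG2_rcons_G //= andbT; lia.
- exact: rep2_scale.
- exact: rep2_add.
- by apply: rep2_letter => // w /andP[vw hw]; rewrite all_rcons uv vw HbG2_rcons.
- exact: rep2_eq.
Qed.

(** [in_n] fixes the order of its two parts, so the concatenation has to be rearranged and only the
    values are compared. *)
Lemma in_n_cat s t : in_n s -> in_n t -> exists2 r, in_n r & forall M, ZqM q r M = ZqM q s M + ZqM q t M.
Proof.
move=> [s1 [s2 [h1 [h2 ->]]]] [t1 [t2 [k1 [k2 ->]]]].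
exists ((s1 ++ t1) ++ fscale 'X (s2 ++ t2)).
  by exists (s1 ++ t1), (s2 ++ t2); do ![split => //]; apply: in_span_cat.
by move=> M; rewrite /fscale map_cat !ZqM_cat; ring.
Qed.

Lemma in_n_scale p s : in_n s -> in_n (fscale p s).
Proof.
have sc (P : seq letter -> Prop) t : in_span P t -> in_span P (fscale p t).
  by elim: t => //= c t IH [h1 h2]; split => //; exact: IH.
move=> [s1 [s2 [h1 [h2 ->]]]]; exists (fscale p s1), (fscale p s2).
do ![split; first exact: sc]; rewrite /fscale map_cat -!map_comp; congr (_ ++ _).
by apply: eq_map => c /=; rewrite mulrCA.
Qed.

Lemma in_span_snoc (P : seq letter -> bool) (Q : seq letter -> Prop) u s :
  (forall w, P w -> Q (rcons w u)) -> all (fun c => P c.2) s -> in_span Q (snoc u s).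
Proof. by move=> h; elim: s => //= c s IH /andP[/h h1 /IH]. Qed.

Lemma hatH0_rcons w k : (0 < k)%N -> vld w -> hatH0_word (rcons w (G k)).
Proof.
by move=> k0 vw; split; [rewrite all_rcons /= k0 | right; exists w, k].
Qed.

Lemma in_n_letter (P : seq letter -> bool) k phi : (0 < k)%N ->
  (forall w, P w -> vld w && HbG2 (rcons w (G k))) -> rep2 P phi ->
  exists2 s, in_n s & forall M, ZqM q s M = psum (fun m => lw (G k) m * phi m) M.
Proof.
move=> k0 h [f1 [f2 [[s [hs es]] [t [ht et]] e]]].
exists (snoc (G k) s ++ fscale 'X (snoc (G k) t)).
  exists (snoc (G k) s), (snoc (G k) t); split.
    by apply: in_span_snoc hs => w /h /andP[vw hw]; exact: HbG2_n0.
  by split => //; apply: in_span_snoc ht => w vw; exact: hatH0_rcons.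
move=> M; rewrite ZqM_cat ZqM_scale !ZqM_snoc evX -psumZ -psumD; apply: eq_psum => -[|m].
  by rewrite lw0; ring.
by rewrite e // es // et //; ring.
Qed.

Lemma Nl_in_n phi : Nl phi -> exists2 s, in_n s & forall M, ZqM q s M = psum phi M.
Proof.
elim=> {phi} [|[|k] phi [[]|[]] //= k0 h|phi psi _ [s hs es] _ [t ht et]|p phi _ [s hs es]].
- exists [::]; first by exists [::], [::].
  by move=> M; rewrite /ZqM big_nil /psum big1.
- apply: in_n_letter (I_rep h) => [|w /andP[vw hw]]; first by lia.
  by rewrite vw HbG2_rcons_G.
- apply: in_n_letter (J_rep h) => // w /andP[vw hw].
  by rewrite vw HbG2_rcons.
- have [r hr er] := in_n_cat hs ht; exists r => // M.
  by rewrite er es et psumD.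
- exists (fscale p s); first exact: in_n_scale.
  by move=> M; rewrite ZqM_scale es psumZ.
Qed.

Lemma in_H0_cat s t : in_H0 s -> in_H0 t -> exists2 r, in_H0 r & forall M, ZqM q r M = ZqM q s M + ZqM q t M.
Proof.
move=> [s1 [s2 [h1 [h2 ->]]]] [t1 [t2 [k1 [k2 ->]]]].
have [r hr er] := in_n_cat h2 k2; exists ((s1 ++ t1) ++ r).
  by exists (s1 ++ t1), r; do ![split => //]; apply: in_span_cat.
by move=> M; rewrite !ZqM_cat er; ring.
Qed.

Lemma in_span_fscale (P : seq letter -> Prop) p s : in_span P s -> in_span P (fscale p s).
Proof. by elim: s => //= c t IH [h1 h2]; split => //; exact: IH. Qed.

Lemma in_H0_scale p s : in_H0 s -> in_H0 (fscale p s).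
Proof.
move=> [s1 [s2 [h1 [h2 ->]]]]; exists (fscale p s1), (fscale p s2).
split; first exact: in_span_fscale.
by split; [exact: in_n_scale | rewrite /fscale map_cat].
Qed.

Lemma in_n_H0 s : in_n s -> in_H0 s.
Proof. by move=> h; exists [::], s. Qed.

Lemma in_n_nil : in_n [::].
Proof. by exists [::], [::]. Qed.

Lemma S2_in_H0 phi : S2 phi -> exists2 s, in_H0 s & forall M, ZqM q s M = psum phi M.
Proof.
elim=> {phi} [|[|k] phi [[]|[]] //= k0 h|phi psi _ [s hs es] _ [t ht et]|p phi _ [s hs es]].
- exists [::]; first exact/in_n_H0/in_n_nil.
  by move=> M; rewrite /ZqM big_nil /psum big1.
- have [s [hs es]] := W_rep h; exists (snoc (G k) s).
    exists (snoc (G k) s), [::]; rewrite cats0; split; last by split => //; exact: in_n_nil.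
    apply: in_span_snoc hs => w vw; split; first by rewrite all_rcons /= vw andbT; lia.
    by right; exists w, k.
  move=> M; rewrite ZqM_snoc; apply: eq_psum => -[|m]; first by rewrite lw0 !mul0r.
  by rewrite es.
- case: h => psi hpsi ->.
  (* The factor hbar alone puts the sum into n: [rep2_hbar] takes 0 for the part made of words in
     n_0. *)
  have [s hs es] := in_n_letter k0 (P := fun w => vld w && HbG2 w)
    (fun w hw => let: conj a b := andP hw in introT andP (conj a (HbG2_rcons (G k) b)))
    (rep2_hbar _ hpsi).
  by exists s => //; exact: in_n_H0.
- have [r hr er] := in_H0_cat hs ht; exists r => // M.
  by rewrite er es et psumD.
- exists (fscale p s); first exact: in_H0_scale.
  by move=> M; rewrite ZqM_scale es psumZ.
Qed.

Lemma ZqE s l : cvgC (ZqM q s) l -> Zq q s = l.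
Proof. exact: limCE. Qed.

(* Values of convergent sums, in forms stable under the ring operations. *)
Definition Zval (z : C) := exists p phi, S2 phi /\ cvgC (fun M => ev q p + psum phi M) z.
Definition N2val (z : C) := exists2 phi, N2 phi & cvgC (psum phi) z.
Definition Nval (z : C) := exists2 phi, Nl phi & cvgC (psum phi) z.

Lemma Nval_Nq z : Nval z -> Nq_space q z.
Proof.
move=> [phi /Nl_in_n[s hs es] c]; exists s; split => //.
by rewrite (@ZqE _ z) //; apply: cvgC_eq c.
Qed.

Lemma Zval_Zq z : Zval z -> Zq_space q z.
Proof.
move=> [p [phi [/S2_in_H0[s hs es] c]]].
have h1 : in_H0 [:: (p, [::])].
  exists [:: (p, [::])], [::]; split; last by split => //; exact: in_n_nil.
  by split => //; split => //; left.
have [r hr er] := in_H0_cat h1 hs; exists r; split => //.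
rewrite (@ZqE _ z) //; apply: cvgC_eq c => M.
by rewrite er es /ZqM big_seq1 /= mulr1.
Qed.

Lemma Nval_add x y : Nval x -> Nval y -> Nval (x + y).
Proof.
move=> [f hf cf] [g hg cg]; exists (fun n => f n + g n); first exact: lspan_add.
by apply: cvgC_eq (cvgCD cf cg) => M; rewrite psumD.
Qed.
Lemma Nval_scale p x : Nval x -> Nval (ev q p * x).
Proof.
move=> [f hf cf]; exists (fun n => ev q p * f n); first exact: lspan_scale.
by apply: cvgC_eq (cvgCM (cvgC_cst (ev q p)) cf) => M; rewrite psumZ.
Qed.
Lemma Nval0 : Nval 0.
Proof.
exists (fun _ => 0); first exact: lspan_zero.
by apply: cvgC_eq (cvgC_cst 0) => M; rewrite /psum big1.
Qed.
Lemma N2_Nval x : N2val x -> Nval x.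
Proof. by move=> [f hf cf]; exists f => //; exact: N2_Nl. Qed.
Lemma Zval_const p : Zval (ev q p).
Proof.
exists p, (fun _ => 0); split; first exact: lspan_zero.
by apply: cvgC_eq (cvgC_cst _) => M; rewrite /psum big1 ?addr0.
Qed.
Lemma Zval_S2 phi z : S2 phi -> cvgC (psum phi) z -> Zval z.
Proof. by move=> h c; exists 0, phi; split => //; apply: cvgC_eq c => M; rewrite ev0 add0r. Qed.
Lemma N2val_add x y : N2val x -> N2val y -> N2val (x + y).
Proof.
move=> [f hf cf] [g hg cg]; exists (fun n => f n + g n); first exact: lspan_add.
by apply: cvgC_eq (cvgCD cf cg) => M; rewrite psumD.
Qed.
Lemma N2val0 : N2val 0.
Proof.
exists (fun _ => 0); first exact: lspan_zero.
by apply: cvgC_eq (cvgC_cst 0) => M; rewrite /psum big1.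
Qed.
Lemma Zval_add x y : Zval x -> Zval y -> Zval (x + y).
Proof.
move=> [p [f [hf cf]]] [p' [g [hg cg]]]; exists (p + p'), (fun n => f n + g n).
split; first exact: lspan_add.
by apply: cvgC_eq (cvgCD cf cg) => M; rewrite psumD evD addrACA.
Qed.

Lemma S2_W phi : S2 phi -> W (psum phi).
Proof. by move=> h; apply/St_psum/Sc_St/S2_Sc. Qed.
Lemma N2_I phi : N2 phi -> I (psum phi).
Proof. by move=> /N2_Nl /Nl_psum /JI. Qed.

Lemma Sc_mul phi psi : Sc phi -> St psi -> S2 (fun n => phi n * psi n).
Proof.
move=> + h; elim=> {phi} [|[|k] phi [//= k0 w]|f g _ hf _ hg|p f _ hf].
- by apply: class_eq (lspan_zero _ _) => n; rewrite mul0r.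
- by apply: class_eq (lwG_St k0 (StM h w)) => n; rewrite mulrAC mulrA.
- by apply: class_eq (lspan_add hf hg) => n; rewrite mulrDl.
- by apply: class_eq (lspan_scale p hf) => n; rewrite mulrA.
Qed.

Lemma N2_mul phi psi : N2 phi -> St psi -> N2 (fun n => phi n * psi n).
Proof.
move=> + h; elim=> {phi} [|[|k] phi [[]|[]] //= k0|f g _ hf _ hg|p f _ hf].
- by apply: class_eq (lspan_zero _ _) => n; rewrite mul0r.
- move=> w; apply: class_eq (lwG_Sn (ltnW k0) (StI h w)) => n; by rewrite mulrAC mulrA.
- move=> [f w ->]; apply: class_eq (Sc_hbar (S2_Sc (lwG_St k0 (StM h w)))) => n.
  by ring.
- by apply: class_eq (lspan_add hf hg) => n; rewrite mulrDl.
- by apply: class_eq (lspan_scale p hf) => n; rewrite mulrA.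
Qed.

Lemma Zval_mul x y : Zval x -> Zval y -> Zval (x * y).
Proof.
move=> [p [f [hf cf]]] [p' [g [hg cg]]].
exists (p * p'), (fun n => (ev q p * g n + ev q p' * f n) +
  (psum f n * g n + f n * psum g n + f n * g n)).
split.
  apply: lspan_add; first by apply: lspan_add; apply: lspan_scale.
  apply: lspan_add; last by apply: Sc_mul (S2_Sc hf) (Sc_St (S2_Sc hg)).
  apply: lspan_add; last exact: S2M hf (S2_W hg).
  by apply: class_eq (S2M hg (S2_W hf)) => n; rewrite mulrC.
apply: cvgC_eq (cvgCM cf cg) => M; rewrite mulrDl !mulrDr psumM !psumD evM !psumZ; ring.
Qed.

(** In the product rule [psumM] each term either keeps a factor in [N2], or multiplies a summand in
    [S2] by a partial sum in [I], which is again in [N2]. *)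
Lemma N2val_mul x y : N2val x -> Zval y -> N2val (x * y).
Proof.
move=> [f hf cf] [p' [g [hg cg]]].
exists (fun n => ev q p' * f n + (psum f n * g n + f n * psum g n + f n * g n)).
  apply: lspan_add; first exact: lspan_scale.
  apply: lspan_add; last by apply: N2_mul hf (Sc_St (S2_Sc hg)).
  apply: lspan_add; last exact: N2M hf (S2_W hg).
  by apply: class_eq (S2I hg (N2_I hf)) => n; rewrite mulrC.
by apply: cvgC_eq (cvgCM cf cg) => M; rewrite mulrDr psumM !psumD !psumZ; ring.
Qed.

Inductive Pval : C -> Prop :=
| P_zero : Pval 0
| P_gen a k : Zval a -> (1 <= k)%N -> Pval (a * Zq q (word [:: G (2 * k)]))
| P_add x y : Pval x -> Pval y -> Pval (x + y).

Lemma Pval_mul a x : Zval a -> Pval x -> Pval (a * x).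
Proof.
move=> ha; elim=> {x} [|b k hb k1|x y _ hx _ hy].
- by rewrite mulr0; exact: P_zero.
- by rewrite mulrA; apply: P_gen => //; exact: Zval_mul.
- by rewrite mulrDr; exact: P_add.
Qed.

Lemma Pval_Pq z : Pval z -> Pq_ideal q z.
Proof.
elim=> {z} [|a k /Zval_Zq ha k1|x y _ [n [a [k [h e]]]] _ [n' [a' [k' [h' e']]]]].
- by exists 0%N, (fun _ => 0), (fun _ => 0%N); split => //; rewrite big_ord0.
- by exists 1%N, (fun _ => a), (fun _ => k); split => //; rewrite big_ord1.
- exists (n + n')%N, (fun i => if (i < n)%N then a i else a' (i - n)%N),
    (fun i => if (i < n)%N then k i else k' (i - n)%N); split.
    move=> i hi; case: ltnP => ni; first exact: h.
    by apply: h'; lia.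
  rewrite e e' big_split_ord /=; congr (_ + _); apply: eq_bigr => i _; first by rewrite ltn_ord.
  by rewrite ltnNge leq_addr /= addKn.
Qed.

Definition NPval (z : C) := exists n y, Nval n /\ Pval y /\ z = n + y.

Lemma NPval_eq x z : NPval (x - z) -> eq_mod_NP q x z.
Proof.
by move=> [n [y [/Nval_Nq hn [/Pval_Pq hp e]]]]; exists n, y.
Qed.

Lemma NPval_add x y : NPval x -> NPval y -> NPval (x + y).
Proof.
move=> [n [p [hn [hp ->]]]] [n' [p' [hn' [hp' ->]]]]; exists (n + n'), (p + p').
by split; [exact: Nval_add | split; [exact: P_add | ring]].
Qed.
Lemma N_NP x : Nval x -> NPval x.
Proof. by move=> h; exists x, 0; rewrite addr0; do ![split => //]; exact: P_zero. Qed.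
Lemma P_NP x : Pval x -> NPval x.
Proof. by move=> h; exists 0, x; rewrite add0r; do ![split => //]; exact: Nval0. Qed.
Lemma NPval0 : NPval 0. Proof. exact/P_NP/P_zero. Qed.
Lemma NPval_scale p x : NPval x -> NPval (ev q p * x).
Proof.
move=> [n [p' [hn [hp ->]]]]; exists (ev q p * n), (ev q p * p'); rewrite mulrDr.
do ![split => //]; first exact: Nval_scale.
by apply: Pval_mul => //; exact: Zval_const.
Qed.
Lemma NPval_opp x : NPval x -> NPval (- x).
Proof. by move=> /(NPval_scale (-1)); rewrite evN ev1 mulN1r. Qed.

End Values.
(** * Series in two variables with coefficients in a class of sequences *)

(* [fpsX] is the grading variable z; T = z and R = z kappa, kappa being the inner variable. *)
Notation ser C := (fps (fps C)).

(* The sum of the [t^c Y^c phi], where [Y phi = g * psum phi]. *)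
Section Res.
Variables (A : comPzRingType) (g : nat -> A) (t : A) (phi : nat -> A).
Fixpoint res_psum n : A :=
  if n is n'.+1 then res_psum n' + phi n' + t * g n' * res_psum n' else 0.
Definition res n : A := phi n + t * g n * res_psum n.

Lemma psum_res n : psum res n = res_psum n.
Proof. by elim: n => [|n IH]; rewrite ?psum0 // psumS IH /= /res addrA. Qed.

Lemma resE n : res n = phi n + t * g n * psum res n.
Proof. by rewrite psum_res. Qed.

Lemma res_uniq (psi : nat -> A) : (forall n, psi n = phi n + t * g n * psum psi n) -> psi =1 res.
Proof.
move=> e; suff h n : psum psi n = res_psum n by move=> n; rewrite e h.
by elim: n => [|n IH]; rewrite ?psum0 // psumS IH e IH /= addrA.
Qed.
End Res.

Lemma res_sub (A : comPzRingType) (g h : nat -> A) t phi psi m :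
  res g t phi m - res h t psi m = (phi m - psi m) +
    t * (g m * psum (res g t phi) m - h m * psum (res h t psi) m).
Proof. by rewrite resE [X in _ - X]resE; ring. Qed.

Definition run (A : pzRingType) (g : nat -> A) a (phi : nat -> A) : nat -> A :=
  iter a (fun psi n => g n * psum psi n) phi.

(* [L] lists the lengths of the runs of [y], the last one read first. *)
Fixpoint ust (A : comPzRingType) (gx gy : nat -> A) (t : A) (L : seq nat) : nat -> A :=
  match L with
  | [::] => fun n => (n == 0%N)%:R
  | a :: L' => fun n => gx n * run gy a (res gy t (ust gx gy t L')) n
  end.

(** The runs of [y] keep their lengths here; longer runs of [x] are accounted for by the choice of
    the weight [gy]. *)
Fixpoint est (A : comPzRingType) (gx gy : nat -> A) (L : seq nat) : nat -> A :=
  match L with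
  | [::] => fun n => (n == 0%N)%:R
  | a :: L' => fun n => gx n * run gy a (est gx gy L') n
  end.

Section Series.
Variables (R : realType) (q : R[i]).
Local Notation C := R[i].
Local Notation K := (ser C).
Implicit Types (x y : K) (phi psi : nat -> K) (d a n : nat) (X Y Z : (nat -> C) -> Prop).

Definition cf d a x : C := x d a.
Definition kC (c : C) : K := fpsC (fpsC c).
Definition kz : K := fpsX _.
Definition kk : K := fpsC (fpsX C).

Lemma kserP x y : (forall d a, cf d a x = cf d a y) -> x = y.
Proof. by move=> e; apply: funext => d; apply: funext => a; exact: e. Qed.

Lemma cfD d a x y : cf d a (x + y) = cf d a x + cf d a y. Proof. by []. Qed.
Lemma cfN d a x : cf d a (- x) = - cf d a x. Proof. by []. Qed.
Lemma cfB d a x y : cf d a (x - y) = cf d a x - cf d a y. Proof. by []. Qed.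
Lemma cf0 d a : cf d a 0 = 0. Proof. by []. Qed.
Lemma cf1 d a : cf d a 1 = ((d == 0%N) && (a == 0%N))%:R.
Proof. by rewrite /cf fps1E; case: d => [|d]; rewrite ?fps1E. Qed.
Lemma cf_sum (T : Type) (r : seq T) (P : pred T) (F : T -> K) d a :
  cf d a (\sum_(i <- r | P i) F i) = \sum_(i <- r | P i) cf d a (F i).
Proof. by rewrite /cf !fps_sum. Qed.
Lemma cfM d a x y :
  cf d a (x * y) = \sum_(i < d.+1) \sum_(b < a.+1) cf i b x * cf (d - i) (a - b) y.
Proof. by rewrite /cf fpsM fps_sum; apply: eq_bigr => i _; rewrite fpsM. Qed.
Lemma cf_kC d a c x : cf d a (kC c * x) = c * cf d a x.
Proof. by rewrite /cf fpsCM fpsCM. Qed.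
Lemma cf_kC1 d a c : cf d a (kC c) = c * ((d == 0%N) && (a == 0%N))%:R.
Proof. by rewrite -[kC c]mulr1 cf_kC cf1. Qed.
Lemma cf_kz d a x : cf d a (kz * x) = if d is d'.+1 then cf d' a x else 0.
Proof. by rewrite /cf fpsXM; case: d. Qed.
Lemma cf_kk d a x : cf d a (kk * x) = if a is a'.+1 then cf d a' x else 0.
Proof. by rewrite /cf fpsCM fpsXM; case: a. Qed.
Lemma cf_psum d a phi M : cf d a (psum phi M) = psum (fun m => cf d a (phi m)) M.
Proof. by rewrite /psum cf_sum. Qed.

Lemma kCM c c' : kC (c * c') = kC c * kC c'. Proof. by rewrite /kC !rmorphM. Qed.
Lemma kCD c c' : kC (c + c') = kC c + kC c'. Proof. by rewrite /kC !rmorphD. Qed.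
Lemma kCN c : kC (- c) = - kC c. Proof. by rewrite /kC !rmorphN. Qed.
Lemma kC1 : kC 1 = 1. Proof. by rewrite /kC !rmorph1. Qed.
Lemma kC0 : kC 0 = 0. Proof. by rewrite /kC !rmorph0. Qed.

Definition KLn n X phi := forall d a, (d < n)%N -> X (fun m => cf d a (phi m)).
Definition KL X phi := forall d a, X (fun m => cf d a (phi m)).

Lemma KLnP X phi : KL X phi <-> forall n, KLn n X phi.
Proof. by split=> [h n d a _|h d a]; [exact: h | exact: (h d.+1 d a (ltnSn d))]. Qed.

(** Each turn of the recursions gains a factor z, so the coefficients below degree [n] control those
    of degree [n]; [KLn_raise] is the gain. *)
Lemma KL_ind X phi : (forall n, KLn n X phi -> KLn n.+1 X phi) -> KL X phi.
Proof. by move=> h; apply/KLnP; elim=> // n; exact: h. Qed.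

Lemma KL_KLn X phi n : KL X phi -> KLn n X phi. Proof. by move=> h d a _; exact: h. Qed.

Lemma KLn_eq n X phi psi : phi =1 psi -> KLn n X phi -> KLn n X psi.
Proof. by move=> /funext ->. Qed.

Lemma KL_eq X phi psi : phi =1 psi -> KL X phi -> KL X psi.
Proof. by move=> /funext ->. Qed.

Lemma KLn_sub n X Y phi : (forall f, X f -> Y f) -> KLn n X phi -> KLn n Y phi.
Proof. by move=> h hp d a dn; apply: h; exact: hp. Qed.
Lemma KL_sub X Y phi : (forall f, X f -> Y f) -> KL X phi -> KL Y phi.
Proof. by move=> h hp d a; apply: h; exact: hp. Qed.

Lemma KLn_add n X phi psi : modclass q X -> KLn n X phi -> KLn n X psi ->
  KLn n X (fun m => phi m + psi m).
Proof. by move=> mX h h' d a dn; apply: (mod_add mX); [exact: h | exact: h']. Qed.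

Lemma KLn_opp n X phi : modclass q X -> KLn n X phi -> KLn n X (fun m => - phi m).
Proof. by move=> mX h d a dn; apply: (mod_opp mX); exact: h. Qed.

Lemma KLn_Sub n X phi psi : modclass q X -> KLn n X phi -> KLn n X psi ->
  KLn n X (fun m => phi m - psi m).
Proof. by move=> mX h h'; apply: KLn_add => //; exact: KLn_opp. Qed.

Lemma KLn_mul n X Y Z phi psi : modclass q Z ->
  (forall f g, X f -> Y g -> Z (fun m => f m * g m)) ->
  KLn n X phi -> KLn n Y psi -> KLn n Z (fun m => phi m * psi m).
Proof.
move=> mZ h hX hY d a dn.
apply: (@class_eq _ _ (fun m => \sum_(i < d.+1) \sum_(b < a.+1)
    cf i b (phi m) * cf (d - i) (a - b) (psi m))) => [m|]; first by rewrite cfM.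
apply: (@mod_sum _ q) => // i _; apply: (@mod_sum _ q) => // b _; apply: h.
  by apply: hX; apply: leq_ltn_trans dn; rewrite -ltnS.
by apply: hY; apply: leq_ltn_trans dn; rewrite leq_subr.
Qed.

Lemma KL_mul X Y Z phi psi : modclass q Z ->
  (forall f g, X f -> Y g -> Z (fun m => f m * g m)) ->
  KL X phi -> KL Y psi -> KL Z (fun m => phi m * psi m).
Proof.
by move=> mZ h hX hY; apply/KLnP => n; apply: KLn_mul h _ _ => //; exact: KL_KLn.
Qed.

Lemma KLn_psum n X Y phi : (forall f, X f -> Y (psum f)) -> KLn n X phi -> KLn n Y (psum phi).
Proof.
move=> h hX d a dn; apply: class_eq (h _ (hX d a dn)) => M.
by rewrite cf_psum.
Qed.

Lemma KLn_kC n X Y (c : nat -> C) phi : (forall f, X f -> Y (fun m => c m * f m)) ->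
  KLn n X phi -> KLn n Y (fun m => kC (c m) * phi m).
Proof.
move=> h hX d a dn; apply: class_eq (h _ (hX d a dn)) => m.
by rewrite cf_kC.
Qed.

(* The classes of sequences are only modules over Q[hbar]: these are the series that act on them. *)
Definition rser x := forall d a, exists p, cf d a x = ev q p.

Lemma rser1 : rser 1.
Proof.
move=> d a; exists (((d == 0%N) && (a == 0%N))%:R)%:P; rewrite cf1 evC.
by case: (_ && _); rewrite ?rmorph1 ?rmorph0.
Qed.
Lemma rser_kk : rser kk.
Proof.
move=> d a; rewrite -[kk]mulr1 cf_kk; case: a => [|a]; last exact: rser1.
by exists 0; rewrite ev0.
Qed.
Lemma rserN x : rser x -> rser (- x).
Proof. by move=> h d a; have [p e] := h d a; exists (- p); rewrite cfN e evN. Qed.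
Lemma rserD x y : rser x -> rser y -> rser (x + y).
Proof.
by move=> h h' d a; have [p e] := h d a; have [p' e'] := h' d a; exists (p + p'); rewrite cfD e e' evD.
Qed.
Lemma rserM x y : rser x -> rser y -> rser (x * y).
Proof.
move=> h h' d a; rewrite cfM.
have ev_sum (I : finType) (F : I -> C) : (forall i, exists p, F i = ev q p) ->
    exists p, \sum_i F i = ev q p.
  move=> hF; elim/big_ind: _ => [|u v [p ->] [p' ->]|i _]; last exact: hF.
    by exists 0; rewrite ev0.
  by exists (p + p'); rewrite evD.
apply: (ev_sum _ _) => i; apply: (ev_sum _ _) => b.
have [p e] := h i b; have [p' e'] := h' (d - i)%N (a - b)%N.
by exists (p * p'); rewrite e e' evM.
Qed.

Lemma KLn_rser n X x phi : modclass q X -> rser x -> KLn n X phi -> KLn n X (fun m => x * phi m).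
Proof.
move=> mX hx hX.
pose Y : (nat -> C) -> Prop := fun f => exists p, f = fun _ => ev q p.
apply: (@KLn_mul n Y X X (fun _ => x) phi mX) => //.
  by move=> f g [p ->] hg; exact: (mod_scale mX).
by move=> d a _; have [p e] := hx d a; exists p; apply: funext => m.
Qed.

Lemma KLn_raise n X x phi : modclass q X -> rser x -> KLn n X phi ->
  KLn n.+1 X (fun m => kz * x * phi m).
Proof.
move=> mX hx /(KLn_rser mX hx) hX [|d] a dn.
  by apply: class_eq (mod_zero mX) => m; rewrite -mulrA cf_kz.
by apply: class_eq (hX d a dn) => m; rewrite -mulrA cf_kz.
Qed.

End Series.
(** * Summands attached to words with geometric runs *)

Section States.
Variables (R : realType) (q : R[i]).
Local Notation C := R[i].
Local Notation K := (ser C).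
Implicit Types (x y : K) (phi psi : nat -> K) (d a n : nat) (gc : nat -> C).
Notation fw := (fw q).
Notation lw := (lw q).
Notation D := (D q).
Notation St0 := (St0 q).
Notation Sn := (lspan q (genSn q)).
Notation S2 := (lspan q (genS2 q)).
Notation N2 := (lspan q (genN2 q)).
Notation rser := (rser q).
Notation kz := (kz R).

Definition kf m : K := kC (fw m).
Definition kh m : K := kC (fw m + lw Hb m).

Lemma N2_Sn f : N2 f -> Sn f.
Proof.
apply: lspan_map => -[|k] {}f [[]|[]] //= k2 w; left; split => //=; try by lia.
by case: w => g w ->; exact: I_hbar.
Qed.

Lemma St0_fw f : St0 f -> St0 (fun n => fw n * f n).
Proof. by move=> h; exact/St_St0/Sc_St/S2_Sc/fw_St0. Qed.
Lemma St0_fw_psum f : St0 f -> St0 (fun n => fw n * psum f n).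
Proof. by move=> h; apply/St_St0/Sc_St/fw_W; exact: St0_psum. Qed.
Lemma St0_h_psum f : St0 f -> St0 (fun n => (fw n + lw Hb n) * psum f n).
Proof.
move=> h; apply: class_eq (mod_add (modSt0 q) (St0_fw_psum h) (_ : St0 (fun n => lw Hb n * psum f n))) => [n|].
  by rewrite mulrDl.
by apply/St_St0/lspan_gen; split => //; exact: St0_psum.
Qed.

Lemma KL_res X gc x phi : modclass q X ->
  (forall f, X f -> X (fun n => gc n * psum f n)) -> rser x -> KL X phi ->
  KL X (res (fun m => kC (gc m)) (kz * x) phi).
Proof.
move=> mX h hx hphi; apply: KL_ind => n hn.
apply: (@KLn_eq _ _ _ (fun m => phi m + kz * x * (kC (gc m) * psum (res (fun m => kC (gc m)) (kz * x) phi) m))).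
  by move=> m; rewrite [RHS]resE mulrA.
apply: (KLn_add mX); first exact: KL_KLn.
apply: (KLn_raise mX hx) => d a dn; apply: class_eq (h _ (hn d a dn)) => m.
by rewrite cf_kC cf_psum.
Qed.

Lemma KL_run X gc a phi : (forall f, X f -> X (fun n => gc n * psum f n)) -> KL X phi ->
  KL X (run (fun m => kC (gc m)) a phi).
Proof.
move=> h hphi; elim: a => // a IH d b; apply: class_eq (h _ (IH d b)) => m.
by rewrite cf_kC cf_psum.
Qed.

Lemma KL_kC X Y gc phi : (forall f, X f -> Y (fun n => gc n * f n)) -> KL X phi ->
  KL Y (fun m => kC (gc m) * phi m).
Proof. by move=> h hphi d b; apply: class_eq (h _ (hphi d b)) => m; rewrite cf_kC. Qed.

Lemma KL_dirac X : modclass q X -> X (dirac R) -> KL X (fun n => (n == 0%N)%:R : K).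
Proof.
move=> mX h d a; case e: ((d == 0%N) && (a == 0%N)).
  by apply: class_eq h => m; rewrite /dirac; case: m => [|m]; rewrite ?cf0 ?cf1 ?e.
by apply: class_eq (mod_zero mX) => -[|m]; rewrite ?cf0 ?cf1 ?e.
Qed.

(** The innermost run must contain a [y]: an [x] acting directly on [dirac] would meet [f] at its
    pole 0, where its value is a default. *)
Definition tame (L : seq nat) := (L == [::]) || (0 < last 0%N L)%N.

Lemma tame_behead a L : tame (a :: L) -> tame L /\ ((0 < a)%N \/ L != [::]).
Proof. by rewrite /tame /=; case: L => [|b L] /= h; split => //; [left|right]. Qed.

Lemma ust0 gx gy t a L : gx 0%N = 0 -> @ust K gx gy t (a :: L) 0%N = 0.
Proof. by move=> /= ->; rewrite mul0r. Qed.

Lemma run_res0 gx gy t a L : gx 0%N = 0 -> gy 0%N = 0 -> tame (a :: L) ->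
  run gy a (res gy t (@ust K gx gy t L)) 0%N = 0.
Proof.
move=> gx0 gy0 /tame_behead[_]; case: a => [|a] /=; last by rewrite gy0 mul0r.
case: L => [[]|b L _] //; rewrite resE psum0 mulr0 addr0; exact: ust0.
Qed.

Lemma kf0 : kf 0 = 0. Proof. by rewrite /kf fw0 kC0. Qed.
Lemma kh0 : kh 0 = 0. Proof. by rewrite /kh fw0 lw0 addr0 kC0. Qed.

Lemma D_run x a L : rser x -> KL D (ust kf kf (kz * x) L) ->
  KL D (run kf a (res kf (kz * x) (ust kf kf (kz * x) L))).
Proof.
move=> hx h; apply: KL_run; first by move=> f; exact: D_psum.
by apply: KL_res => //; [exact: modD | move=> f; exact: D_psum].
Qed.

Lemma ust_D x L : rser x -> tame L -> KL D (ust kf kf (kz * x) L).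
Proof.
move=> hx; elim: L => [|a L IH] hL; first by apply: KL_dirac; [exact: modD | exact: D_dirac].
have [hL' _] := tame_behead hL.
have h := D_run a hx (IH hL').
move=> d b; apply: class_eq (D_fw _ (h d b)) => [m|]; first by rewrite cf_kC.
by rewrite (run_res0 _ kf0 kf0).
Qed.

Section Pairs.
Variable x : K.
Hypothesis hx : rser x.
Local Notation t := (kz * x).

Lemma ust_St0 gc L : (forall f, St0 f -> St0 (fun n => gc n * psum f n)) ->
  KL St0 (ust kf (fun m => kC (gc m)) t L).
Proof.
move=> h; elim: L => [|a L IH].
  by apply: KL_dirac; [exact: modSt0 | exact/D_St0/D_dirac].
apply: KL_kC (St0_fw) _; apply: KL_run => //; apply: KL_res => //.
exact: modSt0.
Qed.

Lemma ust_S2 gc a L : (forall f, St0 f -> St0 (fun n => gc n * psum f n)) ->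
  KL S2 (ust kf (fun m => kC (gc m)) t (a :: L)).
Proof.
move=> h; apply: KL_kC (@fw_St0 _ _) _; apply: KL_run => //; apply: KL_res => //.
  exact: modSt0.
exact: ust_St0.
Qed.

(* The weight g / (1 - t f) of a letter [y] in the generating series of the words k + e. *)
Definition yw gc m : K := kC (gc m) * fps_geom (x * kf m).

Lemma ywE gc m : yw gc m = kC (gc m) + t * (kf m * yw gc m).
Proof.
have e := fps_geomE (x * kf m).
have {e} e : fps_geom (x * kf m) = 1 + t * kf m * fps_geom (x * kf m).
  by move: e; rewrite mulrBr mulr1 => /eqP; rewrite subr_eq => /eqP {1}->; rewrite /kz; ring.
by rewrite /yw {1}e; ring.
Qed.

Lemma yw_sub gc gc' m P P' : yw gc m * P - yw gc' m * P' =
  (kC (gc m) * P - kC (gc' m) * P') + t * (kf m * (yw gc m * P - yw gc' m * P')).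
Proof. by rewrite {1}ywE [X in _ - X * _]ywE; ring. Qed.

Lemma yw0 gc : gc 0%N = 0 -> yw gc 0 = 0.
Proof. by move=> e; rewrite /yw e kC0 mul0r. Qed.

Lemma KL_yw_psum X Y gc phi : modclass q Y -> (forall f, X f -> Y (fun n => gc n * psum f n)) ->
  (forall f, Y f -> Y (fun n => fw n * f n)) -> KL X phi ->
  KL Y (fun m => yw gc m * psum phi m).
Proof.
move=> mY h h' hphi; apply: KL_ind => n hn.
apply: (@KLn_eq _ _ _ (fun m => kC (gc m) * psum phi m + t * (kf m * (yw gc m * psum phi m)))).
  by move=> m; rewrite [in RHS]ywE; ring.
apply: (KLn_add mY).
  by move=> d a dn; apply: class_eq (h _ (hphi d a)) => m; rewrite cf_kC cf_psum.
by apply: (KLn_raise mY hx); exact: KLn_kC hn.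
Qed.

Lemma est_run_St0 gc a phi : (forall f, St0 f -> St0 (fun n => gc n * psum f n)) ->
  KL St0 phi -> KL St0 (run (yw gc) a phi).
Proof.
move=> h hphi; elim: a => // a IH; apply: KL_yw_psum IH => //; first exact: modSt0.
exact: St0_fw.
Qed.

Lemma est_St0 gc L : (forall f, St0 f -> St0 (fun n => gc n * psum f n)) ->
  KL St0 (est kf (yw gc) L).
Proof.
move=> h; elim: L => [|a L IH].
  by apply: KL_dirac; [exact: modSt0 | exact/D_St0/D_dirac].
by apply: KL_kC (St0_fw) _; exact: est_run_St0.
Qed.

Lemma est_S2 gc a L : (forall f, St0 f -> St0 (fun n => gc n * psum f n)) ->
  KL S2 (est kf (yw gc) (a :: L)).
Proof.
by move=> h; apply: KL_kC (@fw_St0 _ _) _; apply: est_run_St0 => //; exact: est_St0.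
Qed.

(* Replacing [fw] by [fw + hbar] in the letters [y] changes summands by elements of [Sn]. *)
Definition near X phi psi := KL X (fun m => phi m - psi m).

(** The difference is [fw] times the sum of [f - g], less a letter [Hb] applied to [g]; each of the
    two terms is in [Sn]. *)
Lemma Sn_step f g : Sn (fun m => f m - g m) -> St0 g ->
  Sn (fun n => fw n * psum f n - (fw n + lw Hb n) * psum g n).
Proof.
move=> h hg.
have h1 : Sn (fun n => fw n * psum (fun m => f m - g m) n).
  apply: (@class_eq _ _ (fun n => lw (G 1) n * psum (fun m => f m - g m) n)) => [n|].
    by rewrite lwG1.
  by apply: lspan_gen; left; split => //; exact: Sn_psum.
have h2 : Sn (fun n => lw Hb n * psum g n).
  by apply: lspan_gen; right; split => //; exact: St0_psum.
apply: class_eq (mod_sub (modlspan _ _) h1 h2) => n.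
have -> : psum (fun m => f m - g m) n = psum f n - psum g n.
  by rewrite psumD /psum sumrN.
by ring.
Qed.

Lemma Sn_fw f : Sn f -> Sn (fun n => fw n * f n).
Proof. by move=> h; exact/N2_Sn/fw_Sn. Qed.

Lemma near_step n phi psi : KLn n Sn (fun m => phi m - psi m) -> KLn n St0 psi ->
  KLn n Sn (fun m => kf m * psum phi m - kh m * psum psi m).
Proof.
move=> h hpsi d a dn; apply: class_eq (Sn_step (h d a dn) (hpsi d a dn)) => m.
by rewrite cfB !cf_kC !cf_psum.
Qed.

Lemma near_run a phi psi : near Sn phi psi -> KL St0 psi -> near Sn (run kf a phi) (run kh a psi).
Proof.
move=> h hpsi; elim: a => // a IH; apply/KLnP => n; apply: near_step; first exact: KL_KLn.
by apply: KL_KLn; apply: KL_run => //; exact: St0_h_psum.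
Qed.

Lemma near_res phi psi : near Sn phi psi -> KL St0 psi -> near Sn (res kf t phi) (res kh t psi).
Proof.
move=> h hpsi; apply: KL_ind => n hn.
apply: (@KLn_eq _ _ _ (fun m => (phi m - psi m) +
   t * (kf m * psum (res kf t phi) m - kh m * psum (res kh t psi) m))).
  by move=> m; rewrite res_sub.
apply: KLn_add; [exact: modlspan | exact: KL_KLn |].
apply: (KLn_raise (modlspan q _) hx); apply: near_step hn _.
by apply: KL_KLn; apply: KL_res => //; [exact: modSt0 | exact: St0_h_psum].
Qed.

Lemma near_refl phi : near Sn phi phi.
Proof.
by move=> d a; apply: class_eq (mod_zero (modlspan q (genSn q))) => m; rewrite subrr cf0.
Qed.

Lemma near_kf X Y phi psi : (forall f, X f -> Y (fun n => fw n * f n)) -> near X phi psi ->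
  near Y (fun m => kf m * phi m) (fun m => kf m * psi m).
Proof.
move=> h hp; apply: (KL_eq _ (KL_kC h hp)) => m.
by rewrite /kf mulrBr.
Qed.

Lemma near_ust_run a L : near Sn (ust kf kf t L) (ust kf kh t L) ->
  near Sn (run kf a (res kf t (ust kf kf t L))) (run kh a (res kh t (ust kf kh t L))).
Proof.
move=> h; have h' : KL St0 (ust kf kh t L) by apply: ust_St0; exact: St0_h_psum.
apply: near_run; first exact: near_res.
by apply: KL_res => //; [exact: modSt0 | exact: St0_h_psum].
Qed.

Lemma near_ust L : near Sn (ust kf kf t L) (ust kf kh t L).
Proof.
elim: L => [|a L IH]; first exact: near_refl.
by apply: near_kf Sn_fw _; exact: near_ust_run.
Qed.

(** The outermost [x] multiplies by [fw], which improves [Sn] to [N2]. *)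
Lemma near_ust_N2 a L : near N2 (ust kf kf t (a :: L)) (ust kf kh t (a :: L)).
Proof. by apply: near_kf (@fw_Sn _ _) _; apply: near_ust_run; exact: near_ust. Qed.

Definition hw m := fw m + lw Hb m.

Lemma near_yw phi psi : near Sn phi psi -> KL St0 psi ->
  near Sn (fun m => yw fw m * psum phi m) (fun m => yw hw m * psum psi m).
Proof.
move=> h hpsi; apply: KL_ind => n hn.
apply: (@KLn_eq _ _ _ (fun m => (kf m * psum phi m - kh m * psum psi m) +
   t * (kf m * (yw fw m * psum phi m - yw hw m * psum psi m)))).
  by move=> m; rewrite [RHS]yw_sub.
apply: KLn_add; [exact: modlspan | |].
  by apply: near_step; exact: KL_KLn.
by apply: (KLn_raise (modlspan q _) hx); apply: KLn_kC hn; exact: Sn_fw.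
Qed.

Lemma near_est_run a phi psi : near Sn phi psi -> KL St0 psi ->
  near Sn (run (yw fw) a phi) (run (yw hw) a psi).
Proof.
move=> h hpsi; elim: a => // a IH; apply: near_yw => //.
by apply: est_run_St0 => //; exact: St0_h_psum.
Qed.

Lemma near_est L : near Sn (est kf (yw fw) L) (est kf (yw hw) L).
Proof.
elim: L => [|a L IH]; first exact: near_refl.
apply: near_kf Sn_fw _; apply: near_est_run => //.
by apply: est_St0; exact: St0_h_psum.
Qed.

Lemma near_est_N2 a L : near N2 (est kf (yw fw) (a :: L)) (est kf (yw hw) (a :: L)).
Proof.
apply: near_kf (@fw_Sn _ _) _; apply: near_est_run; first exact: near_est.
by apply: est_St0; exact: St0_h_psum.
Qed.

End Pairs.
End States.
(** * Regularising factors *)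

Section Regularisation.
Variables (R : realType) (q : R[i]).
Local Notation C := R[i].
Local Notation K := (ser C).
Implicit Types (x y : K) (phi psi : nat -> K) (d a n : nat).
Notation fw := (fw q).
Notation lw := (lw q).
Notation W := (W q).
Notation I := (I q).
Notation St := (lspan q (genSt q)).
Notation Sn := (lspan q (genSn q)).
Notation S2 := (lspan q (genS2 q)).
Notation N2 := (lspan q (genN2 q)).
Notation rser := (rser q).
Notation kz := (kz R).
Notation kf := (kf q).
Definition kb m : K := kC (lw Hb m).

(* The product over j < m of (1 + z y1 f_j) / (1 + z x1 f_j + z x2 hbar). *)
Fixpoint rg x1 x2 y1 m : K :=
  if m is m'.+1 then
    rg x1 x2 y1 m' * (1 + kz * y1 * kf m') * fps_geom (- (x1 * kf m' + x2 * kb m'))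
  else 1.

Lemma rgS_eq x1 x2 y1 m :
  rg x1 x2 y1 m.+1 * (1 + kz * (x1 * kf m + x2 * kb m)) = rg x1 x2 y1 m * (1 + kz * y1 * kf m).
Proof.
have e := fps_geomE (- (x1 * kf m + x2 * kb m)).
rewrite /= -mulrA -[RHS]mulr1; congr (_ * _).
by move: e; rewrite mulrN opprK.
Qed.

Lemma rgS x1 x2 y1 m : rg x1 x2 y1 m.+1 =
  rg x1 x2 y1 m + kz * y1 * (kf m * rg x1 x2 y1 m)
  - kz * x1 * (kf m * rg x1 x2 y1 m.+1) - kz * x2 * (kb m * rg x1 x2 y1 m.+1).
Proof.
have := rgS_eq x1 x2 y1 m.
move: (kf m) (kb m) (rg x1 x2 y1 m) (rg x1 x2 y1 m.+1) kz => f b r r' z e.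
have -> : r + z * y1 * (f * r) = r * (1 + z * y1 * f) by ring.
by rewrite -e; ring.
Qed.

Record stable (X : (nat -> C) -> Prop) : Prop := Stable {
  stable_mod : modclass q X;
  stable_fw : forall f, X f -> X (fun n => fw n * f n);
  stable_Hb : forall f, X f -> X (fun n => lw Hb n * f n);
  stable_W : forall f g, X f -> W g -> X (fun n => f n * g n) }.

Lemma lspan_Hb P f : lspan q P f -> (fun n => lw Hb n * f n) =1 (fun n => (1 - q) * f n).
Proof. by move=> /lspan_at0 e [|n] //=; rewrite e !mulr0. Qed.

Lemma lspan_stable P : (forall f, lspan q P f -> lspan q P (fun n => fw n * f n)) ->
  (forall f g, lspan q P f -> W g -> lspan q P (fun n => f n * g n)) -> stable (lspan q P).
Proof.
move=> h h'; split=> //; first exact: modlspan.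
move=> f hf; apply: class_eq (mod_hbar (modlspan q P) hf) => n.
by rewrite (lspan_Hb hf).
Qed.

Lemma stable_St : stable St.
Proof.
apply: lspan_stable; last exact: StM.
by move=> f /fw_St /S2_Sc /Sc_St.
Qed.
Lemma stable_S2 : stable S2.
Proof.
apply: lspan_stable; last exact: S2M.
by move=> f /S2_Sc /Sc_St /fw_St.
Qed.
Lemma stable_Sn : stable Sn.
Proof. apply: lspan_stable; [exact: Sn_fw | exact: SnM]. Qed.
Lemma stable_N2 : stable N2.
Proof.
apply: lspan_stable; last exact: N2M.
by move=> f /N2_Sn /fw_Sn.
Qed.

(** A summand of index [m] may only be multiplied by partial sums below [m], whereas [rg] at [m.+1]
    contains the factor of index [m]. The recursion [rgS], solved degree by degree in z, expresses
    it through [rg] at [m]. *)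
Lemma KLn_rgS X x1 x2 y1 phi n : stable X -> rser x1 -> rser x2 -> rser y1 ->
  KLn n W (rg x1 x2 y1) -> KLn n X phi -> KLn n X (fun m => phi m * rg x1 x2 y1 m.+1).
Proof.
move=> [mX hf hb hW] h1 h2 h3 hrg hphi.
suff h k : (k <= n)%N -> KLn k X (fun m => phi m * rg x1 x2 y1 m.+1) by exact: h.
elim: k => // k IH kn.
have leK Y psi : KLn n Y psi -> KLn k.+1 Y psi by move=> h d a dk; apply: h; apply: leq_trans kn.
have hp : KLn n X (fun m => phi m * rg x1 x2 y1 m) by apply: KLn_mul mX hW hphi hrg.
have {}IH := IH (ltnW kn).
apply: (@KLn_eq _ _ _ (fun m => phi m * rg x1 x2 y1 m + kz * y1 * (kf m * (phi m * rg x1 x2 y1 m))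
  - kz * x1 * (kf m * (phi m * rg x1 x2 y1 m.+1)) - kz * x2 * (kb m * (phi m * rg x1 x2 y1 m.+1)))).
  move=> m; rewrite [in RHS]rgS.
  by move: (kf m) (kb m) (rg _ _ _ m) (rg _ _ _ m.+1) kz => f b r r' z; ring.
apply: (KLn_Sub mX); last by apply: (KLn_raise mX h2); exact: KLn_kC hb IH.
apply: (KLn_Sub mX); last by apply: (KLn_raise mX h1); exact: KLn_kC hf IH.
apply: (KLn_add mX); first exact: leK.
have hp' : KLn k X (fun m => phi m * rg x1 x2 y1 m).
  by move=> d a dk; apply: hp; apply: leq_trans kn; exact: ltnW.
by apply: (KLn_raise mX h3); exact: KLn_kC hf hp'.
Qed.

Lemma rg_psum x1 x2 y1 M : rg x1 x2 y1 M = 1 + psum (fun m => kz * y1 * (kf m * rg x1 x2 y1 m)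
  - kz * x1 * (kf m * rg x1 x2 y1 m.+1) - kz * x2 * (kb m * rg x1 x2 y1 m.+1)) M.
Proof.
elim: M => [|M IH]; first by rewrite psum0 addr0.
by rewrite psumS addrA -IH [LHS]rgS !addrA.
Qed.

Lemma KLn_const X c n : modclass q X -> X (fun _ => 1) -> rser c -> KLn n X (fun _ => c).
Proof.
move=> mX h1 hc d a _; have [p e] := hc d a.
by apply: class_eq (mod_scale mX p h1) => m; rewrite mulr1 e.
Qed.

Lemma St_fw_const n : KLn n St (fun m => kf m).
Proof.
have h : KLn n W (fun _ => 1 : K) by apply: KLn_const; [exact: modW | exact: W_one | exact: rser1].
apply: (@KLn_eq _ _ _ (fun m => kf m * 1)) => [m|]; first by rewrite mulr1.
apply: KLn_kC h => f hf; exact/Sc_St/fw_W.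
Qed.

Lemma St_Hb_const n : KLn n St (fun m => kb m).
Proof.
have h : KLn n W (fun _ => 1 : K) by apply: KLn_const; [exact: modW | exact: W_one | exact: rser1].
apply: (@KLn_eq _ _ _ (fun m => kb m * 1)) => [m|]; first by rewrite mulr1.
by apply: KLn_kC h => f hf; apply: lspan_gen.
Qed.

Lemma Sn_Hb_const n : KLn n Sn (fun m => kb m).
Proof.
have h : KLn n W (fun _ => 1 : K) by apply: KLn_const; [exact: modW | exact: W_one | exact: rser1].
apply: (@KLn_eq _ _ _ (fun m => kb m * 1)) => [m|]; first by rewrite mulr1.
by apply: KLn_kC h => f hf; apply: lspan_gen; right.
Qed.

Section One.
Variables x1 x2 y1 : K.
Hypotheses (h1 : rser x1) (h2 : rser x2) (h3 : rser y1).
Local Notation y := (rg x1 x2 y1).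

Lemma rg_W : KL W y.
Proof.
apply: KL_ind => n hn.
apply: (@KLn_eq _ _ _ (fun M => 1 + psum (fun m => kz * y1 * (kf m * rg x1 x2 y1 m)
  - kz * x1 * (kf m * rg x1 x2 y1 m.+1) - kz * x2 * (kb m * rg x1 x2 y1 m.+1)) M)).
  by move=> M; rewrite [RHS]rg_psum.
apply: KLn_add; [exact: modW | | ].
  by apply: KLn_const; [exact: modW | exact: W_one | exact: rser1].
apply: (KLn_psum (@St_psum _ q)).
have mS := modlspan q (genSt q).
apply: (KLn_Sub mS); last by apply: (KLn_raise mS h2); apply: (KLn_rgS stable_St) => //; exact: St_Hb_const.
apply: (KLn_Sub mS); last by apply: (KLn_raise mS h1); apply: (KLn_rgS stable_St) => //; exact: St_fw_const.
by apply: (KLn_raise mS h3); exact: (KLn_mul mS (@StM _ q) (@St_fw_const n) hn).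
Qed.

Lemma KL_rgS X phi : stable X -> KL X phi -> KL X (fun m => phi m * y m.+1).
Proof.
by move=> hX hp; apply/KLnP => n; apply: KLn_rgS => //; apply: KL_KLn => //; exact: rg_W.
Qed.

Local Notation y' := (rg x1 0 y1).

Lemma near_rgS X Y phi n : modclass q Y -> stable X -> stable Y ->
  (forall f g, X f -> I g -> Y (fun m => f m * g m)) ->
  (forall f, X f -> Y (fun m => lw Hb m * f m)) ->
  KLn n I (fun m => y' m - y m) -> KL X phi ->
  KLn n Y (fun m => phi m * (y' m.+1 - y m.+1)).
Proof.
move=> mY sX sY hXI hXb hn hphi.
suff h k : (k <= n)%N -> KLn k Y (fun m => phi m * (y' m.+1 - y m.+1)) by exact: h.
elim: k => // k IH kn.
have leK Z psi : KLn n Z psi -> KLn k.+1 Z psi by move=> h d a dk; apply: h; apply: leq_trans kn.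
have hp : KLn n Y (fun m => phi m * (y' m - y m)) by apply: (KLn_mul mY hXI) hn; exact: KL_KLn.
have {}IH := IH (ltnW kn).
apply: (@KLn_eq _ _ _ (fun m => phi m * (y' m - y m) + kz * y1 * (kf m * (phi m * (y' m - y m)))
  - kz * x1 * (kf m * (phi m * (y' m.+1 - y m.+1))) + kz * x2 * (kb m * (phi m * y m.+1)))).
  move=> m; rewrite [in RHS]rgS [X in _ = _ * (_ - X)]rgS.
  move: (kf m) (kb m) (rg x1 0 y1 m) (rg x1 0 y1 m.+1) (rg x1 x2 y1 m) (rg x1 x2 y1 m.+1) kz.
  by move=> f b r r' s s' z; ring.
apply: (KLn_add mY); last first.
  apply: (KLn_raise mY h2); apply: KLn_kC hXb _.
  by apply: KL_KLn; exact: KL_rgS.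
apply: (KLn_Sub mY); last by apply: (KLn_raise mY h1); exact: KLn_kC (stable_fw sY) IH.
apply: (KLn_add mY); first exact: leK.
have hp' : KLn k Y (fun m => phi m * (y' m - y m)).
  by move=> d a dk; apply: hp; apply: leq_trans kn; exact: ltnW.
by apply: (KLn_raise mY h3); exact: KLn_kC (stable_fw sY) hp'.
Qed.

Lemma St_hbar f : St f -> Sn (fun m => lw Hb m * f m).
Proof.
apply: lspan_lw => // u g [uv w]; split => //; left; split; first exact: circ_valid.
by case: u uv => [|k] _; rewrite evX; exact: I_hbar.
Qed.

(** Removing hbar from the denominators changes each step of [rgS] by a term with the letter [Hb],
    or by a multiple of the difference already reached. *)
Lemma near_rg : KL I (fun m => y' m - y m).
Proof.
apply: KL_ind => n hn.
have mS := modlspan q (genSn q).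
apply: (@KLn_eq _ _ _ (psum (fun m => kz * y1 * (kf m * (y' m - y m))
  - kz * x1 * (kf m * (y' m.+1 - y m.+1)) + kz * x2 * (kb m * y m.+1)))).
  move=> M; elim: M => [|M IH]; first by rewrite psum0 subrr.
  rewrite psumS IH [X in _ = X - _]rgS [X in _ = _ - X]rgS.
  move: (kf M) (kb M) (rg x1 0 y1 M) (rg x1 0 y1 M.+1) (rg x1 x2 y1 M) (rg x1 x2 y1 M.+1) kz.
  by move=> f b r r' s s' z; ring.
apply: (KLn_psum (@Sn_psum _ q)); apply: (KLn_add mS).
  apply: (KLn_Sub mS).
    by apply: (KLn_raise mS h3); exact: (KLn_mul mS (@StI _ q) (@St_fw_const n) hn).
  apply: (KLn_raise mS h1); apply: (near_rgS _ stable_St stable_Sn) => //.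
  - exact: StI.
  - exact: St_hbar.
  - by apply/KLnP => k; exact: St_fw_const.
apply: (KLn_raise mS h2).
apply: (KLn_rgS stable_Sn) => //; last exact: Sn_Hb_const.
by apply: KL_KLn; exact: rg_W.
Qed.

End One.
End Regularisation.
(** * The kernel intertwining the two sides of Ohno's relation *)

Section Kernel.
Variables (A : comNzRingType) (f h nu u qp : nat -> A) (t r : A).
Hypotheses (f0 : f 0%N = 0) (h0 : h 0%N = 0) (nu0 : nu 0%N = 0) (u0 : u 0%N = 0).
Hypothesis hf : forall m d, (0 < m)%N -> f m - f (m + d)%N = h (m + d)%N * f m * nu d.
Hypothesis hh : forall m d, (0 < m)%N -> h m - h (m + d)%N = h (m + d)%N * f m * nu d.
Hypothesis nuh : forall d, (0 < d)%N -> nu d * h d = 1.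
Hypothesis uf : forall m, (0 < m)%N -> u m * f m = 1.
Hypothesis unu : forall a b, (0 < a + b)%N -> (u a + nu b) * f (a + b)%N = qp b.
Hypothesis uh : forall m d, (0 < m)%N -> u m * h m * f (m + d)%N = qp d * h (m + d)%N.

Let dl : fps A := fun n => (n == 0%N)%:R.
(** In the application [f], [h], [nu], [u], [qp] at [m] are q^m / [m], 1 / [m], [m], [m] / q^m and
    q^m. For d > 0, [kap d] is the product of the [1 + t * h j] over 0 < j < d, and [ker d] is
    [t * h d * kap d]. *)
Definition ker : fps A := res h t dl.
Definition kap : fps A := psum ker.

Fixpoint cfac m : A := if m is m'.+1 then cfac m' * (1 - t * f m) else 1.
Fixpoint efac m : A := if m is m'.+1 then efac m' * (1 - t * f m + r * h m) else 1.

Lemma ker0 : ker 0%N = 1.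
Proof. by rewrite /ker resE h0 mulr0 mul0r addr0. Qed.

Lemma kerS d : ker d.+1 = t * h d.+1 * kap d.+1.
Proof. by rewrite /ker resE add0r. Qed.

Lemma kapS d : kap d.+1 = kap d + ker d. Proof. exact: psumS. Qed.

Lemma nu_ker d : nu d * ker d = t * kap d.
Proof.
case: d => [|d]; first by rewrite nu0 mul0r /kap psum0 mulr0.
by rewrite kerS mulrA mulrCA nuh // mulr1.
Qed.

Lemma nu_kerS d : t * ker d = nu d.+1 * ker d.+1 - nu d * ker d.
Proof. by rewrite !nu_ker /kap psumS; ring. Qed.

(** The intertwiner. By [Kop_y] it turns the weight h / (1 - t f) of [y] into [h], and by [Kop_f] it
    turns [x] into [x] followed by a geometric series in [y]; so it carries the lengthening of the
    runs of [x] into that of the runs of [y]. *)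
Definition Kop (theta : nat -> A) : fps A := pmul cfac theta * ker.

Lemma psum_Kop theta : (psum (Kop theta) : fps A) = pmul cfac theta * kap.
Proof. by rewrite /Kop psum_fpsMr. Qed.

Lemma Kop_f theta : theta 0%N = 0 ->
  Kop (fun m => f m * theta m) =1 res h t (fun n => f n * Kop theta n).
Proof.
move=> z; apply: res_uniq => n; rewrite psum_Kop /Kop !fpsM !mulr_sumr -big_split /=.
apply: eq_bigr => i _; rewrite /pmul; have [->|i0] := posnP i; first by rewrite z; ring.
have ni : n = (i + (n - i))%N by rewrite subnKC // -ltnS.
(* Moving [f] across the kernel leaves the defect [f i - f n], which contains [nu (n - i)]; this
   factor turns [ker] into its own partial sum [t * kap]. *)
have e : f i * ker (n - i)%N = f n * ker (n - i)%N + t * h n * f i * kap (n - i)%N.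
  have -> : t * h n * f i * kap (n - i)%N = h n * f i * (t * kap (n - i)%N) by ring.
  rewrite -nu_ker; have := hf (n - i) i0; rewrite -ni => {}e.
  by rewrite -[f i in LHS](subrK (f n)) e; ring.
have -> : cfac i * (f i * theta i) * ker (n - i)%N = cfac i * theta i * (f i * ker (n - i)%N) by ring.
by rewrite e; ring.
Qed.

Variable yw : nat -> A.
Hypothesis ywf : forall m, yw m * (1 - t * f m) = h m.

Lemma Kop_y theta : Kop (fun m => yw m * psum theta m) =1 (fun n => h n * psum (Kop theta) n).
Proof.
move=> n; rewrite psum_Kop /Kop !fpsM.
(* Summation by parts: the coefficients on the left are the differences [Q j - Q j.+1], and the
   boundary term [Q n] vanishes because [kap 0 = 0]. *)
pose Q b := h n * cfac b * kap (n - b)%N.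
suff S j : (j <= n)%N ->
    \sum_(m < j.+1) pmul cfac (fun m => yw m * psum theta m) m * ker (n - m)%N =
    \sum_(b < j.+1) theta b * Q b - psum theta j.+1 * Q j.
  have Qn : Q n = 0 by rewrite /Q subnn /kap psum0 mulr0.
  rewrite S // Qn mulr0 subr0 mulr_sumr.
  by apply: eq_bigr => b _; rewrite /Q /pmul; ring.
elim: j => [_|j IH jn].
  by rewrite !big_ord1 psumS psum0 add0r subrr /pmul psum0 mulr0 mulr0 mul0r.
rewrite big_ord_recr [in RHS]big_ord_recr IH 1?ltnW //= [X in _ = _ - X * _]psumS.
have nj : n = (j.+1 + (n - j.+1))%N by rewrite subnKC.
have e : pmul cfac (fun m => yw m * psum theta m) j.+1 * ker (n - j.+1)%N =
    psum theta j.+1 * (Q j - Q j.+1).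
  have -> : Q j - Q j.+1 = h j.+1 * cfac j * ker (n - j.+1)%N.
    have nj' : (n - j)%N = (n - j.+1).+1 by rewrite subnSK.
    rewrite /Q /= nj' kapS; set d := (n - j.+1)%N.
    have := nu_ker d; have := hh d (ltn0Sn j); rewrite -nj => e1 e2.
    have e3 : (h j.+1 - h n) * ker d = h n * f j.+1 * (t * kap d) by rewrite e1 -e2; ring.
    have -> : h n * cfac j * (kap d + ker d) - h n * (cfac j * (1 - t * f j.+1)) * kap d =
      h n * cfac j * ker d + cfac j * (h n * f j.+1 * (t * kap d)) by ring.
    by rewrite -e3; ring.
  rewrite /pmul /= -[h j.+1](ywf j.+1); ring.
by rewrite e; ring.
Qed.

Variables (y : nat -> A) (N : nat).
Hypothesis y1 : y 1%N = 1.
Hypothesis yS : forall n, y n = y n.+1 * (1 + r * h n).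

(** For m > 0, [f m * Tm m] is the sum of [ker (n - m) * f n * y n.+1] over m <= n < N. The term n =
    m is taken apart so that the definition still makes sense at 0, where it gives the initial value
    1. *)
Definition Tm m : A := y m.+1 + u m * \sum_(m.+1 <= n < N) ker (n - m)%N * f n * y n.+1.

(** A certificate for creative telescoping: the summand of the recursion of [Tm] in [m] is a
    difference in [n] of [qp (n - m) * ker (n - m) * y n]. *)
Lemma Tm_cert m n : (0 < m)%N -> (m <= n)%N ->
  ((1 - t * f m + r * h m) * u m * ker (n - m)%N - u m.-1 * ker (n - m).+1) * f n * y n.+1 =
  qp (n - m)%N * ker (n - m)%N * y n - qp (n - m).+1 * ker (n - m).+1 * y n.+1.
Proof.
move=> m0 mn; set d := (n - m)%N; rewrite (yS n).
have nm : (m + d)%N = n by rewrite subnKC.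
have nm' : (m.-1 + d.+1)%N = n by rewrite -nm; move: m0; lia.
have n0 : (0 < n)%N by apply: leq_trans mn.
have := nu_kerS d; have := uh d m0; rewrite nm => e1 e2.
have := @unu m d; have := @unu m.-1 d.+1; rewrite nm nm' => /(_ n0) e3 /(_ n0) e4.
have e5 := uf m0.
have -> : (1 - t * f m + r * h m) * u m * ker d - u m.-1 * ker d.+1 =
   u m * ker d - t * ker d * (u m * f m) + r * (u m * h m) * ker d - u m.-1 * ker d.+1 by ring.
rewrite e5 mulr1 e2.
have -> : u m * ker d - (nu d.+1 * ker d.+1 - nu d * ker d) + r * (u m * h m) * ker d
    - u m.-1 * ker d.+1 =
  (u m + nu d) * ker d - (u m.-1 + nu d.+1) * ker d.+1 + r * (u m * h m) * ker d by ring.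
rewrite mulrDl mulrBl.
have -> : (u m + nu d) * ker d * f n = (u m + nu d) * f n * ker d by ring.
have -> : (u m.-1 + nu d.+1) * ker d.+1 * f n = (u m.-1 + nu d.+1) * f n * ker d.+1 by ring.
have -> : r * (u m * h m) * ker d * f n = r * (u m * h m * f n) * ker d by ring.
by rewrite e3 e4 e1; ring.
Qed.

Lemma Tm_rec m : (m.+1 < N)%N ->
  (1 - t * f m.+1 + r * h m.+1) * Tm m.+1 = Tm m - qp (N - m.+1)%N * ker (N - m.+1)%N * y N.
Proof.
move=> mN.
have tel : \sum_(m.+1 <= n < N) ((1 - t * f m.+1 + r * h m.+1) * u m.+1 * ker (n - m.+1)%N
     - u m * ker (n - m.+1).+1) * f n * y n.+1 =
   y m.+1 - qp (N - m.+1)%N * ker (N - m.+1)%N * y N.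
  pose F n := - (qp (n - m.+1)%N * ker (n - m.+1)%N * y n).
  rewrite (eq_big_nat _ _ (F2 := fun n => F n.+1 - F n)) => [|n /andP[mn nN]]; last first.
    by rewrite Tm_cert // /F subSn // opprK addrC.
  rewrite (telescope_sumr _ (ltnW mN)) /F subnn ker0 mulr1 opprK addrC.
  have -> : qp 0 = 1 by rewrite -(@unu m.+1 0) // addn0 nu0 addr0 uf.
  by rewrite mul1r.
have -> : Tm m.+1 = u m.+1 * \sum_(m.+1 <= n < N) ker (n - m.+1)%N * f n * y n.+1.
  rewrite /Tm [in RHS]big_ltn //= subnn ker0 mul1r mulrDr.
  by rewrite [u m.+1 * (f m.+1 * _)]mulrA uf // mul1r.
have -> : Tm m = y m.+1 + u m * \sum_(m.+1 <= n < N) ker (n - m.+1).+1 * f n * y n.+1.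
  congr (_ + _ * _); apply: eq_big_nat => n /andP[mn _].
  by rewrite subnSK.
move: tel; under eq_bigr => n _ do rewrite mulrBl mulrBl.
rewrite sumrB => /eqP; rewrite subr_eq => /eqP e.
rewrite mulrA mulr_sumr mulr_sumr.
under eq_bigr => n _ do rewrite !mulrA.
rewrite e addrAC; congr (_ + _ - _).
by apply: eq_bigr => n _; rewrite !mulrA.
Qed.

Lemma Tm0 : Tm 0 = 1. Proof. by rewrite /Tm u0 mul0r addr0. Qed.

Lemma efac_Tm m : (m < N)%N ->
  efac m * Tm m = 1 - y N * \sum_(i < m) efac i * (qp (N - i.+1)%N * ker (N - i.+1)%N).
Proof.
elim: m => [_|m IH mN]; first by rewrite Tm0 big_ord0 mulr0 subr0 mulr1.
rewrite /= -mulrA Tm_rec // mulrBr IH 1?ltnW // big_ord_recr /=.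
by rewrite -/(efac m); ring.
Qed.

Variables (rho theta : nat -> A).
Hypothesis erho : forall m, efac m * rho m = cfac m.
Hypothesis theta0 : theta 0%N = 0.

(** Exchanging the summations leaves [cfac m * Tm m]. By [efac_Tm], [Tm m] is the inverse of
    [efac m] up to a remainder at [N], whence the factor [rho m]. *)
Lemma kernel_sum :
  psum (fun n => f n * Kop theta n * y n.+1) N - psum (fun m => f m * theta m * rho m) N =
  - (y N * \sum_(m < N) \sum_(i < m) (f m * theta m * rho m) * efac i *
      (qp (N - i.+1)%N * ker (N - i.+1)%N)).
Proof.
have -> : psum (fun n => f n * Kop theta n * y n.+1) N =
   \sum_(m < N) theta m * cfac m * (f m * Tm m).
  rewrite /psum; under eq_bigr => n _.
    rewrite /Kop fpsM mulr_sumr mulr_suml.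
    rewrite (big_ord_widen N (fun i => f n * (pmul cfac theta i * ker (n - i)%N) * y n.+1)) //.
    over.
  rewrite (exchange_big_dep xpredT) //=; apply: eq_bigr => m _.
  rewrite -(big_mkord (fun n => (m < n.+1)%N) (fun n => f n * (pmul cfac theta m * ker (n - m)%N) * y n.+1)).
  have -> : \sum_(0 <= n < N | (m < n.+1)%N) f n * (pmul cfac theta m * ker (n - m)%N) * y n.+1 =
      \sum_(m <= n < N) f n * (pmul cfac theta m * ker (n - m)%N) * y n.+1.
    by rewrite [RHS](big_nat_widenl _ 0) //; apply: eq_bigl => n; rewrite ltnS.
  have [->|m0] := posnP m.
    by rewrite theta0 !mul0r big1 // => n _; rewrite /pmul theta0; ring.
  have -> : f m * Tm m = \sum_(m <= n < N) ker (n - m)%N * f n * y n.+1.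
    by rewrite /Tm [RHS]big_ltn //= subnn ker0 mul1r mulrDr mulrA [f m * u m]mulrC uf // mul1r.
  by rewrite mulr_sumr; apply: eq_bigr => n _; rewrite /pmul; ring.
rewrite /psum -sumrB mulr_sumr -sumrN; apply: eq_bigr => m _.
have e : cfac m * Tm m = rho m * (efac m * Tm m) by rewrite -erho; ring.
have -> : theta m * cfac m * (f m * Tm m) = theta m * f m * (cfac m * Tm m) by ring.
rewrite e efac_Tm //.
under [in RHS]eq_bigr => i _ do rewrite -mulrA.
by rewrite -mulr_sumr; ring.
Qed.

End Kernel.
(** * Ohno's relation modulo the null classes *)

Section Tri.
Variable R : realType.
Local Notation C := R[i].
Implicit Types phi : nat -> C.

Lemma rate_shift (r : R) phi : rate r phi -> rate r (fun n => phi n.+1).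
Proof.
move=> h s s1; have [B hB] := h s s1; exists (B * (s * r)) => n.
by rewrite -mulrA -exprS.
Qed.

(** Since i < m, the exponents of [r] satisfy m + (N - i - 1) >= N; the middle factor and the number
    of terms are subexponential. *)
Lemma rate_tri (r : R) (f1 f2 f3 : nat -> C) : 0 < r < 1 -> rate r f1 -> rate 1 f2 -> rate r f3 ->
  rate r (fun N => \sum_(m < N) \sum_(i < m) f1 m * f2 i * f3 (N - i.+1)%N).
Proof.
move=> /andP[r0 r1] h1 h2 h3 s s1.
(* Of the four powers [t ^+ N] making up [s ^+ N], two bound the three factors and two the N^2
   terms. *)
pose t0 := Num.sqrt s; pose t := Num.sqrt t0.
have t01 : 1 < t0 by rewrite -[1]sqrtr1 ltr_sqrt //; lra.
have t1 : 1 < t by rewrite -[1]sqrtr1 ltr_sqrt //; lra.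
have ts : s = t ^+ 4.
  by rewrite (exprM t 2 2) /t sqr_sqrtr ?sqr_sqrtr //; lra.
have [B1 hB1] := h1 t t1; have [B2 hB2] := h2 t t1; have [B3 hB3] := h3 t t1.
have [H hH] := nat_le_exp t1.
have b1 := rate_ge0 hB1; have b2 := rate_ge0 hB2; have b3 := rate_ge0 hB3.
exists (B1 * B2 * B3 * H * H) => N.
have term (m i : nat) : (i < m)%N -> (m < N)%N ->
    normc (f1 m * f2 i * f3 (N - i.+1)%N) <= B1 * B2 * B3 * (t ^+ (2 * N) * r ^+ N).
  move=> im mN; rewrite !normcM.
  apply: le_trans (_ : B1 * (t * r) ^+ m * (B2 * (t * 1) ^+ i) * (B3 * (t * r) ^+ (N - i.+1)) <= _).
    apply: ler_pM; rewrite ?mulr_ge0 ?normc_ge0 //.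
    by apply: ler_pM; rewrite ?normc_ge0.
  rewrite mulr1 !exprMn.
  have -> : B1 * (t ^+ m * r ^+ m) * (B2 * t ^+ i) * (B3 * (t ^+ (N - i.+1) * r ^+ (N - i.+1))) =
    B1 * B2 * B3 * ((t ^+ m * t ^+ i * t ^+ (N - i.+1)) * (r ^+ m * r ^+ (N - i.+1))) by ring.
  apply: ler_wpM2l; first by rewrite !mulr_ge0.
  rewrite -!exprD; apply: ler_pM; rewrite ?exprn_ge0 //; try by [lra | exact: ltW].
    by rewrite ler_eXn2l //; lia.
  apply: ler_wiXn2l; [exact: ltW | exact: ltW | lia].
have tn k : 0 <= t ^+ k by rewrite exprn_ge0 //; lra.
have rn k : 0 <= r ^+ k by rewrite exprn_ge0 //; exact: ltW.
have T0 : 0 <= B1 * B2 * B3 * (t ^+ (2 * N) * r ^+ N) by rewrite !mulr_ge0.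
apply: le_trans (_ : \sum_(m < N) \sum_(i < N) B1 * B2 * B3 * (t ^+ (2 * N) * r ^+ N) <= _).
  apply: le_trans (normc_sum _ _ _) _; apply: ler_sum => m _.
  apply: le_trans (normc_sum _ _ _) _.
  rewrite (big_ord_widen N (fun i => normc (f1 m * f2 i * f3 (N - i.+1)%N))) 1?ltnW //.
  rewrite big_mkcond; apply: ler_sum => i _; case: ifP => // im.
  exact: term.
rewrite !sumr_const !card_ord -mulrnA -mulr_natl natrM.
have HN : N%:R * (N%:R : R) <= (H * t ^+ N) * (H * t ^+ N) by apply: ler_pM; rewrite ?ler0n.
apply: le_trans (ler_wpM2r T0 HN) _.
rewrite exprMn ts -exprM (_ : (4 * N)%N = (N + N + 2 * N)%N); last by ring.
by rewrite [t ^+ (N + N + 2 * N)]exprD [t ^+ (N + N)]exprD le_eqVlt; apply/orP; left; apply/eqP; ring.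
Qed.

End Tri.

Section Key.
Variables (R : realType) (q : R[i]).
Local Notation C := R[i].
Local Notation K := (ser C).
Hypothesis q01 : 0 < `|q| < 1.
Implicit Types (phi psi : nat -> K) (d a n : nat).
Notation fw := (fw q).
Notation lw := (lw q).
Notation St0 := (St0 q).
Notation S2 := (lspan q (genS2 q)).
Notation rser := (rser q).
Notation kz := (kz R).
Notation kf := (kf q).
Notation kh := (kh q).
Notation kb := (kb q).
Notation hw := (hw q).
Notation qint := (qint q).
Local Notation rho := (normc q).

Lemma mod_rate r : 0 <= r -> modclass q (@rate R r).
Proof.
move=> r0; split; [exact: rateD | by move=> p phi; exact: rateZ |].
by exists (fun _ => 0); exact: rate0.
Qed.

Lemma hwE m : (0 < m)%N -> hw m = (1 - q) / (1 - q ^+ m).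
Proof.
case: m => // m m0; rewrite /hw /fw /= /lw /qint; have h := qpow_neq1 q01 m0; have h1 := q_neq1 q01.
by field; rewrite h h1.
Qed.

Lemma fwE m : fw m = q ^+ m * (1 - q) / (1 - q ^+ m).
Proof. by rewrite /fw /qint invf_div mulrA. Qed.

Lemma fw_sub m d : (0 < m)%N -> fw m - fw (m + d) = hw (m + d) * fw m * qint d.
Proof.
move=> m0; rewrite !fwE hwE ?ltn_addr // /qint exprD.
have h := qpow_neq1 q01 m0; have h1 := q_neq1 q01.
have := @qpow_neq1 _ _ q01 (m + d) (ltn_addr d m0); rewrite exprD => hij.
by field; rewrite h h1 hij.
Qed.

Lemma hw_sub m d : (0 < m)%N -> hw m - hw (m + d) = hw (m + d) * fw m * qint d.
Proof.
move=> m0; rewrite -fw_sub //.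
have e k : (0 < k)%N -> hw k = fw k + (1 - q) by case: k.
by rewrite !e ?ltn_addr //; ring.
Qed.

Lemma qint_hw d : (0 < d)%N -> qint d * hw d = 1.
Proof.
move=> d0; rewrite hwE // /qint; have h := qpow_neq1 q01 d0; have h1 := q_neq1 q01.
by field; rewrite h h1.
Qed.

Definition ufw m : C := qint m / q ^+ m.

Lemma ufwM m : (0 < m)%N -> ufw m * fw m = 1.
Proof.
move=> m0; rewrite /ufw fwE /qint; have h := qpow_neq1 q01 m0; have h1 := q_neq1 q01.
by have h2 : q ^+ m != 0 by [rewrite expf_neq0 // q_neq0]; field; rewrite h h1 h2.
Qed.

Lemma ufwD a b : (0 < a + b)%N -> (ufw a + qint b) * fw (a + b) = q ^+ b.
Proof.
move=> ab; rewrite /ufw fwE /qint; have := qpow_neq1 q01 ab; rewrite exprD => h.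
have h1 := q_neq1 q01; have h2 : q ^+ a != 0 by rewrite expf_neq0 // q_neq0.
by field; rewrite h h1 h2.
Qed.

Lemma ufwh m d : (0 < m)%N -> ufw m * hw m * fw (m + d) = q ^+ d * hw (m + d).
Proof.
move=> m0; rewrite /ufw fwE !hwE ?ltn_addr // /qint exprD.
have h := qpow_neq1 q01 m0; have h1 := q_neq1 q01.
have h2 : q ^+ m != 0 by rewrite expf_neq0 // q_neq0.
have := @qpow_neq1 _ _ q01 (m + d) (ltn_addr d m0); rewrite exprD => hij.
by field; rewrite h h1 h2 hij.
Qed.

Lemma kfhb m : kh m = kf m + kb m. Proof. exact: kCD. Qed.

Variables x r0 : K.
Hypotheses (hx : rser x) (hr : rser r0).
Local Notation t := (kz * x).
Local Notation r := (kz * r0).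
Local Notation knu := (fun m => kC (qint m) : K).
Local Notation ku := (fun m => kC (ufw m) : K).
Local Notation kq := (fun m => kC (q ^+ m) : K).
Local Notation yh := (yw q x hw).
Local Notation ker := (ker kh t).
Local Notation Kop := (Kop kf kh t).

Lemma qint0 : qint 0 = 0. Proof. by rewrite /qint expr0 subrr mul0r. Qed.

Lemma yh_spec m : yh m * (1 - t * kf m) = kh m.
Proof.
rewrite mulrBr mulr1 [X in X - _]ywE (_ : kC (hw m) = kh m) //.
by move: (kh m) (kf m) (yh m) => h f w; ring.
Qed.

Lemma knu0 : kC (qint 0) = 0 :> K. Proof. by rewrite qint0 kC0. Qed.
Lemma kfh_sub m d : (0 < m)%N -> kf m - kf (m + d) = kh (m + d) * kf m * knu d.
Proof. by move=> m0; rewrite -!kCM -fw_sub // kCD kCN. Qed.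
Lemma khh_sub m d : (0 < m)%N -> kh m - kh (m + d) = kh (m + d) * kf m * knu d.
Proof. by move=> m0; rewrite -!kCM -hw_sub // kCD kCN. Qed.
Lemma knu_kh d : (0 < d)%N -> knu d * kh d = 1.
Proof. by move=> d0; rewrite -kCM qint_hw // kC1. Qed.

Lemma run_Kop a theta : run kh a (Kop theta) =1 Kop (run yh a theta).
Proof.
elim: a => [|a IH] n; first by [].
transitivity (kh n * psum (Kop (run yh a theta)) n).
  by congr (_ * _); apply: eq_psum => m; exact: IH.
symmetry; exact: (@Kop_y K kf kh knu t knu0 khh_sub knu_kh yh yh_spec).
Qed.

Lemma est0 gy b L : est kf gy (b :: L) 0%N = 0 :> K.
Proof. by rewrite /= kf0 mul0r. Qed.

Lemma hw0 : hw 0 = 0. Proof. by rewrite /hw fw0 lw0 addr0. Qed.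

Lemma run_est0 a L : tame (a :: L) -> run yh a (est kf yh L) 0%N = 0.
Proof.
move=> /tame_behead[_]; case: a => [|a] /=; last by rewrite yw0 ?mul0r ?hw0.
by case: L => [[]|b L _] //; exact: est0.
Qed.

(** Induction over the runs, with [Kop_f] at each [x] and [Kop_y] at each [y]. *)
Lemma res_ust_Kop L : tame L -> res kh t (ust kf kh t L) =1 Kop (est kf yh L).
Proof.
elim: L => [|a L IH] hL n.
  rewrite /Kop (_ : pmul _ _ = 1) ?mul1r //.
  by apply: funext => -[|m]; rewrite /pmul /= ?mulr1 // mulr0.
have [hL' _] := tame_behead hL.
have -> : ust kf kh t (a :: L) = fun n => kf n * Kop (run yh a (est kf yh L)) n.
  apply: funext => m; rewrite [LHS]/= (funext (IH hL')).
  by rewrite run_Kop.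
symmetry; exact: (@Kop_f K kf kh knu t knu0 kfh_sub knu_kh _ (run_est0 hL)).
Qed.

Lemma ust_Kop a L : tame (a :: L) ->
  ust kf kh t (a :: L) =1 fun n => kf n * Kop (run yh a (est kf yh L)) n.
Proof.
move=> hL n; have [hL' _] := tame_behead hL.
by rewrite [LHS]/= (funext (res_ust_Kop hL')) run_Kop.
Qed.

Local Notation yA := (rg q r0 r0 0).
Local Notation yE := (rg q (r0 - x) r0 (- x)).
Local Notation efac := (efac kf kh t r).

Lemma yA_step n : yA n = yA n.+1 * (1 + r * kh n).
Proof.
have := rgS_eq q r0 r0 0 n; rewrite mulr0 mul0r addr0 mulr1 => <-.
by rewrite kfhb; move: (kf n) (kb n) (yA n.+1) => f b y; ring.
Qed.

Lemma yA1 : yA 1 = 1.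
Proof. by have := yA_step 0; rewrite kh0 mulr0 addr0 mulr1 => <-. Qed.

Lemma yE1 : yE 1 = 1.
Proof.
have := rgS_eq q (r0 - x) r0 (- x) 0; rewrite kf0 /kb lw0 kC0.
by rewrite !mulr0 !addr0 !mulr0 !addr0 !mulr1.
Qed.

Lemma efac_yE m : efac m * yE m.+1 = cfac kf t m.
Proof.
elim: m => [|m IH]; first by rewrite yE1 mulr1.
have e := rgS_eq q (r0 - x) r0 (- x) m.+1.
rewrite [efac _]/= [cfac _ _ _]/= -IH.
transitivity (efac m * (yE m.+2 * (1 + kz * ((r0 - x) * kf m.+1 + r0 * kb m.+1)))).
  by rewrite kfhb; move: (kf m.+1) (kb m.+1) (yE m.+2) (efac m) => f b y e'; ring.
by rewrite e; move: (kf m.+1) (yE m.+1) (efac m) => f y e'; ring.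
Qed.

(** [yA] is the product of the 1 / (1 + r h_j), and [yE] below that of the (1 - t f_j) / (1 - t f_j
    + r h_j). These are the summands left once the geometric series in R has been split off, for the
    weights h and h / (1 - t f) of [y]. *)
Definition ubar a L m := ust kf kh t (a :: L) m * yA m.+1.
Definition ebar a L m := est kf yh (a :: L) m * yE m.+1.

Lemma bar_sum a L N : tame (a :: L) ->
  psum (ubar a L) N - psum (ebar a L) N =
  - (yA N * \sum_(m < N) \sum_(i < m) ebar a L m * efac i *
      (kq (N - i.+1)%N * ker (N - i.+1)%N)).
Proof.
move=> hL.
have h2 m : (0 < m)%N -> kC (ufw m) * kf m = 1 by move=> m0; rewrite -kCM ufwM // kC1.
have h3 a' b : (0 < a' + b)%N -> (kC (ufw a') + kC (qint b)) * kf (a' + b) = kC (q ^+ b).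
  by move=> ab; rewrite -kCD -kCM ufwD.
have h4 m d : (0 < m)%N -> kC (ufw m) * kh m * kf (m + d) = kC (q ^+ d) * kh (m + d).
  by move=> m0; rewrite -!kCM ufwh.
have h6 : kC (ufw 0) = 0 by rewrite /ufw qint0 mul0r kC0.
rewrite -(@kernel_sum K kf kh knu ku kq t r (kh0 q) knu0 h6 knu_kh h2 h3 h4 yA N yA1 yA_step
  (fun m => yE m.+1) (run yh a (est kf yh L)) efac_yE (run_est0 hL)).
by congr (_ - _); apply: eq_psum => m; rewrite /ubar ust_Kop.
Qed.

Lemma S2_rate f : S2 f -> rate rho f.
Proof. by move=> /S2_Sc; exact: Sc_rate. Qed.

Lemma St0_rate f : St0 f -> rate 1 f.
Proof.
have r1 := mod_rate ler01.
move=> [p [g [hg ->]]]; apply: (mod_add r1); last first.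
  elim: hg => {g} [|u g [uv w]|g g' _ h _ h'|p' g _ h].
  - exact: rate0.
  - by have := rateM ler01 ler01 (rate_lw q01 uv) (W_rate q01 w); rewrite mulr1.
  - exact: rateD.
  - exact: rateZ.
apply: rateZ => s s1; exists 1 => n; rewrite mul1r mulr1 /dirac.
have s0 : 1 <= s ^+ n by rewrite exprn_ege1 // ltW.
by case: (n == 0%N); rewrite ?normc1 ?normc0 //; apply: le_trans s0.
Qed.

Lemma efac_rate : KL (@rate R 1) efac.
Proof.
have r1 := mod_rate ler01.
have shift gc n (phi : nat -> K) : rate 1 gc -> KLn n (@rate R 1) phi ->
    KLn n (@rate R 1) (fun m => kC (gc m.+1) * phi m).
  move=> hg; apply: (KLn_kC (c := fun m => gc m.+1)) => f h.
  by have := rateM ler01 ler01 (rate_shift hg) h; rewrite mulr1.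
apply: KL_ind => n hn.
apply: (@KLn_eq _ _ _ (fun m => 1 + psum (fun j =>
    kz * r0 * (kC (hw j.+1) * efac j) - kz * x * (kC (fw j.+1) * efac j)) m)).
  move=> m; elim: m => [|m IH]; first by rewrite psum0 addr0.
  rewrite psumS addrA IH [RHS]/=; rewrite -/(efac m) (_ : kC (hw m.+1) = kh m.+1) //.
  rewrite (_ : kC (fw m.+1) = kf m.+1) //.
  by move: (kh m.+1) (kf m.+1) (efac m) => h f e; ring.
apply: (KLn_add r1).
  by apply: KLn_const; [exact: r1 | exact: rate1 | exact: rser1].
apply: (KLn_psum (Y := @rate R 1) (X := @rate R 1)); first by move=> f; exact: rate_psum.
apply: (KLn_Sub r1).
  apply: (KLn_raise r1 hr); apply: shift hn; apply: rateD; last exact: rate_lw.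
  by move=> s /(@rate_lw _ _ q01 (G 1) isT) [B hB]; exists B => m; rewrite -lwG1.
apply: (KLn_raise r1 hx); apply: shift hn.
by move=> s /(@rate_lw _ _ q01 (G 1) isT) [B hB]; exists B => m; rewrite -lwG1.
Qed.

Lemma KL_tri (X1 X2 X3 Y : (nat -> C) -> Prop) (phi1 phi2 phi3 : nat -> K) : modclass q Y ->
  (forall f1 f2 f3, X1 f1 -> X2 f2 -> X3 f3 ->
     Y (fun N => \sum_(m < N) \sum_(i < m) f1 m * f2 i * f3 (N - i.+1)%N)) ->
  KL X1 phi1 -> KL X2 phi2 -> KL X3 phi3 ->
  KL Y (fun N => \sum_(m < N) \sum_(i < m) phi1 m * phi2 i * phi3 (N - i.+1)%N).
Proof.
move=> mY h h1 h2 h3 d a.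
apply: (@class_eq _ _ (fun N => \sum_(d1 < d.+1) \sum_(a1 < a.+1) \sum_(d2 < d1.+1) \sum_(a2 < a1.+1)
   \sum_(m < N) \sum_(i < m) cf d2 a2 (phi1 m) * cf (d1 - d2) (a1 - a2) (phi2 i) *
      cf (d - d1) (a - a1) (phi3 (N - i.+1)%N))); last first.
  apply: (@mod_sum _ q) => // d1 _; apply: (@mod_sum _ q) => // a1 _.
  apply: (@mod_sum _ q) => // d2 _; apply: (@mod_sum _ q) => // a2 _.
  exact: (h _ _ _ (h1 d2 a2) (h2 (d1 - d2)%N (a1 - a2)%N) (h3 (d - d1)%N (a - a1)%N)).
move=> N; rewrite cf_sum.
under [RHS]eq_bigr => m _.
  rewrite cf_sum.
  under eq_bigr => i _.
    rewrite cfM.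
    under eq_bigr => d1 _.
      under eq_bigr => a1 _.
        rewrite cfM mulr_suml.
        under eq_bigr => d2 _ do rewrite mulr_suml.
        over.
      over.
    over.
  over.
rewrite /=.
under [RHS]eq_bigr => m _ do rewrite exchange_big /=.
rewrite [RHS]exchange_big /=; apply: eq_bigr => d1 _.
under [RHS]eq_bigr => m _ do rewrite exchange_big /=.
rewrite [RHS]exchange_big /=; apply: eq_bigr => a1 _.
under [RHS]eq_bigr => m _ do rewrite exchange_big /=.
rewrite [RHS]exchange_big /=; apply: eq_bigr => d2 _.
under [RHS]eq_bigr => m _ do rewrite exchange_big /=.
by rewrite [RHS]exchange_big.
Qed.

(** In the remainder of [bar_sum], [ebar] and [q ^+ j] times the kernel decay like powers of q while
    the other factors are subexponential, so [rate_tri] applies. *)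
Lemma bar_rate a L : tame (a :: L) ->
  KL (@rate R rho) (fun N => psum (ubar a L) N - psum (ebar a L) N).
Proof.
move=> hL; have r1 := mod_rate ler01; have rr := mod_rate (rho_ge0 q01).
have he : KL (@rate R rho) (ebar a L).
  apply: (KL_sub S2_rate); apply: KL_rgS => //; try exact: stable_S2.
  - exact: (rserD hr (rserN hx)).
  - exact: rserN.
  - by apply: (est_S2 hx) => f; exact: St0_h_psum.
have hk : KL (@rate R rho) (fun j => kq j * ker j).
  have kSt0 : KL St0 (ker : nat -> K).
    apply: (KL_res (gc := hw) (modSt0 q)) => //; first by move=> f; exact: St0_h_psum.
    by apply: KL_dirac; [exact: modSt0 | exact/D_St0/D_dirac].
  apply: (KL_kC (gc := fun j => q ^+ j) (X := St0)) kSt0 => f /St0_rate h.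
  have hq : rate rho (fun j => q ^+ j).
    move=> s s1; exists 1 => n; rewrite mul1r normcX; apply: lerXn2r.
    - by rewrite nnegrE normc_ge0.
    - by rewrite nnegrE mulr_ge0 ?normc_ge0 //; lra.
    - by have := rho_ge0 q01; nra.
  by have := rateM (rho_ge0 q01) ler01 hq h; rewrite mulr1.
have hy : KL (@rate R 1) yA.
  by apply: (KL_sub (W_rate q01)); apply: rg_W => //; move=> d b; exists 0; rewrite cf0 ev0.
have h3 := KL_tri rr (fun f1 f2 f3 h1 h2 h3 => rate_tri (rho01 q01) h1 h2 h3) he efac_rate hk.
have h4 : KL (@rate R rho) (fun N => yA N * \sum_(m < N) \sum_(i < m) ebar a L m * efac i *
      (kq (N - i.+1)%N * ker (N - i.+1)%N)).
  apply: (KL_mul (X := @rate R 1) (Y := @rate R rho) rr _ hy h3) => f g hf hg.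
  by have := rateM ler01 (rho_ge0 q01) hf hg; rewrite mul1r.
move=> d b; apply: class_eq (mod_opp rr (h4 d b)) => N.
by rewrite bar_sum // cfN.
Qed.

End Key.
(** * Limits of series and the ideal generated by even zeta values *)

Section Limits.
Variables (R : realType) (q : R[i]).
Local Notation C := R[i].
Local Notation K := (ser C).
Hypothesis q01 : 0 < `|q| < 1.
Implicit Types (phi psi : nat -> K) (d a n : nat) (f g : nat -> C) (l : K).
Notation fw := (fw q).
Notation S2 := (lspan q (genS2 q)).
Notation Sc := (lspan q (genSc q)).
Notation N2 := (lspan q (genN2 q)).
Notation rser := (rser q).
Notation kz := (kz R).
Notation kf := (kf q).
Notation rg := (rg q).
Notation Zval := (Zval q).
Notation N2val := (N2val q).
Notation Pval := (Pval q).

Lemma rg00 m : rg 0 0 0 m = 1.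
Proof.
elim: m => // m IH; have := rgS_eq q 0 0 0 m.
by rewrite IH !mulr0 !mul0r addr0 mulr0 addr0 !mulr1.
Qed.

Lemma rg_cancel x y m : rg x 0 y m * rg 0 0 x m = rg 0 0 y m.
Proof.
elim: m => [|m IH]; first by rewrite /= mulr1.
have P z : rg 0 0 z m.+1 = rg 0 0 z m * (1 + kz * z * kf m).
  by have := rgS_eq q 0 0 z m; rewrite !mul0r addr0 mulr0 addr0 mulr1.
have := rgS_eq q x 0 y m; rewrite mul0r addr0 !P -IH.
move: (rg x 0 y m.+1) (rg x 0 y m) (rg 0 0 x m) (kf m) kz => u v w f0 z e.
have -> : u * (w * (1 + z * x * f0)) = u * (1 + z * (x * f0)) * w by ring.
by rewrite e; ring.
Qed.

Lemma rg_inv x y m : rg x 0 y m * rg y 0 x m = 1.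
Proof.
have h := rg_cancel x 0 m; rewrite rg00 in h.
rewrite -[LHS]mulr1; transitivity (rg x 0 y m * rg y 0 x m * (rg x 0 0 m * rg 0 0 x m)); first by rewrite h.
have -> : rg x 0 y m * rg y 0 x m * (rg x 0 0 m * rg 0 0 x m) =
  (rg x 0 y m * rg 0 0 x m) * rg y 0 x m * rg x 0 0 m by ring.
by rewrite rg_cancel [rg 0 0 y m * _]mulrC rg_cancel mulrC.
Qed.

(** Variation of constants: the partial sums satisfy a first order recursion, and [p] solves its
    homogeneous form. *)
Lemma psum_res_rg (g : nat -> K) (r : K) (p y : nat -> K) phi M :
  p 0%N = 1 -> (forall m, p m.+1 = p m * (1 + r * g m)) -> (forall m, p m * y m = 1) ->
  psum (res g r phi) M = p M * psum (fun m => phi m * y m.+1) M.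
Proof.
move=> p0 pS py; elim: M => [|M IH]; first by rewrite !psum0 mulr0.
rewrite !psumS mulrDr mulrCA py mulr1 pS resE IH.
by move: (p M) (g M) (psum (fun m => phi m * y m.+1) M) => u v w; ring.
Qed.

Lemma rg_Pi x m : rg 0 0 x m.+1 = rg 0 0 x m * (1 + kz * x * kf m).
Proof.
by have := rgS_eq q 0 0 x m; rewrite !mul0r addr0 mulr0 addr0 mulr1.
Qed.

Definition cvgK phi l := forall d a, cvgC (fun M => cf d a (phi M)) (cf d a l).
Definition KV (X : C -> Prop) (x : K) := forall d a, X (cf d a x).

Lemma cvgK_eq phi psi l : phi =1 psi -> cvgK phi l -> cvgK psi l.
Proof. by move=> /funext ->. Qed.
Lemma cvgK_eq1 phi psi l : (forall M, (0 < M)%N -> phi M = psi M) -> cvgK phi l -> cvgK psi l.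
Proof.
move=> e h d a; have /cvgCP c := h d a; apply/cvgCP => eps e0.
have [N hN] := c eps e0; exists N.+1 => n hn; rewrite -e; last by apply: leq_ltn_trans hn.
by apply: hN; exact: ltnW.
Qed.
Lemma cvgK_cst l : cvgK (fun _ => l) l. Proof. by move=> d a; exact: cvgC_cst. Qed.
Lemma cvgK_unique phi l l' : cvgK phi l -> cvgK phi l' -> l = l'.
Proof. by move=> h h'; apply: kserP => d a; exact: cvgC_unique (h d a) (h' d a). Qed.
Lemma cvgKD phi psi l l' : cvgK phi l -> cvgK psi l' -> cvgK (fun M => phi M + psi M) (l + l').
Proof. by move=> h h' d a; exact: cvgCD (h d a) (h' d a). Qed.
Lemma cvgKM phi psi l l' : cvgK phi l -> cvgK psi l' -> cvgK (fun M => phi M * psi M) (l * l').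
Proof.
move=> h h' d a; rewrite cfM.
apply: (@cvgC_eq _ (fun M => \sum_(i < d.+1) \sum_(b < a.+1)
   cf i b (phi M) * cf (d - i) (a - b) (psi M))) => [M|]; first by rewrite cfM.
by apply: cvgC_sum => i; apply: cvgC_sum => b; exact: cvgCM (h i b) (h' _ _).
Qed.
Lemma cvgKN phi l : cvgK phi l -> cvgK (fun M => - phi M) (- l).
Proof.
move=> h; apply: (@cvgK_eq (fun M => -1 * phi M)) => [M|]; first by rewrite mulN1r.
by rewrite -[X in cvgK _ X]mulN1r; exact: (cvgKM (cvgK_cst _) h).
Qed.

Lemma cvgK_ex phi : (forall d a, exists v : C, cvgC (fun M => cf d a (phi M)) v) -> exists l, cvgK phi l.
Proof.
move=> h; have [l hl] := choice (fun p => h p.1 p.2).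
by exists (fun d a => l (d, a)) => d a; exact: (hl (d, a)).
Qed.

Lemma Sc_cvgK phi : KL Sc phi -> exists l, cvgK (psum phi) l.
Proof.
move=> h; apply: cvgK_ex => d a; have [l hl] := Sc_cvg q01 (h d a).
by exists l; apply: cvgC_eq hl => M; rewrite cf_psum.
Qed.

Lemma S2_KV phi l : KL S2 phi -> cvgK (psum phi) l -> KV Zval l.
Proof.
move=> h c d a; apply: Zval_S2 (h d a) _.
by apply: cvgC_eq (c d a) => M; rewrite cf_psum.
Qed.

Definition idl (X : C -> Prop) := [/\ X 0, forall x y, X x -> X y -> X (x + y) &
  forall x y, Zval x -> X y -> X (x * y)].

Lemma idl_sum X (T : finType) (F : T -> C) : idl X -> (forall i, X (F i)) -> X (\sum_i F i).
Proof. by move=> [x0 xD _] h; elim/big_ind: _. Qed.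

Lemma idl_Z : idl Zval.
Proof.
split; [by rewrite -(ev0 q); exact: Zval_const | exact: Zval_add | exact: Zval_mul].
Qed.
Lemma idl_N2 : idl N2val.
Proof.
split; [exact: N2val0 | exact: N2val_add |].
by move=> x y hx hy; rewrite mulrC; exact: N2val_mul.
Qed.
Lemma idl_P : idl Pval.
Proof. split; [exact: P_zero | exact: P_add | exact: Pval_mul]. Qed.

(** Built on [N2val] and not on [Nval], because [N2val_mul] lets it absorb products with values in
    Z_q. *)
Definition Mval (z : C) := exists v y : C, [/\ N2val v, Pval y & z = v + y].
Lemma idl_M : idl Mval.
Proof.
split.
- by exists 0, 0; rewrite addr0; split=> //; [exact: N2val0 | exact: P_zero].
- move=> _ _ [n [y [h1 h2 ->]]] [n' [y' [h1' h2' ->]]]; exists (n + n'), (y + y').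
  by split; [exact: N2val_add | exact: P_add | ring].
- move=> x _ hx [n [y [h1 h2 ->]]]; exists (x * n), (x * y).
  by split; [case: idl_N2 => _ _; apply | exact: Pval_mul | ring].
Qed.
Lemma N2_M x : N2val x -> Mval x.
Proof. by move=> h; exists x, 0; rewrite addr0; split=> //; exact: P_zero. Qed.
Lemma P_M x : Pval x -> Mval x.
Proof. by move=> h; exists 0, x; rewrite add0r; split=> //; exact: N2val0. Qed.
Lemma M_NP x : Mval x -> NPval q x.
Proof. by move=> [n [y [h1 h2 ->]]]; exists n, y; split=> //; exact: N2_Nval. Qed.

Lemma KVD X x y : idl X -> KV X x -> KV X y -> KV X (x + y).
Proof. by move=> [_ h _] hx hy d a; exact: (h _ _ (hx d a) (hy d a)). Qed.
Lemma KVM X x y : idl X -> KV Zval x -> KV X y -> KV X (x * y).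
Proof.
move=> hX hx hy d a; rewrite cfM; have [_ _ h] := hX.
apply: (idl_sum hX) => i; apply: (idl_sum hX) => b.
exact: (h _ _ (hx _ _) (hy _ _)).
Qed.
Lemma KVN X x : idl X -> KV X x -> KV X (- x).
Proof.
move=> [_ _ h] hx d a; rewrite cfN -mulN1r -(ev1 q) -evN; apply: h => //.
exact: Zval_const.
Qed.
Lemma KVB X x y : idl X -> KV X x -> KV X y -> KV X (x - y).
Proof. by move=> hX hx hy; apply: KVD => //; exact: KVN. Qed.
Lemma rser_KV x : rser x -> KV Zval x.
Proof. by move=> h d a; have [p ->] := h d a; exact: Zval_const. Qed.

Fact psum_four d a u1 e1 u2 e2 M :
  cf d a (psum u1 M) + -1 * cf d a (psum e1 M) + -1 * cf d a (psum u2 M - psum e2 M) =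
  psum (fun m => cf d a (u1 m - u2 m) - cf d a (e1 m - e2 m)) M :> C.
Proof.
rewrite cfB !cf_psum; elim: M => [|M IH]; first by rewrite !psum0; ring.
by rewrite !psumS -IH !cfB; ring.
Qed.

Section KeyValues.
Variables x r0 : K.
Hypotheses (hx : rser x) (hr : rser r0).

(** [bu] and [be] are [ubar] and [ebar] with [f] in place of [f + hbar], in the letters [y] and in
    the products alike. *)
Definition bu L m := ust kf kf (kz * x) L m * rg r0 0 0 m.+1.
Definition be L m := est kf (yw q x fw) L m * rg (r0 - x) 0 (- x) m.+1.

Lemma rser0 : rser 0. Proof. by move=> d a; exists 0; rewrite cf0 ev0. Qed.

Lemma bu_S2 a L : KL S2 (bu (a :: L)).
Proof.
apply: KL_rgS => //; try exact: rser0; first exact: stable_S2.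
by apply: (ust_S2 (gc := fw) hx) => f; exact: St0_fw_psum.
Qed.

Lemma be_S2 a L : KL S2 (be (a :: L)).
Proof.
apply: KL_rgS => //; try exact: rser0.
- exact: (rserD hr (rserN hx)).
- exact: rserN.
- exact: stable_S2.
by apply: (est_S2 hx) => f; exact: St0_fw_psum.
Qed.

Lemma near_mul x1 y1 phi psi : rser x1 -> rser y1 -> near N2 phi psi -> KL S2 psi ->
  near N2 (fun m => phi m * rg x1 0 y1 m.+1) (fun m => psi m * rg x1 r0 y1 m.+1).
Proof.
move=> h1 h3 hn hpsi; have mN := modlspan q (genN2 q).
apply/KLnP => n.
apply: (@KLn_eq _ _ _ (fun m => (phi m - psi m) * rg x1 0 y1 m.+1 +
   psi m * (rg x1 0 y1 m.+1 - rg x1 r0 y1 m.+1))).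
  by move=> m; rewrite mulrBl mulrBr addrA subrK.
apply: (KLn_add mN).
  by apply: KL_KLn; apply: KL_rgS => //; [exact: rser0 | exact: stable_N2].
apply: (near_rgS h1 hr h3 mN (stable_S2 q) (stable_N2 q)) => //.
- exact: S2I.
- by move=> f hf; apply: class_eq (Sc_hbar (S2_Sc hf)) => m; rewrite (lspan_Hb hf).
- by apply: KL_KLn; apply: near_rg.
Qed.

(** Passing to the weight [f + hbar] costs summands in [N2] on each side; afterwards the difference
    tends to 0 by [bar_rate]. *)
Lemma key_values a L bl el : tame (a :: L) ->
  cvgK (psum (bu (a :: L))) bl -> cvgK (psum (be (a :: L))) el -> KV N2val (bl - el).
Proof.
move=> hL cb ce d b; have mN := modlspan q (genN2 q).
have n1 : near N2 (bu (a :: L)) (ubar q x r0 a L).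
  apply: near_mul => //; [exact: rser0 | exact: near_ust_N2 |].
  by apply: (ust_S2 (gc := hw q) hx) => f; exact: St0_h_psum.
have n2 : near N2 (be (a :: L)) (ebar q x r0 a L).
  apply: near_mul => //.
  - exact: (rserD hr (rserN hx)).
  - exact: rserN.
  - exact: near_est_N2.
  by apply: (est_S2 hx) => f; exact: St0_h_psum.
exists (fun m => cf d b (bu (a :: L) m - ubar q x r0 a L m) - cf d b (be (a :: L) m - ebar q x r0 a L m)).
  by apply: (mod_sub mN); [exact: n1 | exact: n2].
have c0 := rate_cvg0 (rho01 q01) (bar_rate q01 hx hr hL d b).
have := cvgCD (cvgCD (cb d b) (cvgCM (cvgC_cst (-1)) (ce d b))) (cvgCM (cvgC_cst (-1)) c0).
rewrite mulr0 addr0 mulN1r cfB; apply: cvgC_eq => M.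
exact: psum_four.
Qed.

End KeyValues.
End Limits.

(** * Regularising products modulo the even zeta values *)

Section EvenZeta.
Variables (R : realType) (q : R[i]).
Local Notation C := R[i].
Local Notation K := (ser C).
Hypothesis q01 : 0 < `|q| < 1.
Implicit Types (phi psi : nat -> K) (d a n : nat) (f g : nat -> C) (l : K).
Notation fw := (fw q).
Notation lw := (lw q).
Notation W := (W q).
Notation S2 := (lspan q (genS2 q)).
Notation rser := (rser q).
Notation kz := (kz R).
Notation kf := (kf q).
Notation rg := (rg q).
Notation Zval := (Zval q).
Notation N2val := (N2val q).
Notation Pval := (Pval q).
Notation Mval := (Mval q).

(* Elementary symmetric functions and power sums of the [f_m ^ 2], [m < M]. *)
Fixpoint ep i : nat -> C :=
  if i is i'.+1 then psum (fun m => fw m ^+ 2 * ep i' m) else fun _ => 1.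
Definition pw a : nat -> C := psum (fun m => fw m ^+ (2 * a)).

(** Induction on the number of variables [f_m ^ 2], the identity being needed in two consecutive
    degrees. *)
Lemma ep_newton i M :
  i%:R * ep i M = \sum_(a < i) (-1) ^+ a * pw a.+1 M * ep (i.-1 - a)%N M.
Proof.
elim: M i => [|M IH] [|n]; rewrite ?mul0r ?big_ord0 //.
  by rewrite /= psum0 mulr0 big1 // => a _; rewrite /pw psum0 mulr0 mul0r.
pose epp j := if j is j'.+1 then ep j' M else 0.
have epS j : ep j M.+1 = ep j M + fw M ^+ 2 * epp j.
  by case: j => [|j]; rewrite /= ?mulr0 ?addr0 ?psumS.
have e1 : \sum_(a < n.+1) (-1) ^+ a * pw a.+1 M * epp (n - a)%N = n%:R * ep n M.
  rewrite big_ord_recr /= subnn mulr0 addr0 IH; apply: eq_bigr => a _.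
  congr (_ * _); rewrite (_ : (n - a)%N = (n.-1 - a).+1) //.
  by have := ltn_ord a; lia.
(* The two parts of the bracket cancel with a shift in [a], so only the term a = 0 survives. *)
have e2 : \sum_(a < n.+1) (-1) ^+ a * fw M ^+ (2 * a.+1) * (ep (n - a)%N M + fw M ^+ 2 * epp (n - a)%N)
   = fw M ^+ 2 * ep n M.
  under eq_bigr do rewrite mulrDr.
  rewrite big_split /= big_ord_recl [X in _ + X]big_ord_recr /= subnn !mulr0 addr0 subn0.
  rewrite expr0 mul1r muln1 -addrA -big_split /= big1 ?addr0 // => a _.
  rewrite /bump /= add1n (_ : (n - a)%N = (n - a.+1).+1) /=; last by rewrite subnSK.
  by rewrite exprS (_ : (2 * a.+2)%N = (2 * a.+1 + 2)%N) ?exprD; [ring | lia].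
have -> : n.+1%:R * ep n.+1 M.+1 = n.+1%:R * ep n.+1 M + fw M ^+ 2 * (n%:R * ep n M)
    + fw M ^+ 2 * ep n M.
  by rewrite epS /= -natr1; ring.
rewrite -e1 -e2 IH /= mulr_sumr -!big_split /=; apply: eq_bigr => a _.
by rewrite epS /pw psumS; ring.
Qed.

Lemma ep_W i : W (ep i).
Proof.
elim: i => [|i IH]; first exact: W_one.
apply: class_eq (W_letter (u := G 2) isT IH) => M.
by apply: eq_psum => m; rewrite lwG.
Qed.

Lemma ep_S2 i : S2 (fun m => fw m ^+ 2 * ep i m).
Proof.
apply: (@class_eq _ _ (fun m => lw (G 2) m * ep i m)) => [m|]; first by rewrite lwG.
by apply: lspan_gen; left; split=> //; exact: ep_W.
Qed.

Lemma ep_cvg i : exists2 v : C, cvgC (ep i) v & Zval v.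
Proof.
case: i => [|i]; first by exists 1; [exact: cvgC_cst | rewrite -(ev1 q); exact: Zval_const].
have [v hv] := Sc_cvg q01 (S2_Sc (ep_S2 i)).
by exists v => //; exact: Zval_S2 (ep_S2 i) hv.
Qed.

Lemma pw_cvg a : cvgC (pw a.+1) (Zq q (word [:: G (2 * a.+1)])).
Proof.
have hS : S2 (fun m => lw (G (2 * a.+1)) m * 1).
  by apply: lspan_gen; left; split; [rewrite /=; lia | exact: W_one].
have [v hv] := Sc_cvg q01 (S2_Sc hS).
have e M : psum (fun m => lw (G (2 * a.+1)) m * 1) M = pw a.+1 M.
  by apply: eq_psum => m; rewrite mulr1 lwG.
have hv' := cvgC_eq e hv.
rewrite (@ZqE _ _ _ v) //; apply: cvgC_eq hv => M.
rewrite (_ : word _ = snoc (G (2 * a.+1)) [:: (1, [::])]) // ZqM_snoc; apply: eq_psum => m.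
by rewrite /ZqM big_seq1 ev1 mul1r.
Qed.

(** In Newton's identity each term contains a power sum, whose limit is some Z_q(g_(2a)); the
    division by [i.+1] is a rational scalar. *)
Lemma ep_P i v : cvgC (ep i.+1) v -> Pval v.
Proof.
move=> hv; pose ee j := projT1 (cid2 (ep_cvg j)).
have hee j : cvgC (ep j) (ee j) by rewrite /ee; case: (cid2 _).
have zee j : Zval (ee j) by rewrite /ee; case: (cid2 _).
have n0 : i.+1%:R != 0 :> C by rewrite pnatr_eq0.
have hr : (ev q (i.+1%:R^-1)%:P : C) = i.+1%:R^-1 by rewrite evC fmorphV rmorph_nat.
have -> : v = \sum_(a < i.+1) (ev q (i.+1%:R^-1)%:P * ev q ((-1) ^+ a) * ee (i - a)%N)
    * Zq q (word [:: G (2 * a.+1)]).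
  apply: cvgC_unique hv _.
  apply: (@cvgC_eq _ (fun M => \sum_(a < i.+1) (ev q (i.+1%:R^-1)%:P * ev q ((-1) ^+ a) * ep (i - a)%N M)
    * pw a.+1 M)); last first.
    apply: cvgC_sum => a; apply: cvgCM (pw_cvg a).
    by apply: cvgCM (hee _); exact: cvgC_cst.
  move=> M; have -> : ep i.+1 M = i.+1%:R^-1 * (i.+1%:R * ep i.+1 M).
    by rewrite mulrA mulVf // mul1r.
  rewrite ep_newton mulr_sumr /= hr; apply: eq_bigr => a _.
  have -> : ev q ((-1) ^+ a) = (-1) ^+ a :> C.
    by elim: (nat_of_ord a) => [|k IH]; rewrite ?expr0 ?ev1 // !exprS evM IH evN ev1.
  by rewrite -!mulrA; congr (_ * (_ * _)); rewrite mulrC.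
apply: (idl_sum (idl_P q)) => a; apply: P_gen => //.
apply: Zval_mul => //; apply: Zval_mul => //; exact: Zval_const.
Qed.

Inductive Ecl : (nat -> C) -> Prop :=
| E_gen i : Ecl (ep i)
| E_add f g : Ecl f -> Ecl g -> Ecl (fun M => f M + g M)
| E_scale p f : Ecl f -> Ecl (fun M => ev q p * f M).

Inductive Pcl : (nat -> C) -> Prop :=
| P_ep i : Pcl (ep i.+1)
| Pcl_add f g : Pcl f -> Pcl g -> Pcl (fun M => f M + g M)
| Pcl_scale p f : Pcl f -> Pcl (fun M => ev q p * f M).

Lemma modE : modclass q Ecl.
Proof. by split; [exact: E_add | exact: E_scale | exists (ep 0); exact: E_gen]. Qed.
Lemma modP : modclass q Pcl.
Proof. by split; [exact: Pcl_add | exact: Pcl_scale | exists (ep 1); exact: P_ep]. Qed.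

Lemma PclE f : Pcl f -> Ecl f.
Proof. by elim=> {f} [i|f g _ + _|p f _]; [exact: E_gen | exact: E_add | exact: E_scale]. Qed.

Lemma Ecl_psum f : Ecl f -> Pcl (psum (fun m => fw m ^+ 2 * f m)).
Proof.
elim=> {f} [i|f g _ h _ h'|p f _ h]; first exact: P_ep.
  apply: class_eq (Pcl_add h h') => M; rewrite -psumD; apply: eq_psum => m.
  by rewrite mulrDr.
apply: class_eq (Pcl_scale p h) => M; rewrite -psumZ; apply: eq_psum => m.
by rewrite mulrCA.
Qed.

Lemma Pcl_cvg f : Pcl f -> exists2 v : C, cvgC f v & Pval v.
Proof.
elim=> {f} [i|f g _ [v hv pv] _ [w hw pw]|p f _ [v hv pv]].
- by have [v hv _] := ep_cvg i.+1; exists v => //; exact: ep_P hv.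
- by exists (v + w); [exact: cvgCD | exact: P_add].
- exists (ev q p * v); first by apply: cvgCM hv; exact: cvgC_cst.
  by apply: Pval_mul => //; exact: Zval_const.
Qed.

Definition qq x M : K := rg 0 0 x M * rg 0 0 (- x) M.

Lemma qqE x M : qq x M = 1 + psum (fun m => kz * x * (kz * - x * (kC (fw m ^+ 2) * qq x m))) M.
Proof.
elim: M => [|M IH]; first by rewrite psum0 addr0 /qq mulr1.
rewrite psumS addrA -IH /qq !rg_Pi expr2 kCM -/(kf M).
by move: (kf M) (rg 0 0 x M) (rg 0 0 (- x) M) kz => f u v z; ring.
Qed.

(** Each turn of [qqE] applies [psum] to f^2 times the previous term, which sends [ep i] to
    [ep i.+1]; hence [ep 0] occurs only in the constant 1. *)
Lemma qq_Pcl x : rser x -> KL Pcl (fun M => qq x M - 1).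
Proof.
move=> hx; have hx' := rserN hx; have mE := modE; have mP := modP.
have step n : KLn n Ecl (qq x) -> KLn n.+1 Pcl (fun M => qq x M - 1).
  move=> h; apply: (@KLn_eq _ _ _ (fun M => kz * x * (kz * - x * psum (fun m => kC (fw m ^+ 2) * qq x m) M))).
    by move=> M; rewrite [in RHS]qqE addrC addKr !psumZ.
  have h1 : KLn n Pcl (psum (fun m => kC (fw m ^+ 2) * qq x m)).
    move=> d a dn; apply: class_eq (Ecl_psum (h d a dn)) => M; rewrite cf_psum.
    by apply: eq_psum => m; rewrite cf_kC.
  by move=> d a dn; apply: (KLn_raise mP hx (KLn_raise mP hx' h1)); exact: ltnW.
have hE : KL Ecl (qq x).
  apply: KL_ind => n /step h; apply: (@KLn_eq _ _ _ (fun M => 1 + (qq x M - 1))).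
    by move=> M; rewrite addrC subrK.
  apply: (KLn_add mE); last by apply: KLn_sub h; exact: PclE.
  exact: (KLn_const mE (E_gen 0) (rser1 q)).
by move=> d a; apply: (step d.+1) => //; exact: KL_KLn.
Qed.

Lemma qq_cvg x : rser x -> exists l, cvgK (qq x) l /\ KV Pval (l - 1).
Proof.
move=> hx; have h d a := Pcl_cvg (qq_Pcl hx d a).
have [l hl] : exists l, cvgK (fun M => qq x M - 1) l.
  by apply: cvgK_ex => d a; have [v hv _] := h d a; exists v.
exists (l + 1); split.
  by apply: cvgK_eq (cvgKD hl (cvgK_cst 1)) => M; rewrite subrK.
rewrite addrK => d a; have [v hv pv] := h d a.
by rewrite (cvgC_unique (hl d a) hv).
Qed.

Lemma Pval_Zval v : Pval v -> Zval v.
Proof.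
elim=> {v} [|b k hb k1|u v _ + _]; last exact: Zval_add.
  by rewrite -(ev0 q); exact: Zval_const.
apply: Zval_mul => //; case: k k1 => // a _.
apply: (Zval_S2 (phi := fun m => lw (G (2 * a.+1)) m * 1)).
  by apply: lspan_gen; left; split; [rewrite /=; lia | exact: W_one].
by apply: cvgC_eq (pw_cvg a) => M; apply: eq_psum => m; rewrite mulr1 lwG.
Qed.

Lemma KV1 : KV Zval 1.
Proof. exact: (rser_KV (rser1 q)). Qed.

Lemma KV_one_P s : KV Pval (s - 1) -> KV Zval s.
Proof.
move=> h; rewrite -(subrK 1 s); apply: KVD (idl_Z q) _ KV1.
by move=> d a; exact: Pval_Zval.
Qed.

(** As [s1] is 1 in degree 0 of z, the coefficients of [u] are found in Z_q by induction on the
    degree; only then does [u - 1 = (s2 - 1) - u * (s1 - 1)] give membership in the ideal. *)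
Lemma inv_P s1 s2 u : (forall a, cf 0 a s1 = cf 0 a 1) -> KV Pval (s1 - 1) -> KV Pval (s2 - 1) ->
  u * s1 = s2 -> KV Pval (u - 1).
Proof.
move=> s10 h1 h2 e.
have eu : u = s2 - u * (s1 - 1) by rewrite -e; ring.
have hZ n : forall d a, (d < n)%N -> Zval (cf d a u).
  elim: n => // n IH d a dn; rewrite eu cfB cfM.
  rewrite -[X in Zval (_ - X)]opprK opprK -[- _]mulN1r -(ev1 q) -evN.
  apply: Zval_add; first exact: KV_one_P.
  apply: Zval_mul; first exact: Zval_const.
  rewrite big_ord_recr /=; apply: Zval_add.
    apply: (idl_sum (idl_Z q)) => i; apply: (idl_sum (idl_Z q)) => b.
    apply: Zval_mul; last exact: Pval_Zval.
    by apply: IH; apply: leq_trans (ltn_ord i) _; rewrite -ltnS.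
  rewrite big1; first by rewrite -(ev0 q); exact: Zval_const.
  by move=> b _; rewrite subnn cfB s10 subrr mulr0.
have hu : KV Zval u by move=> d a; exact: (hZ d.+1).
have -> : u - 1 = (s2 - 1) - u * (s1 - 1) by rewrite {1}eu; ring.
by apply: (KVB (idl_P q)) => //; apply: (KVM (idl_P q)).
Qed.

(** The divisor is 1 in degree 0 of z, so each coefficient of [phi], and with it its limit, is
    computed from those of lower degree. *)
Lemma cvgK_div phi psi chi s1 s2 : (forall M, phi M * psi M = chi M) ->
  (forall M a, cf 0 a (psi M) = cf 0 a 1) -> cvgK psi s1 -> cvgK chi s2 ->
  exists u, [/\ cvgK phi u, u * s1 = s2 & forall a, cf 0 a s1 = cf 0 a 1].
Proof.
move=> e e0 h1 h2.
have ephi M : phi M = chi M - phi M * (psi M - 1) by rewrite -e; ring.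
have hZ n : forall d a, (d < n)%N -> exists v, cvgC (fun M => cf d a (phi M)) v.
  elim: n => // n IH d a dn.
  have hIH (ib : 'I_d * 'I_a.+1) : exists v, cvgC (fun M => cf ib.1 ib.2 (phi M)) v.
    by apply: IH; apply: leq_trans (ltn_ord ib.1) _; rewrite -ltnS.
  have [v hv] := choice hIH.
  exists (cf d a s2 + -1 * \sum_(i < d) \sum_(b < a.+1) v (i, b) * cf (d - i) (a - b) (s1 - 1)).
  apply: (@cvgC_eq _ (fun M => cf d a (chi M) +
     -1 * \sum_(i < d) \sum_(b < a.+1) cf i b (phi M) * cf (d - i) (a - b) (psi M - 1))).
    move=> M; rewrite [in RHS]ephi cfB cfM mulN1r big_ord_recr /= [X in _ = _ - (_ + X)]big1 ?addr0 //.
    by move=> b _; rewrite subnn cfB e0 subrr mulr0.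
  apply: cvgCD (h2 d a) _; apply: cvgCM (cvgC_cst _) _.
  apply: cvgC_sum => i; apply: cvgC_sum => b; apply: cvgCM (hv (i, b)) _.
  exact: (cvgKD h1 (cvgKN (cvgK_cst 1))).
have [u hu] : exists u, cvgK phi u by apply: cvgK_ex => d a; exact: (hZ d.+1).
exists u; split=> //.
  by apply: cvgK_unique h2; apply: cvgK_eq (cvgKM hu h1).
by move=> a; apply: (cvgC_unique (h1 0%N a)); apply: cvgC_eq (cvgC_cst _) => M; rewrite e0.
Qed.

Lemma qq_cf0 x M a : cf 0 a (qq x M) = cf 0 a 1.
Proof.
rewrite qqE cfD cf_psum [X in _ + X]big1 ?addr0 // => m _.
by rewrite -mulrA cf_kz.
Qed.

Section Products.
Variables x r0 : K.
Hypotheses (hx : rser x) (hr : rser r0).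

Definition vu y L := psum (res kf (kz * y.2) (ust kf kf (kz * y.1) L)).
Definition ve y L := psum (res (yw q y.1 fw) (kz * y.2) (est kf (yw q y.1 fw) L)).

Lemma vuE y z L M : vu (y, z) L M = rg 0 0 z M * psum (bu q y z L) M.
Proof.
apply: psum_res_rg => // m; first exact: rg_Pi.
by rewrite rg_inv.
Qed.

(** With T = [kz * y] and R = [kz * z], the factor of [psum_res_rg] is 1 + R f / (1 - T f) = (1 + (R
    - T) f) / (1 - T f). *)
Lemma veE y z L M : ve (y, z) L M = rg (- y) 0 (z - y) M * psum (be q y z L) M.
Proof.
rewrite /ve -[(y, z).2]/z -[(y, z).1]/y.
apply: psum_res_rg => // m; last by rewrite rg_inv.
have := rgS_eq q (- y) 0 (z - y) m; rewrite mul0r addr0 /yw -/(kf m).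
have : fps_geom (y * kf m) * (1 - kz * (y * kf m)) = 1 := fps_geomE (y * kf m).
move: (rg _ _ _ m.+1) (rg _ _ _ m) (kf m) (fps_geom _) kz => u v f g t e1 e2.
have -> : u = u * (1 + t * (- y * f)) * g by rewrite -mulrA -[LHS]mulr1 -{1}e1; ring.
rewrite e2 -[v * _ * g]mulrA; congr (_ * _).
rewrite -[in RHS]e1; ring.
Qed.

Lemma rg_one y z : rg y 0 z 1 = 1.
Proof.
have := rgS_eq q y 0 z 0.
by rewrite (kf0 q) !mulr0 mul0r !addr0 mulr0 addr0 !mulr1.
Qed.

Lemma psum_first phi M : phi 0%N = 1 -> (forall m, phi m.+1 = 0) -> (0 < M)%N -> psum phi M = 1.
Proof.
move=> e0 e; rewrite /psum; case: M => // M _.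
by rewrite big_ord_recl /= e0 big1 ?addr0.
Qed.
End Products.

Section Limit.
Variables x r0 : K.
Hypotheses (hx : rser x) (hr : rser r0).

Lemma be_bu_cvg L : tame L -> exists bl el, [/\ cvgK (psum (bu q x r0 L)) bl,
  cvgK (psum (be q x r0 L)) el, KV Zval bl, KV Zval el & KV N2val (bl - el)].
Proof.
case: L => [_|a L hL].
  exists 1, 1; rewrite subrr; split; try exact: KV1; last first.
  - by move=> d a; exact: N2val0.
  - apply: (cvgK_eq1 _ (cvgK_cst 1)) => M M0; rewrite psum_first // => [|m].
      by rewrite /be rg_one mulr1.
    by rewrite /be mul0r.
  - apply: (cvgK_eq1 _ (cvgK_cst 1)) => M M0; rewrite psum_first // => [|m].
      by rewrite /bu rg_one mulr1.
    by rewrite /bu mul0r.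
have hb := bu_S2 hx hr a L; have he := be_S2 hx hr a L.
have [bl cb] := Sc_cvgK q01 (KL_sub (@S2_Sc _ q) hb).
have [el ce] := Sc_cvgK q01 (KL_sub (@S2_Sc _ q) he).
exists bl, el; split=> //; first exact: S2_KV hb cb.
  exact: S2_KV he ce.
exact: key_values cb ce.
Qed.

End Limit.

(* The regularising factors of [vu] multiply to [qq r0], those of [ve] to [qq (r0 - x) / qq x];
   both limits are congruent to 1 modulo the even zeta values. *)
Theorem mid_values x r0 P N : rser x -> rser r0 -> tame P -> tame N ->
  exists cu ce, [/\ cvgK (fun M => vu (x, r0) P M * vu (- x, - r0) N M) cu,
    cvgK (fun M => ve (x, r0) P M * ve (- x, - r0) N M) ce & KV Mval (cu - ce)].
Proof.
move=> hx hr hP hN.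
have [bl [el [cb ce zb ze nbe]]] := be_bu_cvg hx hr hP.
have [bl' [el' [cb' ce' zb' ze' nbe']]] := be_bu_cvg (rserN hx) (rserN hr) hN.
have [s [hs ps]] := qq_cvg hr.
have [s1 [hs1 ps1]] := qq_cvg hx.
have [s2 [hs2 ps2]] := qq_cvg (rserD hr (rserN hx)).
have [M|u [hu us1 s10]] := cvgK_div (phi := fun M => rg (- x) 0 (r0 - x) M * rg x 0 (x - r0) M) _ (qq_cf0 x) hs1 hs2.
  rewrite /qq -(rg_cancel q (- x) (r0 - x)) opprB -(rg_cancel q x (x - r0)).
  by ring.
have pu := inv_P s10 ps1 ps2 us1.
exists (s * (bl * bl')), (u * (el * el')); split.
- apply: cvgK_eq (cvgKM hs (cvgKM cb cb')) => M; by rewrite !vuE mulrACA.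
- apply: cvgK_eq (cvgKM hu (cvgKM ce ce')) => M; by rewrite !veE !opprK [- r0 + x]addrC mulrACA.
(* This separates the error of the infinite products, in [Pval], from that of the regularised sums,
   in [N2val]. *)
have -> : s * (bl * bl') - u * (el * el') =
   bl * bl' * (s - 1) - el * el' * (u - 1) + (bl' * (bl - el) + el * (bl' - el')) by ring.
have iN := idl_N2 q; have iP := idl_P q; have iZ := idl_Z q; have iM := idl_M q.
apply: (KVD iM).
  move=> d a; apply: P_M; move: d a; apply: (KVB iP).
    exact: (KVM iP (KVM iZ zb zb') ps).
  exact: (KVM iP (KVM iZ ze ze') pu).
by move=> d a; apply: N2_M; move: d a; exact: (KVD iN (KVM iN zb' nbe) (KVM iN ze nbe')).
Qed.
End EvenZeta.
(** * Convolution products of summands *)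

Section Anti.
Variables (R : realType) (q : R[i]).
Local Notation C := R[i].
Local Notation K := (ser C).
Hypothesis q01 : 0 < `|q| < 1.
Implicit Types (phi psi : nat -> K) (d a n : nat) (f g : nat -> C) (l : K).
Notation fw := (fw q).
Notation lw := (lw q).
Notation W := (W q).
Notation I := (I q).
Notation J := (J q).
Notation D := (D q).
Notation Sn := (lspan q (genSn q)).
Notation S2 := (lspan q (genS2 q)).
Notation Sc := (lspan q (genSc q)).
Notation N2 := (lspan q (genN2 q)).
Notation Nl := (lspan q (genNl q)).
Notation rser := (rser q).
Notation kz := (kz R).
Notation kf := (kf q).
Notation kb := (kb q).
Notation rg := (rg q).
Notation Nval := (Nval q).
Notation N2val := (N2val q).
Notation NPval := (NPval q).
Local Notation hb := (kC (1 - q) : K).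

(** The product runs over pairs with both indices below [M], the convolution over pairs with sum
    below [M]; the pairs left over are (m, M - i - 1) with i < m. *)
Lemma conv_psum (A : comNzRingType) (phi psi : fps A) M :
  psum phi M * psum psi M - psum (phi * psi : fps A) M =
  \sum_(m < M) \sum_(i < m) phi m * 1 * psi (M - i.+1)%N.
Proof.
rewrite (congr1 (fun y : fps A => y M) (psum_fpsMr phi psi)) fpsM.
rewrite big_ord_recr /= subnn psum0 mulr0 addr0 {1}/psum mulr_suml -sumrB.
apply: eq_bigr => m _; rewrite -mulrBr -mulr_sumr mulr1; congr (_ * _).
elim: (nat_of_ord m) (ltnW (ltn_ord m)) => [|k IH] kM; first by rewrite subn0 subrr big_ord0.
rewrite big_ord_recr /= -IH; last exact: ltnW.
by rewrite (_ : (M - k)%N = (M - k.+1).+1) ?psumS; [ring | lia].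
Qed.

Lemma cf_conv d a (phi psi : nat -> K) t : cf d a (((phi : fps K) * psi) t) =
  \sum_(i < d.+1) \sum_(b < a.+1)
    (((fun m => cf i b (phi m)) : fps C) * (fun m => cf (d - i) (a - b) (psi m))) t.
Proof.
rewrite fpsM cf_sum; under eq_bigr do rewrite cfM.
rewrite exchange_big /=; apply: eq_bigr => i _.
by rewrite exchange_big /=.
Qed.

Lemma KL_conv phi psi : KL D phi -> KL D psi -> KL D ((phi : fps K) * psi).
Proof.
move=> h h' d a; apply: (@class_eq _ _ (fun t => \sum_(i < d.+1) \sum_(b < a.+1)
    (((fun m => cf i b (phi m)) : fps C) * (fun m => cf (d - i) (a - b) (psi m))) t)).
  by move=> t; rewrite cf_conv.
apply: (@mod_sum _ q) => [|i _]; first exact: modD.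
apply: (@mod_sum _ q) => [|b _]; first exact: modD.
exact: (D_conv q01 (h _ _) (h' _ _)).
Qed.

(** Mertens' theorem: for geometrically decaying summands the pairs left over in [conv_psum] are
    negligible by [rate_tri]. *)
Lemma mertens phi psi l : KL (rate (normc q)) phi -> KL (rate (normc q)) psi ->
  cvgK (fun M => psum phi M * psum psi M) l -> cvgK (psum ((phi : fps K) * psi)) l.
Proof.
move=> h h' c d a; have r01 := rho01 q01.
have hr : rate (normc q) (fun M => cf d a (psum phi M * psum psi M - psum ((phi : fps K) * psi) M)).
  apply: (@class_eq R (rate (normc q)) (fun M => \sum_(i < d.+1) \sum_(b < a.+1)
    (\sum_(m < M) \sum_(j < m) cf i b (phi m) * 1 * cf (d - i) (a - b) (psi (M - j.+1)%N)))).
    move=> M; rewrite cfB cfM cf_psum.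
    have -> : psum (fun m => cf d a (((phi : fps K) * psi) m)) M = \sum_(i < d.+1) \sum_(b < a.+1)
        psum (((fun m => cf i b (phi m)) : fps C) * (fun m => cf (d - i) (a - b) (psi m))) M.
      under eq_psum do rewrite cf_conv.
      by rewrite /psum exchange_big; apply: eq_bigr => i _; rewrite exchange_big.
    rewrite -sumrB; apply: eq_bigr => i _; rewrite -sumrB; apply: eq_bigr => b _.
    rewrite !cf_psum; apply/esym.
    exact: (conv_psum (fun m => cf i b (phi m)) (fun m => cf (d - i) (a - b) (psi m)) M).
  have mr := mod_rate q (rho_ge0 q01).
  apply: (@mod_sum _ q) => // i _; apply: (@mod_sum _ q) => // b _.
  exact: (rate_tri r01 (h i b) (@rate1 R) (h' (d - i)%N (a - b)%N)).
have := cvgCD (c d a) (cvgCM (cvgC_cst (-1)) (rate_cvg0 r01 hr)).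
by rewrite mulr0 addr0; apply: cvgC_eq => M; rewrite cfB; ring.
Qed.

(* With [Phi, Psi, Xi] the partial sums of [mu, c0, c], [X = hbar * psum Psi] and
   [Z = hbar * (Phi * psum Psi - psum Xi)], the summands of [Phi * Psi - Xi] are
   [mu * (Psi - 1)] and [- r * f * Z]: each power of [r] is preceded by an element of [J]. *)
Section Theta.
Variables (r : K) (mu c c0 : nat -> K).
Hypotheses (hr : rser r) (hmu : KL S2 mu).
Hypothesis cE : forall m, c m = mu m - kz * r * (kf m * (hb * psum (psum c) m)).
Hypothesis c0E : forall m, c0 m = (m == 0%N)%:R - kz * r * (kf m * (hb * psum (psum c0) m)).

Let X m := hb * psum (psum c0) m.
Let G := psum (fun m => kf m * X m).
Let Z m := hb * (psum mu m * psum (psum c0) m - psum (psum c) m).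
Let Q m := psum mu m * psum c0 m - psum c m.

Lemma psum_c0 M : (0 < M)%N -> psum c0 M = 1 - kz * r * G M.
Proof.
case: M => // M _; elim: M => [|M IH].
  by rewrite !psumS !psum0 c0E /G /X !psumS !psum0 (kf0 q) /=; ring.
by rewrite psumS IH c0E /G [in RHS]psumS /=; rewrite /X; ring.
Qed.

Let dQ m := - (kz * r * (mu m * (G m + kf m * X m))) - kz * r * (kf m * Z m).

Lemma QE : Q =1 psum dQ.
Proof.
elim=> [|m IH]; first by rewrite /Q !psum0 mulr0 subrr.
rewrite psumS -IH /Q.
have e : psum c0 m + c0 m = 1 - kz * r * (G m + kf m * X m).
  by rewrite -psumS psum_c0 // /G psumS.
have e2 : psum mu m * c0 m = - (kz * r * (kf m * (psum mu m * X m))).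
  case: (m) => [|k]; first by rewrite psum0 (kf0 q) !mul0r mulr0 oppr0.
  by rewrite c0E /= /X; move: (kf k.+1) => f; ring.
rewrite !psumS.
have -> : (psum mu m + mu m) * (psum c0 m + c0 m) =
  psum mu m * psum c0 m + psum mu m * c0 m + mu m * (psum c0 m + c0 m) by ring.
rewrite e2 e cE /dQ /Z /X.
move: (kf m) (G m) (psum mu m) (psum (psum c0) m) (psum (psum c) m) (psum c0 m) (psum c m) (mu m) hb kz.
by move=> f g u v w u' w' m' h k; ring.
Qed.

Lemma ZE : Z =1 psum (fun m => hb * Q m + mu m * (X m + hb * psum c0 m)).
Proof.
elim=> [|m IH]; first by rewrite /Z !psum0; ring.
rewrite psumS -IH /Z /Q /X !psumS.
move: (psum mu m) (psum (psum c0) m) (psum (psum c) m) (psum c0 m) (psum c m) (mu m) hb.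
by move=> u v w u' w' m' h; ring.
Qed.

Lemma fw_I f : I f -> Sn (fun m => fw m * f m).
Proof.
move=> hf; apply: (@class_eq R Sn (fun m => lw (Defs.G 1) m * f m)) => [m|]; first by rewrite lwG1.
by apply: lspan_gen; left.
Qed.

Lemma hb_psum phi M : phi 0%N = 0 -> psum (fun m => hb * phi m) M = psum (fun m => kb m * phi m) M.
Proof. by move=> e; apply: eq_psum => -[|m]; rewrite ?e ?mulr0. Qed.

Lemma KLn_X n : KLn n W (psum c0) -> KLn n I X.
Proof.
move=> h; apply: (@KLn_eq _ _ _ (psum (fun m => kb m * psum c0 m))).
  by move=> M; rewrite -hb_psum ?psum0 // psumZ.
move=> d a dn; apply: class_eq (I_Hb (h d a dn)) => M; rewrite cf_psum.
by apply: eq_psum => m; rewrite cf_kC.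
Qed.

Lemma KLn_G n : KLn n I X -> KLn n I G.
Proof.
move=> h; apply: (KLn_psum (@Sn_psum _ q)); apply: (KLn_kC _ h) => f; exact: fw_I.
Qed.

Lemma c0_W : KL W (psum c0).
Proof.
apply: KL_ind => n /KLn_X/KLn_G h.
have h2 : KLn n.+1 W (fun M => 1 - kz * r * G M).
  apply: (KLn_Sub (modW q)); first exact: (KLn_const (modW q) (W_one q) (rser1 q)).
  by apply: (KLn_raise (modW q) hr); apply: KLn_sub h => f; exact: IW.
by move=> d a dn; apply: W_eq (h2 d a dn) => M M0; rewrite psum_c0.
Qed.

Lemma dQ_Nl n : KLn n J Z -> KLn n.+1 Nl dQ.
Proof.
move=> h; have mN := modlspan q (genNl q).
have hX : KL I X by apply/KLnP => k; apply: KLn_X; exact: KL_KLn c0_W.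
have hG : KL I G by apply/KLnP => k; apply: KLn_G; exact: KL_KLn hX.
apply: (KLn_Sub mN); last first.
  by apply: (KLn_raise mN hr); apply: (KLn_kC _ h) => f; exact: fw_J.
apply: (KLn_opp mN); apply: (KLn_raise mN hr).
apply: (KLn_sub (@N2_Nl _ q)); have m2 := modlspan q (genN2 q).
apply: (@KLn_eq _ _ _ (fun m => mu m * G m + kf m * (mu m * X m))).
  by move=> m; move: (kf m) => f; ring.
apply: (KLn_add m2).
  exact: (KLn_mul m2 (@S2I _ q) (KL_KLn hmu) (KL_KLn hG)).
apply: (KLn_kC (stable_fw (stable_N2 q))).
exact: (KLn_mul m2 (@S2I _ q) (KL_KLn hmu) (KL_KLn hX)).
Qed.

(** [Z] and [dQ] feed each other: [Z] below degree [n] gives [dQ], hence [Q], below [n.+1] thanks to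
    the factor z, and a letter [Hb] applied to [Q] gives back [Z]. *)
Lemma Z_J : KL J Z.
Proof.
apply: KL_ind => n /dQ_Nl h; have mJ := modJ q; have mI := modI q.
have hQ : KLn n.+1 J Q.
  by apply: (@KLn_eq _ _ _ (psum dQ)) => [M|]; [rewrite QE | exact: (KLn_psum (@Nl_psum _ q) h)].
have hX : KL I X by apply/KLnP => k; apply: KLn_X; exact: KL_KLn c0_W.
apply: (@KLn_eq _ _ _ (fun M => psum (fun m => kb m * Q m) M +
   psum (fun m => mu m * (X m + hb * psum c0 m)) M)).
  by move=> M; rewrite ZE psumD -hb_psum // /Q !psum0 mulr0 subrr.
apply: (KLn_add mJ).
  move=> d a dn; apply: class_eq (J_letter (u := Hb) isT (hQ d a dn)) => M; rewrite cf_psum.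
  by apply: eq_psum => m; rewrite cf_kC.
apply: (KLn_psum (@Nl_psum _ q)); apply: (KLn_sub (@N2_Nl _ q)).
apply: (KLn_mul (modlspan q (genN2 q)) (@S2I _ q) (KL_KLn hmu)).
apply: (KLn_add mI); first exact: KL_KLn hX.
apply: KLn_kC (KL_KLn c0_W) => f hf; exact: I_hbar.
Qed.

(** The recursions of [c] and [c0] differ only in their inhomogeneous terms [mu] and [dirac]. So,
    modulo N_q, passing from [dirac] to [mu] multiplies the total by that of [mu]. *)
Lemma theta : exists2 phi, KL Nl phi &
  forall M, psum mu M * psum c0 M - psum c M = psum phi M.
Proof.
exists dQ => [|M]; last exact: QE.
by apply/KLnP => -[|n]; [move=> d a | apply: dQ_Nl; exact: KL_KLn Z_J].
Qed.

End Theta.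

(* The recursion [Q m = f m * (a + t * psum Q)] is stable under convolution: the terms
   linear in [t] are integrated by [psum_fpsM] and only [h * t^2] remains. *)
Lemma conv_rec (A : comNzRingType) (f : nat -> A) (h t : A) (b b' : bool) (e e' u u' : fps A) :
  (forall i j, (0 < i)%N -> (0 < j)%N -> f i * f j = f (i + j)%N * (f i + f j + h)) ->
  u 0%N = 0 -> u' 0%N = 0 ->
  e = b%:R + pmul f (u + fpsC t * (psum e : fps A)) ->
  e' = b'%:R + pmul f (u' + fpsC (- t) * (psum e' : fps A)) ->
  e * e' = (b && b')%:R + pmul f (u * e' + e * u'
    + fpsC h * (u * u' + fpsC t * (psum (e * u' - u * e' : fps A) : fps A)))
    - pmul f (fpsC (h * t * t) * (psum (psum (e * e' : fps A)) : fps A)).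
Proof.
move=> hf u0 u0' ee ee'.
set a := u + _ in ee; set a' := u' + _ in ee'.
have a0 : a 0%N = 0 by rewrite /a fpsD fpsCM u0 psum0 mulr0 addr0.
have a0' : a' 0%N = 0 by rewrite /a' fpsD fpsCM u0' psum0 mulr0 addr0.
have pD (x y : fps A) : pmul f (x + y) = pmul f x + pmul f y.
  by apply: funext => n; rewrite /pmul !fpsD mulrDr.
have pN (x : fps A) : pmul f (- x) = - pmul f x.
  by apply: funext => n; rewrite /pmul !fpsN mulrN.
have pb (c : bool) (x : fps A) : pmul f (c%:R * x) = c%:R * pmul f x.
  case: c; rewrite ?mul1r // !mul0r; apply: funext => n.
  by rewrite /pmul fps0E mulr0.
have c1 : e * e' = (b && b')%:R + pmul f (a * e' + e * a' + fpsC h * (a * a')).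
  have := pmul_conv hf a0 a0'.
  have -> : pmul f a = e - b%:R by rewrite ee addrC addKr.
  have -> : pmul f a' = e' - b'%:R by rewrite ee' addrC addKr.
  have -> : a * (e' - b'%:R) + (e - b%:R) * a' + fpsC h * (a * a') =
    (a * e' + e * a' + fpsC h * (a * a')) - b'%:R * a - b%:R * a' by ring.
  rewrite !pD !pN !pb.
  have ea : pmul f a = e - b%:R by rewrite ee addrC addKr.
  have ea' : pmul f a' = e' - b'%:R by rewrite ee' addrC addKr.
  rewrite ea ea'; move: (pmul f _) (pmul f _) (pmul f _) => X1 X2 X3 E.
  have -> : e * e' = (e - b%:R) * (e' - b'%:R) + b%:R * e' + b'%:R * e - b%:R * b'%:R by ring.
  by rewrite E; clear; case: b; case: b' => /=; ring.
pose g : fps A := psum (1 : fps A).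
have psumE (x : fps A) : (psum x : fps A) = g * x by rewrite /g -psum_fpsM mul1r.
rewrite {1}c1 -[RHS]addrA -pN -pD; congr (_ + pmul f _).
have eN : (fpsC (- t) : fps A) = - (fpsC t : fps A) by exact: rmorphN.
have eM (y z : A) : (fpsC (y * z) : fps A) = (fpsC y : fps A) * (fpsC z : fps A) by exact: rmorphM.
rewrite /a /a' !psumE !eM eN.
by match goal with |- @eq _ ?l ?r => change (l = r :> fps A) end; ring.
Qed.

(* The generating series of a word read up to the letter [x] that ends its first run. *)
Definition um y (L : seq nat) : nat -> K :=
  if L is a :: L' then run kf a (res kf (kz * y) (ust kf kf (kz * y) L')) else fun _ => 0.
Definition ee y z L : nat -> K := res kf (kz * z) (ust kf kf (kz * y) L).

Lemma rser_kz : rser kz.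
Proof.
move=> d a; rewrite -[kz]mulr1 cf_kz; case: d => [|d]; last exact: rser1.
by exists 0; rewrite ev0.
Qed.

Lemma um0 y L : tame L -> um y L 0%N = 0.
Proof. by case: L => // a L hL; apply: run_res0 => //; exact: kf0. Qed.

Lemma um_D y L : rser y -> tame L -> KL D (um y L).
Proof.
move=> hy; case: L => [_|a L hL]; first by move=> d a; exact: (mod_zero (modD q)).
by apply: D_run => //; apply: ust_D => //; case/tame_behead: hL.
Qed.

Lemma ee_D y z L : rser y -> rser z -> tame L -> KL D (ee y z L).
Proof.
move=> hy hz hL; apply: KL_res => //; [exact: modD | by move=> f; exact: D_psum | exact: ust_D].
Qed.

Lemma eeE y z L : ee y z L = ((L == [::])%:R : fps K) +
  pmul kf ((um y L : fps K) + fpsC (kz * z) * (psum (ee y z L) : fps K)).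
Proof.
apply: funext => m; rewrite fpsD /pmul fpsD fpsCM {1}/ee resE -/(ee y z L) mulrDr addrA.
congr (_ + _); last by rewrite mulrCA mulrA.
case: L => [|a L] /=; last by apply/esym; exact: add0r.
by rewrite mulr0 addr0.
Qed.

Lemma KL_fD phi : KL D phi -> KL S2 (fun m => kf m * phi m).
Proof. by apply: KL_kC => f /D_St0; exact: fw_St0. Qed.
Lemma KL_fW phi : KL W phi -> KL Sc (fun m => kf m * phi m).
Proof. by apply: KL_kC => f; exact: fw_W. Qed.

Lemma D_W phi : KL D phi -> KL W (psum phi).
Proof. by move=> h d a; apply: class_eq (St0_psum (D_St0 (h d a))) => M; rewrite cf_psum. Qed.

Lemma ee_rate y z L : rser y -> rser z -> tame L -> KL (rate (normc q)) (ee y z L).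
Proof.
move=> hy hz hL; have r0 := rho_ge0 q01; have mr := mod_rate q r0; have mS := modlspan q (genSc q).
have h1 : KL Sc (fun m => kf m * (um y L m + kz * z * psum (ee y z L) m)).
  apply/KLnP => n; apply: (@KLn_eq _ _ _ (fun m => kf m * um y L m + kz * z * (kf m * psum (ee y z L) m))).
    by move=> m; move: (kf m) => f; ring.
  apply: (KLn_add mS); first by apply: KL_KLn; apply: KL_sub (KL_fD (um_D hy hL)) => f; exact: S2_Sc.
  apply: (KLn_rser mS (rserM rser_kz hz)).
  by apply: KL_KLn; apply: KL_fW; apply: D_W; exact: ee_D.
have h2 : KL (rate (normc q)) (fun m => ((L == [::])%:R : fps K) m).
  case: (L == [::]); last by move=> d a; apply: class_eq (mod_zero mr).
  apply: (KL_dirac mr) => s s1; exists 1 => -[|n]; first by rewrite /dirac eqxx normc1 mul1r expr0.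
  rewrite (_ : dirac R n.+1 = 0) // normc0 mul1r.
  by apply: exprn_ge0; rewrite mulr_ge0 //; lra.
rewrite eeE; apply/KLnP => n; apply: (KLn_add mr); first exact: KL_KLn.
apply: KL_KLn; apply: KL_sub (@Sc_rate _ _ q01) _; apply: KL_eq h1 => m.
by rewrite /pmul fpsD fpsCM.
Qed.

(** By [mertens] the product of the halves is the total of the convolution [c], whose recursion is
    [conv_rec]. By [theta] it is the total of [mu] times that of [c0], which is congruent to 1
    modulo P; and [mu] differs from [fw] times [lam] by a multiple of hbar. *)
Theorem anti_values x r0 P N cu : rser x -> rser r0 -> tame P -> tame N -> ~~ ((P == [::]) && (N == [::])) ->
  cvgK (fun M => vu q (x, r0) P M * vu q (- x, - r0) N M) cu ->
  exists2 v, KV NPval (cu - v) & cvgK (psum (pmul kf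
    ((um x P : fps K) * ee (- x) (- r0) N + (ee x r0 P : fps K) * um (- x) N))) v.
Proof.
move=> hx hr hP hN hne hcu.
have hx' := rserN hx; have hr' := rserN hr; have hz := rser_kz.
pose e : fps K := ee x r0 P; pose e' : fps K := ee (- x) (- r0) N.
pose u : fps K := um x P; pose u' : fps K := um (- x) N.
have hf i j : (0 < i)%N -> (0 < j)%N -> kf i * kf j = kf (i + j) * (kf i + kf j + hb).
  by move=> i0 j0; rewrite /kf -!kCD -!kCM fwM.
have E z z' L L' : tame L -> tame L' -> rser z' -> rser z ->
  (ee z z' L : fps K) * ee (- z) (- z') L' = ((L == [::]) && (L' == [::]))%:R + pmul kf
   ((um z L : fps K) * ee (- z) (- z') L' + (ee z z' L : fps K) * um (- z) L' + fpsC hb * ((um z L : fps K) * um (- z) L' +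
     fpsC (kz * z') * (psum ((ee z z' L : fps K) * um (- z) L' - (um z L : fps K) * ee (- z) (- z') L' : fps K) : fps K)))
    - pmul kf (fpsC (hb * (kz * z') * (kz * z')) * (psum (psum ((ee z z' L : fps K) * ee (- z) (- z') L' : fps K)) : fps K)).
  move=> hL hL' _ _; apply: conv_rec => //; try exact: um0; first exact: eeE.
  by rewrite {1}eeE mulrN.
have hE := E x r0 P N hP hN hr hx; rewrite (negbTE hne) add0r -/e -/e' -/u -/u' in hE.
pose lam : fps K := u * e' + e * u'.
pose nu : fps K := u * u' + fpsC (kz * r0) * (psum (e * u' - u * e' : fps K) : fps K).
pose mu : fps K := pmul kf (lam + fpsC hb * nu).
pose c : fps K := e * e'; pose c0 : fps K := (ee x r0 [::] : fps K) * ee (- x) (- r0) [::].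
have tail m (phi : fps K) : pmul kf (fpsC (hb * (kz * r0) * (kz * r0)) * (psum (psum phi) : fps K)) m =
    kz * (r0 * (kz * r0)) * (kf m * (hb * psum (psum phi) m)).
  by rewrite /pmul fpsCM; move: (kf m) hb kz => f h z; ring.
have cE m : c m = mu m - kz * (r0 * (kz * r0)) * (kf m * (hb * psum (psum c) m)).
  by rewrite -tail /c {1}hE.
have c0E m : c0 m = (m == 0%N)%:R - kz * (r0 * (kz * r0)) * (kf m * (hb * psum (psum c0) m)).
  have hE0 := E x r0 [::] [::] isT isT hr hx.
  rewrite -tail /c0 {1}hE0 fpsB fpsD; congr (_ - _).
  rewrite -[RHS]addr0; congr (_ + _); rewrite /pmul.
  have -> : (um x [::] : fps K) = 0 by [].
  have -> : (um (- x) [::] : fps K) = 0 by [].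
  rewrite !mul0r !mulr0 subrr !add0r.
  have -> : (psum (0 : fps K) : fps K) = 0 by apply: funext => M; rewrite /psum big1.
  by rewrite !mulr0.
have De : KL D e by exact: ee_D.
have De' : KL D e' by exact: ee_D.
have Du : KL D u by exact: um_D.
have Du' : KL D u' by exact: um_D.
have mD := modD q; have mS := modlspan q (genSc q); have m2 := modlspan q (genS2 q).
have mN := modlspan q (genN2 q).
have KD phi psi : KL D phi -> KL D psi -> KL D (fun m => phi m + psi m).
  by move=> h h' d a; exact: (mod_add mD (h d a) (h' d a)).
have KB phi psi : KL D phi -> KL D psi -> KL D (fun m => phi m - psi m).
  by move=> h h' d a; exact: (mod_sub mD (h d a) (h' d a)).
have Dlam : KL D lam by exact: (KD _ _ (KL_conv Du De') (KL_conv De Du')).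
have Sfl : KL S2 (fun m => kf m * lam m) by exact: KL_fD.
have Sfn : KL Sc (fun m => kf m * nu m).
  apply/KLnP => n.
  apply: (@KLn_eq _ _ _ (fun m => kf m * (u * u') m + kz * r0 * (kf m * psum (e * u' - u * e' : fps K) m))).
    by move=> m; rewrite /nu fpsD fpsCM; move: (kf m) => f; ring.
  apply: (KLn_add mS); first by apply: KL_KLn; apply: KL_sub (KL_fD (KL_conv Du Du')) => f; exact: S2_Sc.
  apply: (KLn_rser mS (rserM hz hr)); apply: KL_KLn; apply: KL_fW; apply: D_W.
  exact: (KB _ _ (KL_conv De Du') (KL_conv Du De')).
have N2n : KL N2 (fun m => hb * (kf m * nu m)).
  by move=> d a; apply: class_eq (Sc_hbar (Sfn d a)) => m; rewrite cf_kC.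
have muE m : mu m = kf m * lam m + hb * (kf m * nu m).
  by rewrite /mu /pmul fpsD fpsCM mulrDr mulrCA.
have Smu : KL S2 mu.
  apply: (KL_eq (phi := fun m => kf m * lam m + hb * (kf m * nu m))) => [m|]; first by rewrite muE.
  by move=> d a; apply: (mod_add m2 (Sfl d a)); apply: N2_S2; exact: N2n.
have [lm hlm] := Sc_cvgK q01 (KL_sub (@S2_Sc _ q) Smu).
have [ll hll] := Sc_cvgK q01 (KL_sub (@S2_Sc _ q) Sfl).
have [s [hs ps]] := qq_cvg q01 hr.
exists ll => //.
have hc : cvgK (psum c) cu by apply: (mertens (ee_rate hx hr hP) (ee_rate hx' hr' hN)).
(* With both words empty the product of the halves is exactly [qq r0]. *)
have hc0 : cvgK (psum c0) s.
  have b1 y z M : (0 < M)%N -> vu q (y, z) [::] M = rg 0 0 z M.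
    move=> M0; rewrite vuE psum_first ?mulr1 // => [|m].
      by rewrite /bu rg_one mulr1.
    by rewrite /bu mul0r.
  have hs' : cvgK (fun M => vu q (x, r0) [::] M * vu q (- x, - r0) [::] M) s.
    apply: cvgK_eq1 hs => M M0.
    rewrite (b1 _ _ _ M0).
    rewrite (b1 _ _ _ M0).
    reflexivity.
  by apply: (mertens (ee_rate hx hr (isT : tame [::])) (ee_rate hx' hr' (isT : tame [::]))).
have [phi Nphi ephi] := theta (rserM hr (rserM hz hr)) Smu cE c0E.
have N1 : KV Nval (lm * s - cu).
  move=> d a; exists (fun m => cf d a (phi m)); first exact: Nphi.
  apply: cvgC_eq ((cvgKD (cvgKM hlm hc0) (cvgKN hc)) d a) => M.
  by rewrite -cf_psum -ephi.
have N3 : KV N2val (lm - ll).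
  move=> d a; exists (fun m => cf d a (hb * (kf m * nu m))); first exact: N2n.
  apply: cvgC_eq ((cvgKD hlm (cvgKN hll)) d a) => M.
  rewrite -cf_psum; congr cf; rewrite /psum -sumrB; apply: eq_bigr => m _.
  by rewrite muE addrC addKr.
have zs := KV_one_P q01 ps.
have zl := S2_KV Sfl hll.
have M1 := KVM (idl_N2 q) zs N3; have M2 := KVM (idl_P q) zl ps.
move=> d a.
have -> : cu - ll = - (lm * s - cu) + (s * (lm - ll) + ll * (s - 1)) by ring.
rewrite !cfD; apply: NPval_add; first by rewrite cfN; apply/NPval_opp/N_NP; exact: N1.
by apply: NPval_add; [apply/N_NP/N2_Nval | apply: P_NP].
Qed.

End Anti.
(** * Coefficients above the diagonal *)

Section Diagonal.
Variables (R : realType) (q : R[i]).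
Local Notation C := R[i].
Local Notation K := (ser C).
Implicit Types (x y u : K) (phi psi : nat -> K) (d a n : nat) (c : C).
Notation fw := (fw q).
Notation kz := (kz R).
Notation kk := (kk R).
Notation kf := (kf q).
Notation um := (um q).
Notation ee := (ee q).

Definition kfree x := forall d a, (0 < a)%N -> cf d a x = 0.
(** Holds because kappa enters only through R = z kappa. *)
Definition subd x := forall d a, (d < a)%N -> cf d a x = 0.

(* The coefficient of [T^d] in the sum of the [T^(b - A) [R^b] x], for [T = z], [R = z kappa]. *)
Definition ext A d x : C := \sum_(b < d.+1) cf (d + A) (b + A) x.

Lemma extD A d x y : ext A d (x + y) = ext A d x + ext A d y.
Proof. by rewrite /ext -big_split. Qed.

Lemma ext_kC A d c x : ext A d (kC c * x) = c * ext A d x.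
Proof. by rewrite /ext mulr_sumr; apply: eq_bigr => b _; rewrite cf_kC. Qed.

Lemma ext_sum (T : Type) (s : seq T) (F : T -> K) A d :
  ext A d (\sum_(i <- s) F i) = \sum_(i <- s) ext A d (F i).
Proof.
by rewrite /ext exchange_big /=; apply: eq_bigr => b _; rewrite cf_sum.
Qed.

Lemma ext_kfree0 d x : kfree x -> ext 0 d x = cf d 0 x.
Proof.
move=> h; rewrite /ext big_ord_recl /= !addn0 big1 ?addr0 // => b _.
by rewrite h.
Qed.

Lemma ext_kfreeS A d x : kfree x -> ext A.+1 d x = 0.
Proof. by move=> h; rewrite /ext big1 // => b _; rewrite h // addnS. Qed.

Lemma ext_kR0 d x : ext 0 d (kz * kk * x) = if d is d'.+1 then ext 0 d' x else 0.
Proof.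
rewrite /ext; case: d => [|d].
  by rewrite big_ord1 -mulrA cf_kz.
rewrite big_ord_recl /= !addn0 -mulrA cf_kz cf_kk add0r; apply: eq_bigr => b _.
by rewrite !addn0 cf_kz cf_kk.
Qed.

Lemma ext_kRS A d x : ext A.+1 d (kz * kk * x) = ext A d x.
Proof.
by rewrite /ext; apply: eq_bigr => b _; rewrite -mulrA !addnS cf_kz cf_kk.
Qed.

(** A factor free of kappa is a series in T alone and can be taken out of [ext]; the bounds of
    summation match because [x] vanishes above the diagonal. *)
Lemma ext_mul A d u x : kfree u -> subd x ->
  ext A d (u * x) = \sum_(i < d.+1) cf i 0 u * ext A (d - i) x.
Proof.
move=> hu hx; rewrite /ext.
have e b : cf (d + A) (b + A) (u * x) = \sum_(i < (d + A).+1) cf i 0 u * cf (d + A - i) (b + A) x.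
  rewrite cfM; apply: eq_bigr => i _; rewrite big_ord_recl subn0 big1 ?addr0 // => j _.
  by rewrite hu ?mul0r.
under eq_bigr do rewrite e.
rewrite exchange_big /= -addSn.
rewrite big_split_ord /= [X in _ + X]big1 ?addr0; last first.
  move=> i _; rewrite big1 // => b _; rewrite hx ?mulr0 //.
  by have := ltn_ord i; rewrite /=; lia.
apply: eq_bigr => i _; rewrite -mulr_sumr /ext; congr (_ * _).
have id : (i <= d)%N by rewrite -ltnS.
rewrite (big_ord_widen d.+1 (fun b => cf (d - i + A) (b + A) x)); last by rewrite ltnS leq_subr.
rewrite [RHS]big_mkcond /=; apply: eq_bigr => b _.
rewrite (_ : (d + A - i)%N = (d - i + A)%N); last by lia.
by case: ifP => // /negbT; rewrite -leqNgt => h; rewrite hx // ltn_add2r.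
Qed.

Section Closed.
Variables (P : K -> Prop) (t : K).
Hypotheses (P0 : P 0) (PD : forall x y, P x -> P y -> P (x + y)).
Hypotheses (Pf : forall m x, P x -> P (kf m * x)) (Pt : forall x, P x -> P (t * x)).

Lemma psum_closed phi M : (forall m, P (phi m)) -> P (psum phi M).
Proof. by move=> h; rewrite /psum; elim/big_ind: _. Qed.

Lemma run_closed a phi m : (forall n, P (phi n)) -> P (run kf a phi m).
Proof.
move=> h; elim: a m => [|a IH] m; first exact: h.
by apply: Pf; exact: psum_closed.
Qed.

Lemma res_closed phi m : (forall n, P (phi n)) -> P (res kf t phi m).
Proof.
move=> h; have hr n : P (res_psum kf t phi n).
  by elim: n => [|n IH] //=; apply: PD; [exact: PD | rewrite -mulrA; exact/Pt/Pf].
by apply: PD => //; rewrite -mulrA; exact/Pt/Pf.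
Qed.

Lemma ust_closed L m : P 1 -> P (ust kf kf t L m).
Proof.
move=> h1; elim: L m => [|a L IH] m; first by rewrite /=; case: (m == 0%N).
by apply: Pf; apply: run_closed => n; exact: res_closed.
Qed.

End Closed.

Lemma kfree1 : kfree 1.
Proof. by move=> d a a0; rewrite cf1; case: a a0 => // a _; rewrite andbF. Qed.

Lemma kfree_ust c L m : kfree (ust kf kf (kz * kC c) L m).
Proof.
apply: (ust_closed (P := kfree)); last exact: kfree1.
- by move=> d a _.
- by move=> x y hx hy d a h; rewrite cfD hx // hy // addr0.
- by move=> n x hx d a h; rewrite cf_kC hx // mulr0.
- by move=> x hx d a h; rewrite -mulrA cf_kz; case: d => // d; rewrite cf_kC hx // mulr0.
Qed.

Lemma kfree_um c L m : kfree (um (kC c) L m).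
Proof.
have P0 : kfree 0 by move=> d a _.
have PD x y : kfree x -> kfree y -> kfree (x + y) by move=> hx hy d a h; rewrite cfD hx // hy // addr0.
have Pf n x : kfree x -> kfree (kf n * x) by move=> hx d a h; rewrite cf_kC hx // mulr0.
case: L => [|a L]; first exact: P0.
apply: (run_closed (P := kfree)) => // n; apply: (res_closed (P := kfree)) => //.
  by move=> x hx d b h; rewrite -mulrA cf_kz; case: d => // d; rewrite cf_kC hx // mulr0.
by move=> k; exact: kfree_ust.
Qed.

Lemma subd_ee c L m : subd (ee (kC c) (kC c * kk) L m).
Proof.
apply: (res_closed (P := subd)).
- by move=> d a _.
- by move=> x y hx hy d a h; rewrite cfD hx // hy // addr0.
- by move=> n x hx d a h; rewrite cf_kC hx // mulr0.
- move=> x hx d a h; rewrite -!mulrA cf_kz; case: d h => // d h; rewrite cf_kC cf_kk.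
  by case: a h => [|a] h; rewrite ?mulr0 // hx ?mulr0.
- by move=> n d a h; apply: kfree_ust; apply: leq_ltn_trans h.
Qed.

Lemma cf_kf d a m x : cf d a (kf m * x) = fw m * cf d a x.
Proof. exact: cf_kC. Qed.

(** The powers of R beyond [A] are read as powers of T: a run next to the cut with at least [A]
    letters becomes a run of length [A] lengthened by T and closed off, as in [um]. *)
Lemma ext_ee c A L d m : ext A d (ee (kC c) (kC c * kk) L m) = c ^+ A * cf d 0 (um (kC c) (A :: L) m).
Proof.
set phi := ust kf kf (kz * kC c) L.
have hphi n : kfree (phi n) by exact: kfree_ust.
have eE n : ee (kC c) (kC c * kk) L n = phi n + kC (c * fw n) * (kz * kk * psum (ee (kC c) (kC c * kk) L) n).
  rewrite {1}/ee resE kCM -/(ee (kC c) (kC c * kk) L) -/(kf n); rewrite -/phi; congr (_ + _).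
  have id (z a k f p : K) : z * (a * k) * f * p = a * f * (z * k * p) by ring.
  exact: id.
elim: A d m => [|A IH] d m.
  rewrite expr0 mul1r /=; elim: d m => [|d IHd] m; rewrite eE extD ext_kC ext_kR0 ext_kfree0 // resE -/phi cfD.
    by congr (_ + _); rewrite -!mulrA cf_kz /= !mulr0.
  congr (_ + _); rewrite -[LHS]mulrA -[in RHS]mulrA -[in RHS]mulrA cf_kz /= cf_kC cf_kf cf_psum /psum ext_sum; do 2 congr (_ * _).
  by apply: eq_bigr => k _; exact: IHd.
rewrite eE extD ext_kfreeS // add0r ext_kC ext_kRS /psum ext_sum /= cf_kf cf_psum exprS.
rewrite -[LHS]mulrA -[RHS]mulrA; congr (_ * _); rewrite [RHS]mulrCA; congr (_ * _).
by rewrite /psum mulr_sumr; apply: eq_bigr => k _; exact: IH.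
Qed.

Lemma ext_conv c c' A L L' d t :
  ext A d (((um (kC c) L : fps K) * ee (kC c') (kC c' * kk) L') t) =
  c' ^+ A * cf d 0 (((um (kC c) L : fps K) * um (kC c') (A :: L')) t).
Proof.
rewrite !fpsM ext_sum cf_sum mulr_sumr; apply: eq_bigr => k _.
rewrite ext_mul; [|exact: kfree_um|exact: subd_ee].
rewrite cfM mulr_sumr; apply: eq_bigr => i _.
by rewrite big_ord1 subn0 ext_ee mulrCA.
Qed.

End Diagonal.

(** * Telescoping over the runs of a word *)

Section WordValues.
Variables (R : realType) (q : R[i]).
Local Notation C := R[i].
Local Notation K := (ser C).
Hypothesis q01 : 0 < `|q| < 1.
Implicit Types (x y u : K) (d a n i : nat) (A L : seq nat).
Notation fw := (fw q).
Notation kk := (kk R).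
Notation kf := (kf q).
Notation um := (um q).
Notation ee := (ee q).
Notation NPval := (NPval q).
Notation Mval := (Mval q).

(* The number of letters of a word with runs [L], counting the [x] that closes each run. *)
Definition wl L := (sumn L + size L)%N.
Definition lruns A i := rev (take i A).
Definition rruns A i := drop i.+1 A.

Definition lam P N : fps K := (um 1 P : fps K) * ee (- 1) (- kk) N + (ee 1 kk P : fps K) * um (- 1) N.

Lemma kCN1 : kC (- 1) = - 1 :> K. Proof. by rewrite kCN kC1. Qed.

Lemma ext_lam a d P N t : ext a d (lam P N t) =
  (- 1) ^+ a * cf d 0 (((um 1 P : fps K) * um (- 1) (a :: N)) t) +
  cf d 0 (((um 1 (a :: P) : fps K) * um (- 1) N) t).
Proof.
have h1 := @ext_conv R q 1 (-1) a P N d t.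
have h2 := @ext_conv R q (-1) 1 a N P d t.
rewrite kC1 kCN1 mulN1r in h1; rewrite kC1 kCN1 mul1r expr1n mul1r in h2.
rewrite (mulrC (um (- 1) N : fps K) (ee 1 kk P)) (mulrC (um (- 1) N : fps K) (um 1 _)) in h2.
by rewrite /lam fpsD extD h1 h2.
Qed.

(** By [ext_lam] the run that is cut joins either the right or the left half, giving the
    convolutions attached to the two ends of that run. Neighbouring runs share an end, and at the
    extremities one of the words is empty, where [um] is 0. *)
Lemma telescope_lam A d t :
  \sum_(i < size A) (- 1) ^+ wl (rruns A i) *
    ext (nth 0%N A i) d (pmul kf (lam (lruns A i) (rruns A i)) t) = 0.
Proof.
pose B i : C := (- 1) ^+ wl (drop i A) *
  (fw t * cf d 0 (((um 1 (rev (take i A)) : fps K) * um (- 1) (drop i A)) t)).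
transitivity (\sum_(0 <= i < size A) (B i.+1 - B i)).
  rewrite big_mkord; apply: eq_bigr => i _; have iA := ltn_ord i.
  rewrite /pmul ext_kC ext_lam /B /lruns /rruns (drop_nth 0%N iA) (take_nth 0%N iA) rev_rcons.
  have -> : wl (nth 0%N A i :: drop i.+1 A) = (nth 0%N A i + (wl (drop i.+1 A)).+1)%N.
    by rewrite /wl /=; lia.
  by rewrite exprD exprS; ring.
rewrite telescope_sumr // /B drop_size take0.
have z : (um 1 [::] : fps K) = 0 by [].
have z' : (um (- 1) [::] : fps K) = 0 by [].
by rewrite (_ : rev [::] = [::] :> seq nat) // z z' mulr0 mul0r fps0E !cf0 !mulr0 subrr.
Qed.

Lemma tame_lruns A i : (0 < head 0%N A)%N -> tame (lruns A i).
Proof. by case: A => [|a A] //= a0; case: i => // i; rewrite /lruns /= rev_cons /tame last_rcons a0 orbT. Qed.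

Lemma tame_rruns A i : (0 < last 0%N A)%N -> tame (rruns A i).
Proof.
move=> h; rewrite /tame /rruns; case e: (drop _ _) => [|b B] //=.
by rewrite -(cat_take_drop i.+1 A) e last_cat /= in h.
Qed.

Theorem word_values A d : (1 < size A)%N -> (0 < head 0%N A)%N -> (0 < last 0%N A)%N ->
  exists cu ce : nat -> K, [/\ forall i,
    [/\ cvgK (fun M => vu q (1, kk) (lruns A i) M * vu q (- 1, - kk) (rruns A i) M) (cu i),
      cvgK (fun M => ve q (1, kk) (lruns A i) M * ve q (- 1, - kk) (rruns A i) M) (ce i)
      & KV Mval (cu i - ce i)] &
    NPval (\sum_(i < size A) (- 1) ^+ wl (rruns A i) * ext (nth 0%N A i) d (cu i))].
Proof.
move=> sA hA lA.
have h i := mid_values q01 (rser1 q) (rser_kk q) (tame_lruns i hA) (tame_rruns i lA).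
have [cu hcu] := choice h; have [ce hce] := choice hcu.
exists cu, ce; split=> // {hcu}.
(* With at least two runs the halves are never both empty, so the recursion for the convolution has
   no term [dirac]. *)
have hne (i : 'I_(size A)) : ~~ ((lruns A i == [::]) && (rruns A i == [::])).
  apply/negP => /andP[/eqP e1 /eqP e2].
  have := congr1 size e1; have := congr1 size e2; rewrite /lruns /rruns size_drop size_rev size_take ltn_ord /=.
  lia.
have hv (i : 'I_(size A)) := anti_values q01 (rser1 q) (rser_kk q) (tame_lruns i hA) (tame_rruns i lA)
  (hne i) (let: And3 c _ _ := hce i in c).
have {}hv : forall i : 'I_(size A), exists v, KV NPval (cu i - v) /\
    cvgK (psum (pmul kf (lam (lruns A i) (rruns A i)))) v.
  by move=> i; have [v v1 v2] := hv i; exists v.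
have [v hv'] := choice hv.
have c0 : cvgC (fun M => \sum_(i < size A) (- 1) ^+ wl (rruns A i) *
    ext (nth 0%N A i) d (psum (pmul kf (lam (lruns A i) (rruns A i))) M))
    (\sum_(i < size A) (- 1) ^+ wl (rruns A i) * ext (nth 0%N A i) d (v i)).
  apply: cvgC_sum => i; apply: cvgCM (cvgC_cst _) _.
  by rewrite /ext; apply: cvgC_sum => b; have [_] := hv' i; apply.
(* The telescoping sum is 0 at every bound, hence in the limit; only the differences [cu i - v i]
   remain. *)
have z : \sum_(i < size A) (- 1) ^+ wl (rruns A i) * ext (nth 0%N A i) d (v i) = 0.
  apply: cvgC_unique c0 _; apply: cvgC_eq (cvgC_cst 0) => M.
  under eq_bigr do rewrite /psum ext_sum mulr_sumr.
  by rewrite exchange_big big1 // => t _; rewrite telescope_lam.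
rewrite -[X in NPval X]subr0 -[X in _ - X]z -sumrB.
have NPs (I : finType) (F : I -> C) : (forall j, NPval (F j)) -> NPval (\sum_j F j).
  by move=> hF; elim/big_ind: _ => // [|x y]; [exact: NPval0 | exact: NPval_add].
apply: (NPs _) => i; rewrite -mulrBr.
have -> : (- 1) ^+ wl (rruns A i) = ev q ((- 1) ^+ wl (rruns A i)) :> C.
  by elim: (wl _) => [|k IH]; rewrite ?expr0 ?ev1 // !exprS evM -IH evN ev1.
apply: NPval_scale; rewrite /ext -sumrB; apply: NPs => b.
by rewrite -cfB; case: (hv' i) => + _; apply.
Qed.

End WordValues.
(** * The symmetric sums as sums over cuts of a word *)

Section Star.
Variables (R : realType) (q : R[i]).
Local Notation C := R[i].
Implicit Types (a b w : seq letter) (s t : fsum) (M m n : nat) (k L : seq nat).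
Notation lw := (lw q).

(* Words are read from their last letter. *)
Fixpoint pz w : nat -> C :=
  if w is u :: w' then psum (fun m => lw u m * pz w' m) else fun _ => 1.

Lemma ZqM_from_pz w M : ZqM_from q w 0 M = pz (rev w) M.
Proof.
elim/last_ind: w M => [|w u IH] M //; rewrite rev_rcons /= ZqM_from_rcons.
case: M => [|M]; first by rewrite big_geq // psum0.
rewrite /psum big_add1 big_mkord [RHS]big_ord_recl /= mul0r add0r.
by apply: eq_bigr => m _; rewrite IH.
Qed.

Definition pzs s M := \sum_(p <- s) ev q p.1 * pz p.2 M.

Lemma pzs_cat s t M : pzs (s ++ t) M = pzs s M + pzs t M.
Proof. by rewrite /pzs big_cat. Qed.

Lemma pzs_letter c u s M : pzs [seq (c * p.1, u :: p.2) | p <- s] M =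
  ev q c * psum (fun m => lw u m * pzs s m) M.
Proof.
rewrite /pzs big_map -psumZ /psum; under eq_bigr do rewrite /= /psum mulr_sumr.
rewrite exchange_big; apply: eq_bigr => m _; rewrite !mulr_sumr; apply: eq_bigr => p _.
by rewrite evM; ring.
Qed.

Lemma pzs_letter1 u s M : pzs [seq (p.1, u :: p.2) | p <- s] M = psum (fun m => lw u m * pzs s m) M.
Proof.
rewrite -[RHS]mul1r -(ev1 q) -pzs_letter; congr pzs; apply: eq_map => p.
by rewrite mul1r.
Qed.

Lemma rstar_pz a b M : all valid_letter a -> all valid_letter b ->
  pzs (rstar a b) M = pz a M * pz b M.
Proof.
elim: a b M => [|u a IHa] b M; first by rewrite /pzs big_seq1 ev1 !mul1r.
move=> /andP[ua va]; elim: b M => [|v b IHb] M; first by rewrite /pzs big_seq1 ev1 mul1r mulr1.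
move=> /andP[vb wb].
have -> : rstar (u :: a) (v :: b) = [seq (p.1, u :: p.2) | p <- rstar a (v :: b)]
  ++ [seq (p.1, v :: p.2) | p <- rstar (u :: a) b]
  ++ [seq ((circ u v).1 * p.1, (circ u v).2 :: p.2) | p <- rstar a b] by [].
rewrite !pzs_cat pzs_letter pzs_letter1 pzs_letter1 -psumZ -!psumD /= psumM.
apply: eq_psum => m; rewrite IHa //= ?vb // IHb // IHa // [ev q _ * (_ * _)]mulrA -lw_circ //.
by rewrite /=; ring.
Qed.

Lemma ZqM_star_psi w w' M : all valid_letter w -> all valid_letter w' ->
  ZqM q (star (word w) (psi_word w')) M =
  (- 1) ^+ sumn (map psi_sign w') * (ZqM_from q w 0 M * ZqM_from q (rev w') 0 M).
Proof.
move=> vw vw'; rewrite !ZqM_from_pz -rstar_pz ?all_rev ?revK //.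
rewrite /ZqM /pzs /star /= cats0 /star_word big_map revK mulr_sumr.
rewrite big_map; apply: eq_bigr => p _ /=.
by rewrite ZqM_from_pz revK mul1r evM evC rmorphXn /= rmorphN1 mulrA.
Qed.

Definition pg L := pz (map G L).

Lemma ZqM_wS k M : is_index k -> ZqM q (wS (gword k)) M =
  \sum_(i <- iota 0 (size k).+1)
    (- 1) ^+ sumn (drop i k) * (pg (rev (take i k)) M * pg (drop i k) M).
Proof.
move=> hk; have hv : all valid_letter (gword k) by rewrite all_map.
have vs (s : seq nat) (F : nat -> fsum) : ZqM q (flatten [seq F i | i <- s]) M = \sum_(i <- s) ZqM q (F i) M.
  elim: s => [|i s IH] /=; first by rewrite /ZqM !big_nil.
  by rewrite ZqM_cat IH big_cons.
rewrite /wS vs size_map; apply: eq_bigr => i _.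
have /andP[vt vd] : all valid_letter (take i (gword k)) && all valid_letter (drop i (gword k)).
  by rewrite -all_cat cat_take_drop.
rewrite ZqM_star_psi // !ZqM_from_pz revK /gword -map_take -map_drop -map_rev /pg.
by rewrite -map_comp (@eq_map _ _ _ id) // map_id.
Qed.

End Star.

(** * Cuts of a word at its letters [y] *)

Section Cuts.
Implicit Types (u w l : seq bool) (k L P A : seq nat).

(** The left half is kept reversed, so that both halves are read outwards from the cut. *)
Fixpoint cutl u w : seq (seq bool * seq bool) :=
  if w is b :: w' then (if b then [:: (u, w')] else [::]) ++ cutl (b :: u) w' else [::].

(* The word [x y^(a_1) x y^(a_2) ...]. *)
Definition xwords L := flatten [seq false :: nseq a true | a <- L].
Definition rword L := if L is a :: L' then nseq a true ++ xwords L' else [::].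

Lemma nseq_shift (T : Type) (x : T) a (s : seq T) : nseq a x ++ x :: s = nseq a.+1 x ++ s.
Proof. by elim: a => //= a ->. Qed.

Section Sum.
Variables (V : nmodType) (F : seq bool -> seq bool -> V).

Lemma cutl_run u a w : \sum_(p <- cutl u (nseq a true ++ w)) F p.1 p.2 =
  \sum_(b < a) F (nseq b true ++ u) (nseq (a.-1 - b) true ++ w) +
  \sum_(p <- cutl (nseq a true ++ u) w) F p.1 p.2.
Proof.
elim: a u => [|a IH] u /=; first by rewrite big_ord0 add0r.
rewrite big_cons IH big_ord_recl /= subn0 -addrA; congr (_ + (_ + _)).
  by apply: eq_bigr => b _; rewrite nseq_shift /bump /= add1n subnS predn_sub.
by rewrite nseq_shift.
Qed.

Lemma cutl_rword P A : \sum_(p <- cutl (xwords P) (rword A)) F p.1 p.2 =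
  \sum_(i < size A) \sum_(b < nth 0%N A i)
    F (nseq b true ++ xwords (lruns A i ++ P))
      (nseq ((nth 0%N A i).-1 - b) true ++ xwords (rruns A i)).
Proof.
elim: A P => [|a [|a' A] IH] P; first by rewrite big_nil big_ord0.
  by rewrite [rword _]/= cutl_run big_nil addr0 big_ord1.
rewrite [rword _]/= cutl_run [RHS]big_ord_recl; congr (_ + _).
have := IH (a :: P); rewrite /= => ->; apply: eq_bigr => i _.
by rewrite /lruns /rruns /bump /= rev_cons cat_rcons.
Qed.

Lemma cutl_x u c w : cutl u (nseq c false ++ w) = cutl (nseq c false ++ u) w.
Proof. by elim: c u => //= c IH u; rewrite IH nseq_shift. Qed.

(** The letters [y] of z_k y mark the deconcatenations of k; the appended [y] stands for the one
    with empty right part. *)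
Lemma cutl_zword u k : \sum_(p <- cutl u (zword k ++ [:: true])) F p.1 p.2 =
  \sum_(i < (size k).+1) F (rev (zword (take i k)) ++ u) (behead (zword (drop i k) ++ [:: true])).
Proof.
elim: k u => [|c k IH] u; first by rewrite /= big_seq1 big_ord1.
rewrite -[zword (c :: k)]/((true :: nseq c.-1 false) ++ zword k) big_ord_recl /= big_cons /=.
congr (_ + _); rewrite -catA cutl_x IH; apply: eq_bigr => i _.
by rewrite -[zword (c :: _)]/((true :: nseq c.-1 false) ++ zword _) rev_cat rev_cons rev_nseq -!catA cat_rcons.
Qed.

End Sum.

Lemma size_zword k : is_index k -> size (zword k) = sumn k.
Proof.
elim: k => //= c k IH /andP[c0 hk]; rewrite /zword /= size_cat size_nseq.
by rewrite -/(zword k) IH // -addSn prednK.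
Qed.

End Cuts.

Section Summand.
Variables (A : comPzRingType) (gx gy : nat -> A).
Implicit Types (l : seq bool) (L : seq nat).

(** The head of the word, next to the cut, is the outermost operator and carries the largest
    index. *)
Fixpoint ew l : nat -> A :=
  match l with
  | [::] => fun n => (n == 0%N)%:R
  | true :: l' => fun n => gy n * psum (ew l') n
  | false :: l' => fun n => gx n * ew l' n
  end.

Fixpoint kw L : nat -> A :=
  match L with
  | [::] => fun n => (n == 0%N)%:R
  | k :: L' => fun n => gx n ^+ k.-1 * (gy n * psum (kw L') n)
  end.

Lemma ew_run a l : ew (nseq a true ++ l) = run gy a (ew l).
Proof. by elim: a => //= a ->. Qed.

Lemma ew_xwords L : ew (xwords L) = est gx gy L.
Proof. by elim: L => //= a L IH; rewrite -/(xwords L) ew_run IH. Qed.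

Lemma ew_x c l n : ew (nseq c false ++ l) n = gx n ^+ c * ew l n.
Proof. by elim: c => [|c IH]; rewrite ?mul1r //= IH exprS mulrA. Qed.

Lemma ew_rev_zword L : ew (rev (zword L)) = kw (rev L).
Proof.
elim/last_ind: L => // L c IH; rewrite rev_rcons /= -IH.
rewrite /zword map_rcons flatten_rcons rev_cat rev_cons rev_nseq cat_rcons.
by apply: funext => n; rewrite ew_x.
Qed.

Lemma ew_behead_zword L : ew (behead (zword L ++ [:: true])) = kw L.
Proof.
elim: L => // c L IH; rewrite -[zword _]/((true :: nseq c.-1 false) ++ zword L) /= -catA.
apply: funext => n; rewrite ew_x -IH; congr (_ * _).
by case: (L) => [|c' L'].
Qed.

End Summand.

Section CutSum.
Variables (R : realType) (q : R[i]).
Local Notation C := R[i].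
Notation fw := (fw q).

Lemma pg_kw L M : is_index L -> (0 < M)%N -> psum (kw fw fw L) M = pg q L M.
Proof.
elim: L M => [|k L IH] M /=; first by move=> _; exact: psum_dirac.
move=> /andP[k0 hL] M0; apply: eq_bigr => m _; rewrite lwG //.
have [->|m0] := posnP m; first by rewrite fw0 mul0r mulr0 expr0n; case: (k) k0 => //= ?; rewrite mul0r.
by rewrite IH // mulrA -exprSr prednK.
Qed.

(** The right half loses the [y] at the cut and gains the appended one, so its length is the weight
    of the right part and gives the sign of psi^*. *)
Definition cut M (u w : seq bool) : C :=
  (- 1) ^+ size w * (psum (ew fw fw u) M * psum (ew fw fw w) M).

Lemma ZqM_cuts k M : is_index k -> (0 < M)%N ->
  ZqM q (wS (gword k)) M = \sum_(p <- cutl [::] (zword k ++ [:: true])) cut M p.1 p.2.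
Proof.
move=> hk M0; rewrite ZqM_wS // -[iota _ _]/(index_iota 0 (size k).+1) big_mkord (cutl_zword (cut M)); apply: eq_bigr => i _.
have /andP[ht hd] : is_index (take i k) && is_index (drop i k) by rewrite /is_index -all_cat cat_take_drop.
rewrite /cut cats0 ew_rev_zword ew_behead_zword !pg_kw //; last by rewrite /is_index all_rev.
congr (_ ^+ _ * _); rewrite size_behead size_cat size_zword // addn1.
by [].
Qed.

End CutSum.
(** * Sums over compositions *)

Section Compositions.
Variable R : realType.
Local Notation C := R[i].
Implicit Types (r m n i j a b : nat) (e k L : seq nat) (f g h : seq nat -> C).

Fixpoint sw r m f : C :=
  if r is r'.+1 then \sum_(j < m.+1) sw r' (m - j) (fun e => f (nat_of_ord j :: e))
  else (m == 0%N)%:R * f [::].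

Lemma sum_tuple_sw n r m f : (m <= n)%N ->
  \sum_(e : r.-tuple 'I_n.+1 | (\sum_(x <- tval e) nat_of_ord x)%N == m)
     f [seq nat_of_ord x | x <- tval e] = sw r m f.
Proof.
elim: r m f => [|r IH] m f mn.
  rewrite big_mkcond (bigD1 [tuple]) //= big_nil big1 ?addr0 => [|t /eqP ne].
    by rewrite eq_sym; case: eqP; rewrite ?mul1r ?mul0r.
  by exfalso; apply: ne; exact: (tuple0 t).
rewrite /= -(big_mkord xpredT (fun j => sw r (m - j) (fun e => f (j :: e)))).
rewrite (big_nat_widen _ _ n.+1) // big_mkord.
rewrite (reindex (fun p : 'I_n.+1 * r.-tuple 'I_n.+1 => [tuple of p.1 :: p.2])) /=; last first.
  exists (fun t => (thead t, [tuple of behead t])) => [[x t] _|t _] /=.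
    by congr (_, _); apply: val_inj.
  by case/tupleP: t => x t; apply: val_inj.
under eq_bigl do rewrite big_cons.
rewrite -(pair_big_dep xpredT (fun (x : 'I_n.+1) (t : r.-tuple 'I_n.+1) =>
   (x + \sum_(y <- t) y == m)%N) (fun x t => f (nat_of_ord x :: map (@nat_of_ord n.+1) t))) /=.
rewrite [RHS]big_mkcond; apply: eq_bigr => x _; rewrite ltnS.
case: leqP => hx.
  rewrite -IH; last by apply: leq_trans mn; exact: leq_subr.
  by apply: eq_bigl => t; apply/eqP/eqP; lia.
by rewrite big_pred0 // => t; apply/negP => /eqP; lia.
Qed.

Lemma sum_wt_sw r m f : sum_wt r m f = sw r m f.
Proof. exact: sum_tuple_sw. Qed.

Lemma eq_sw r m f g : (forall e, size e = r -> sumn e = m -> f e = g e) -> sw r m f = sw r m g.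
Proof.
elim: r m f g => [|r IH] m f g h /=.
  by case: eqP => [e|_]; rewrite ?mul0r // h.
apply: eq_bigr => j _; apply: IH => e he hs; apply: h; first by rewrite /= he.
by rewrite /= hs subnKC // -ltnS.
Qed.

Lemma sw_sum (I : Type) (s : seq I) r m (F : I -> seq nat -> C) :
  sw r m (fun e => \sum_(i <- s) F i e) = \sum_(i <- s) sw r m (F i).
Proof.
elim: r m F => [|r IH] m F /=; first by rewrite mulr_sumr.
by rewrite exchange_big /=; apply: eq_bigr => j _; rewrite IH.
Qed.

Lemma swZ c r m f : sw r m (fun e => c * f e) = c * sw r m f.
Proof.
elim: r m f => [|r IH] m f /=; first by rewrite mulrCA.
by rewrite mulr_sumr; apply: eq_bigr => j _; rewrite IH.
Qed.

Lemma sw_psum r m (F : seq nat -> nat -> C) M :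
  sw r m (fun e => psum (F e) M) = psum (fun n => sw r m (fun e => F e n)) M.
Proof. exact: sw_sum. Qed.

Lemma sw_zero r f : sw r 0 f = f (nseq r 0%N).
Proof.
elim: r f => [|r IH] f /=; first by rewrite mul1r.
by rewrite big_ord1 IH.
Qed.

Lemma sum_tri (V : nmodType) m (F : nat -> nat -> V) :
  \sum_(j < m.+1) \sum_(a < (m - j).+1) F j a = \sum_(s < m.+1) \sum_(j < s.+1) F j (s - j)%N.
Proof.
elim: m => [|m IH]; first by rewrite !big_ord1.
rewrite [RHS]big_ord_recr /= -IH big_ord_recr /= subnn big_ord1.
rewrite [X in _ = _ + X]big_ord_recr /= subnn addrA; congr (_ + _).
rewrite -big_split /=; apply: eq_bigr => j _.
by rewrite subSn -1?ltnS // big_ord_recr.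
Qed.

Lemma sum_tri_sym (V : nmodType) m (F : nat -> nat -> V) :
  \sum_(j < m.+1) \sum_(a < (m - j).+1) F j a = \sum_(a < m.+1) \sum_(j < (m - a).+1) F j a.
Proof.
rewrite !sum_tri; rewrite (sum_tri m (fun a j => F j a)); apply: eq_bigr => s _.
rewrite (reindex_inj rev_ord_inj) /=; apply: eq_bigr => j _.
by rewrite subSS subKn // -ltnS.
Qed.

Lemma sw_cat r1 r2 m g h :
  sw (r1 + r2) m (fun e => g (take r1 e) * h (drop r1 e)) =
  \sum_(a < m.+1) sw r1 a g * sw r2 (m - a) h.
Proof.
elim: r1 m g => [|r1 IH] m g.
  rewrite big_ord_recl /= big1 ?addr0 => [|a _]; last by rewrite !mul0r.
  rewrite mul1r subn0 -swZ; apply: eq_sw => e _ _.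
  by rewrite take0 drop0.
rewrite addSn /=; under eq_bigr do rewrite /= (IH _ (fun e => g (_ :: e))).
rewrite (sum_tri m (fun j a => sw r1 a (fun e => g (j :: e)) * sw r2 (m - j - a) h)).
apply: eq_bigr => s _; rewrite mulr_suml; apply: eq_bigr => j _.
by rewrite -subnDA subnKC // -ltnS.
Qed.

(** Isolates the increment of the run that is cut from those of the runs on its two sides. *)
Lemma sw_mid i r m f : sw (i + r.+1) m f =
  \sum_(j < m.+1) sw (i + r) (m - j) (fun e => f (take i e ++ nat_of_ord j :: drop i e)).
Proof.
elim: i m f => [|i IH] m f.
  by apply: eq_bigr => j _; apply: eq_sw => e _ _; rewrite take0 drop0.
rewrite !addSn /=; under eq_bigr do rewrite IH.
rewrite (sum_tri_sym m (fun l j => sw (i + r) (m - l - j) (fun e => f (l :: take i e ++ j :: drop i e)))).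
by apply: eq_bigr => j _; apply: eq_bigr => l _; rewrite subnAC.
Qed.

Lemma sw_rev r m f : sw r m (fun e => f (rev e)) = sw r m f.
Proof.
rewrite -!sum_wt_sw /sum_wt.
rewrite (reindex_inj (h := fun t : r.-tuple 'I_m.+1 => [tuple of rev t])); last first.
  by move=> s t /(congr1 val) /= e; apply: val_inj; rewrite -[LHS]revK e revK.
apply: eq_big => [t|t _] /=; last by rewrite map_rev revK.
by rewrite (perm_big _ (permEl (perm_rev _))).
Qed.

Lemma size_add_index k e : size k = size e -> size (add_index k e) = size k.
Proof. by move=> h; rewrite size_map size_zip -h minnn. Qed.

Lemma add_index_cat k k' e e' : size k = size e ->
  add_index (k ++ k') (e ++ e') = add_index k e ++ add_index k' e'.
Proof. by move=> h; rewrite /add_index zip_cat // map_cat. Qed.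

Lemma add_index_rev k e : size k = size e -> rev (add_index k e) = add_index (rev k) (rev e).
Proof. by move=> h; rewrite /add_index -map_rev rev_zip. Qed.

Lemma take_add_index i k e : take i (add_index k e) = add_index (take i k) (take i e).
Proof.
by rewrite /add_index; elim: i k e => [|i IH] [|a k] [|b e] //=; rewrite ?take0 // IH.
Qed.

Lemma drop_add_index i k e : drop i (add_index k e) = add_index (drop i k) (drop i e).
Proof.
rewrite /add_index; elim: i k e => [|i IH] k e; first by rewrite !drop0.
case: k e => [|a k] [|b e]; last exact: IH.
- by [].
- by rewrite /=; case: (drop i e).
- by rewrite /=; case: (drop i k).
Qed.

Lemma sumn_add_index k e : size k = size e -> sumn (add_index k e) = (sumn k + sumn e)%N.
Proof.
rewrite /add_index; elim: k e => [|a k IH] [|b e] //= [h]; rewrite IH //; lia.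
Qed.

Lemma is_index_add k e : size k = size e -> is_index k -> is_index (add_index k e).
Proof.
rewrite /add_index; elim: k e => [|a k IH] [|b e] //= [h] /andP[a0 hk]; rewrite IH // andbT.
by rewrite ltn_addr.
Qed.

End Compositions.
(** * Generating series of the sums over compositions *)

Lemma runS (A : pzRingType) (g : nat -> A) a phi n :
  run g a.+1 phi n = g n * psum (run g a phi) n.
Proof. by []. Qed.

Section Generating.
Variables (R : realType) (q : R[i]).
Local Notation C := R[i].
Local Notation K := (ser C).
Implicit Types (x y u : K) (phi psi : nat -> K) (d a b n m r i j : nat) (L A P e : seq nat) (c : C).
Notation fw := (fw q).
Notation kz := (kz R).
Notation kk := (kk R).
Notation kf := (kf q).
Notation yw := (yw q).

Lemma cf_kfreeM d a u x : kfree u ->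
  cf d a (u * x) = \sum_(i < d.+1) cf i 0 u * cf (d - i) a x.
Proof.
move=> hu; rewrite cfM; apply: eq_bigr => i _.
by rewrite big_ord_recl subn0 big1 ?addr0 // => b _; rewrite hu ?mul0r.
Qed.

Lemma cf0M d x y : cf d 0 (x * y) = \sum_(i < d.+1) cf i 0 x * cf (d - i) 0 y.
Proof. by rewrite cfM; apply: eq_bigr => i _; rewrite big_ord1. Qed.

Lemma ywM c n x : yw (kC c) fw n * x = kC (fw n) * x + kz * (kC c * (kf n * (yw (kC c) fw n * x))).
Proof.
rewrite {1}ywE mulrDl; congr (_ + _).
by move: (yw (kC c) fw n) (kf n) (kC c) kz => u v w z; ring.
Qed.

Lemma cf_yw c n m x : cf m 0 (yw (kC c) fw n * x) =
  \sum_(j < m.+1) c ^+ j * fw n ^+ j.+1 * cf (m - j) 0 x.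
Proof.
elim: m x => [|m IH] x; rewrite ywM cfD cf_kC cf_kz.
  by rewrite big_ord1 expr0 mul1r expr1 subn0 addr0.
rewrite big_ord_recl expr0 mul1r expr1 subn0; congr (_ + _).
rewrite cf_kC cf_kf IH !mulr_sumr; apply: eq_bigr => j _.
by rewrite /= /bump /= ?add1n !exprS subSS; ring.
Qed.

Lemma kfree_yw c n : kfree (yw (kC c) fw n).
Proof.
move=> d; elim: d => [|d IH] a a0; rewrite ywE cfD cf_kC1.
  by case: a a0 => // a _; rewrite andbF mulr0 -mulrA cf_kz addr0.
case: a a0 => // a _; rewrite andbF mulr0 add0r -mulrA cf_kz cf_kC cf_kf.
by rewrite IH // !mulr0.
Qed.

Lemma cf_dirac d a n : cf d a ((n == 0%N)%:R : K) = ((d == 0%N) && (a == 0%N))%:R * (n == 0%N)%:R.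
Proof. by case: (n == 0%N); rewrite ?cf1 ?mulr1 // cf0 mulr0. Qed.

Lemma cf_kfX k n m x : cf m 0 (kf n ^+ k * x) = fw n ^+ k * cf m 0 x.
Proof.
elim: k x => [|k IH] x; first by rewrite !expr0 !mul1r.
by rewrite !exprS -mulrA cf_kf IH mulrA.
Qed.

(** [c] is 1 to the left of the cut and -1 to its right, where [c ^+ m] supplies the sign of the
    added weight. *)
Lemma cf_kw c L m n : is_index L -> cf m 0 (kw kf (yw (kC c) fw) L n) =
  c ^+ m * sw (size L) m (fun e => kw fw fw (add_index L e) n).
Proof.
elim: L m n => [|k L IH] m n /=.
  by move=> _; rewrite cf_dirac andbT; case: m => [|m]; rewrite ?expr0 ?mul1r // !mul0r mulr0.
move=> /andP[k0 hL]; rewrite cf_kfX cf_yw mulr_sumr mulr_sumr; apply: eq_bigr => j _.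
have jm : (j <= m)%N by rewrite -ltnS.
rewrite cf_psum /psum; under eq_bigr do rewrite IH //.
rewrite -mulr_sumr -sw_sum.
have ec : c ^+ m = c ^+ j * c ^+ (m - j) by rewrite -exprD subnKC.
have ef : fw n ^+ k.-1 * fw n ^+ j.+1 = fw n ^+ (k + j).-1 * fw n.
  by rewrite -exprD -exprSr; congr (_ ^+ _); lia.
rewrite !swZ ec.
set S := sw (size L) (m - j) _; rewrite -[X in _ = _ * (_ * (_ * X))]/S; clearbody S.
move: (fw n ^+ k.-1) (fw n ^+ j.+1) (fw n ^+ (k + j).-1) ef => u v w; move: (fw n) => z ef.
have -> : c ^+ j * c ^+ (m - j) * (w * (z * S)) = c ^+ j * c ^+ (m - j) * (w * z) * S by ring.
by rewrite -ef; ring.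
Qed.

Lemma cf_run_res c a m phi n :
  cf m 0 (run kf a (res kf (kz * kC c) phi) n) =
  \sum_(j < m.+1) c ^+ j * run fw (a + j) (fun n => cf (m - j) 0 (phi n)) n.
Proof.
have run_sum (F : nat -> nat -> C) s b k :
    run fw b (fun n => \sum_(j < s) F j n) k = \sum_(j < s) run fw b (F j) k.
  elim: b k => // b IH k; rewrite runS; under eq_psum do rewrite IH.
  by rewrite /psum exchange_big mulr_sumr.
have runZ w b f k : run fw b (fun n => w * f n) k = w * run fw b f k.
  elim: b k => // b IH k; rewrite !runS; under eq_psum do rewrite IH.
  by rewrite psumZ; ring.
have runD b b' f : run fw (b + b') f = run fw b (run fw b' f) by rewrite /run iterD.
have cf_run b psi k : cf m 0 (run kf b psi k) = run fw b (fun n => cf m 0 (psi n)) k.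
  elim: b k => // b IH k; rewrite !runS cf_kf cf_psum; congr (_ * _).
  by apply: eq_psum => l; rewrite IH.
rewrite cf_run.
transitivity (run fw a (fun n => \sum_(j < m.+1) c ^+ j * run fw j (fun n => cf (m - j) 0 (phi n)) n) n).
  congr (run _ _ _ _); apply: funext => {}n; clear cf_run.
  elim: m n => [|m IH] n; rewrite resE cfD.
    by rewrite big_ord1 expr0 mul1r subn0 -!mulrA cf_kz addr0.
  rewrite big_ord_recl expr0 mul1r subn0 -[in LHS]mulrA -[in LHS]mulrA cf_kz /= cf_kC cf_kf cf_psum.
  congr (_ + _); under eq_psum do rewrite IH.
  rewrite /psum exchange_big !mulr_sumr; apply: eq_bigr => j _.
  by rewrite /bump /= add1n subSS exprS -mulr_sumr /psum; ring.
rewrite (run_sum (fun j k => c ^+ j * run fw j (fun l => cf (m - j) 0 (phi l)) k)); apply: eq_bigr => j _; rewrite runZ; congr (_ * _).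
by rewrite runD.
Qed.

Lemma cf_ust c L m n : cf m 0 (ust kf kf (kz * kC c) L n) =
  c ^+ m * sw (size L) m (fun e => est fw fw (add_index L e) n).
Proof.
elim: L m n => [|a L IH] m n /=.
  by rewrite cf_dirac andbT; case: m => [|m]; rewrite ?expr0 ?mul1r // !mul0r mulr0.
rewrite cf_kf cf_run_res !mulr_sumr; apply: eq_bigr => j _.
have jm : (j <= m)%N by rewrite -ltnS.
have -> : (fun n => cf (m - j) 0 (ust kf kf (kz * kC c) L n)) =
    (fun n => c ^+ (m - j) * sw (size L) (m - j) (fun e => est fw fw (add_index L e) n)).
  by apply: funext => k; rewrite IH.
have run_sw b k : run fw b (fun n => c ^+ (m - j) * sw (size L) (m - j) (fun e => est fw fw (add_index L e) n)) k =
    c ^+ (m - j) * sw (size L) (m - j) (fun e => run fw b (est fw fw (add_index L e)) k).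
  elim: b k => // b IHb k; rewrite runS; under eq_psum do rewrite IHb.
  by rewrite psumZ -sw_psum mulrCA; congr (_ * _); rewrite -swZ.
have ec : c ^+ m = c ^+ j * c ^+ (m - j) by rewrite -exprD subnKC.
rewrite run_sw ec swZ.
set S := sw (size L) (m - j) _; rewrite -[X in _ = _ * (_ * X)]/S; clearbody S.
by ring.
Qed.

Lemma cf_run_ust c b L m M : cf m 0 (psum (run kf b (ust kf kf (kz * kC c) L)) M) =
  c ^+ m * sw (size L) m (fun e => psum (run fw b (est fw fw (add_index L e))) M).
Proof.
rewrite cf_psum sw_psum -psumZ; apply: eq_psum; elim: b => [|b IH] n; first exact: cf_ust.
have -> : sw (size L) m (fun e => run fw b.+1 (est fw fw (add_index L e)) n) =
    fw n * psum (fun k => sw (size L) m (fun e => run fw b (est fw fw (add_index L e)) k)) n.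
  by rewrite -sw_psum -swZ.
rewrite runS cf_kf cf_psum mulrCA; congr (_ * _); rewrite -psumZ.
by apply: eq_psum => k; exact: IH.
Qed.

(** As kappa always comes with a factor z, its exponent [a] both counts the letters of the run and
    shifts the degree in z. *)
Lemma cf_res_run (g phi : nat -> K) c d a n : (forall n, kfree (g n)) -> (forall n, kfree (phi n)) ->
  cf d a (res g (kz * (kC c * kk)) phi n) =
  if (a <= d)%N then c ^+ a * cf (d - a) 0 (run g a phi n) else 0.
Proof.
move=> hg hphi; elim: a d n => [|a IH] d n; rewrite resE cfD.
  rewrite leq0n expr0 mul1r subn0 /= -!mulrA cf_kz; case: d => [|d]; rewrite ?addr0 //.
  by rewrite cf_kC cf_kk mulr0 addr0.
rewrite hphi // add0r -!mulrA cf_kz; case: d => [|d] //.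
rewrite cf_kC cf_kk ltnS subSS cf_kfreeM //.
have e i : cf (d - i) a (psum (res g (kz * (kC c * kk)) phi) n) =
    if (a <= d - i)%N then c ^+ a * cf (d - i - a) 0 (psum (run g a phi) n) else 0.
  rewrite cf_psum; case: ifP => h; last by rewrite /psum big1 // => k _; rewrite IH h.
  by rewrite cf_psum -psumZ; apply: eq_psum => k; rewrite IH h.
under eq_bigr do rewrite e.
case: ifP => ad; last first.
  rewrite big1 ?mulr0 // => i _; rewrite ifF ?mulr0 //; apply/negbTE; rewrite -ltnNge.
  by apply: leq_ltn_trans (leq_subr _ _) _; rewrite ltnNge ad.
rewrite runS cf0M exprS -mulrA; congr (_ * _).
rewrite (big_ord_widen d.+1 (fun i => cf i 0 (g n) * cf (d - a - i) 0 (psum (run g a phi) n))); last first.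
  by rewrite ltnS leq_subr.
rewrite mulr_sumr [RHS]big_mkcond; apply: eq_bigr => i _ /=.
rewrite (_ : (a <= d - i)%N = (i < (d - a).+1)%N); last by have := ltn_ord i; move: ad; lia.
case: ifP => _; last by rewrite mulr0.
by rewrite subnAC mulrCA.
Qed.

Lemma cf_diag_mul (x y : K) (X Y : nat -> nat -> C) a m :
  (forall d b, cf d b x = if (b <= d)%N then X b (d - b)%N else 0) ->
  (forall d b, cf d b y = if (b <= d)%N then Y b (d - b)%N else 0) ->
  cf (m + a) a (x * y) =
  \sum_(b < a.+1) \sum_(i < m.+1) X b i * Y (a - b)%N (m - i)%N.
Proof.
move=> hx hy; rewrite cfM exchange_big; apply: eq_bigr => b _ /=.
have ba : (b <= a)%N by rewrite -ltnS.
rewrite -(big_mkord xpredT (fun i => cf i b x * cf (m + a - i) (a - b) y)).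
rewrite (big_cat_nat (n := b)) //=; last by rewrite leqW // (leq_trans ba) ?leq_addl.
rewrite big_nat big1 ?add0r => [|i /andP[_ ib]]; last by rewrite hx leqNgt ib mul0r.
rewrite (big_cat_nat (n := (b + m.+1)%N)) /=; try lia.
rewrite [X in _ + X]big_nat [X in _ + X]big1 ?addr0 => [|i /andP[h1 h2]]; last first.
  by rewrite hy ifF ?mulr0 //; lia.
rewrite -{1}[nat_of_ord b]add0n [(b + m.+1)%N]addnC big_addn addnK big_mkord; apply: eq_bigr => i _.
have im : (i <= m)%N by rewrite -ltnS.
rewrite hx leq_addl addnK hy ifT; last by lia.
by congr (_ * Y _ _); lia.
Qed.

End Generating.
(** * The two sides of the Ohno relation *)

Section Sides.
Variables (R : realType) (q : R[i]).
Local Notation C := R[i].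
Local Notation K := (ser C).
Implicit Types (x y u : K) (phi psi : nat -> K) (d a b n m r i j M : nat) (k L A P N e : seq nat) (c : C).
Notation fw := (fw q).
Notation kz := (kz R).
Notation kk := (kk R).
Notation kf := (kf q).
Notation yw := (yw q).
Notation vu := (vu q).
Notation ve := (ve q).

Lemma kfree_est c L n : kfree (est kf (yw (kC c) fw) L n).
Proof.
have P0 : @kfree R 0 by move=> d a _.
have PD x y : kfree x -> kfree y -> kfree (x + y) by move=> hx hy d a h; rewrite cfD hx // hy // addr0.
have Pf m x : kfree x -> kfree (kf m * x) by move=> hx d a h; rewrite cf_kf hx // mulr0.
have Py m x : kfree x -> kfree (yw (kC c) fw m * x).
  move=> hx d a h; rewrite (cf_kfreeM _ _ _ (kfree_yw q c m)) big1 // => i _.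
  by rewrite hx // mulr0.
have Ps phi M : (forall m, kfree (phi m)) -> kfree (psum phi M).
  by move=> h; rewrite /psum; elim/big_ind: _.
elim: L n => [|a L IH] n; first by rewrite /=; case: (n == 0%N) => //; exact: kfree1.
by apply: Pf; elim: a n => [|a IHa] n; [exact: IH | apply: Py; exact: Ps].
Qed.

Lemma cf_vu c L M d a : cf d a (vu (kC c, kC c * kk) L M) =
  if (a <= d)%N then c ^+ a * cf (d - a) 0 (psum (run kf a (ust kf kf (kz * kC c) L)) M) else 0.
Proof.
have hf n : kfree (kf n) by move=> i b; case: b => // b _; rewrite cf_kC1 andbF mulr0.
rewrite cf_psum; under eq_psum do rewrite (cf_res_run _ _ _ _ hf (@kfree_ust _ _ c L)).
by case: ifP => _; [rewrite psumZ cf_psum | rewrite /psum big1].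
Qed.

Lemma cf_ve c L M d a : cf d a (ve (kC c, kC c * kk) L M) =
  if (a <= d)%N then c ^+ a *
    cf (d - a) 0 (psum (run (yw (kC c) fw) a (est kf (yw (kC c) fw) L)) M) else 0.
Proof.
rewrite cf_psum; under eq_psum do rewrite (cf_res_run _ _ _ _ (kfree_yw q c) (@kfree_est c L)).
by case: ifP => _; [rewrite psumZ cf_psum | rewrite /psum big1].
Qed.

Lemma cf_vu_mul P N M m a : cf (m + a) a (vu (1, kk) P M * vu (- 1, - kk) N M) =
  \sum_(b < a.+1) \sum_(i < m.+1) cf i 0 (psum (run kf b (ust kf kf (kz * kC 1) P)) M) *
    ((- 1) ^+ (a - b) * cf (m - i) 0 (psum (run kf (a - b) (ust kf kf (kz * kC (- 1)) N)) M)).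
Proof.
have h1 := cf_vu 1 P M; have h2 := cf_vu (- 1) N M.
rewrite kC1 mul1r in h1; rewrite kCN1 mulN1r in h2.
pose X b i := cf i 0 (psum (run kf b (ust kf kf (kz * 1) P)) M).
pose Y b i := (- 1) ^+ b * cf i 0 (psum (run kf b (ust kf kf (kz * - 1) N)) M).
rewrite kC1 kCN1; apply: (cf_diag_mul (X := X) (Y := Y) a m) => d b; last exact: h2.
by rewrite h1 expr1n mul1r.
Qed.

Lemma cf_ve_mul P N M m a : cf (m + a) a (ve (1, kk) P M * ve (- 1, - kk) N M) =
  \sum_(b < a.+1) \sum_(i < m.+1)
    cf i 0 (psum (run (yw (kC 1) fw) b (est kf (yw (kC 1) fw) P)) M) *
    ((- 1) ^+ (a - b) *
      cf (m - i) 0 (psum (run (yw (kC (- 1)) fw) (a - b) (est kf (yw (kC (- 1)) fw) N)) M)).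
Proof.
have h1 := cf_ve 1 P M; have h2 := cf_ve (- 1) N M.
rewrite kC1 mul1r in h1; rewrite kCN1 mulN1r in h2.
pose X b i := cf i 0 (psum (run (yw 1 fw) b (est kf (yw 1 fw) P)) M).
pose Y b i := (- 1) ^+ b * cf i 0 (psum (run (yw (- 1) fw) b (est kf (yw (- 1) fw) N)) M).
rewrite kC1 kCN1; apply: (cf_diag_mul (X := X) (Y := Y) a m) => d b; last exact: h2.
by rewrite h1 expr1n mul1r.
Qed.

Lemma size_xwords L : size (xwords L) = wl L.
Proof. by rewrite /wl; elim: L => //= a L IH; rewrite size_cat size_nseq IH; lia. Qed.

Lemma cf_cut_runs (s : C) (g1 g2 : nat -> K) b b' P N m M :
  cf m 0 (kC s * (psum (ew kf g1 (nseq b true ++ xwords P)) M *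
    psum (ew kf g2 (nseq b' true ++ xwords N)) M)) =
  s * \sum_(a < m.+1) cf a 0 (psum (run g1 b (est kf g1 P)) M) *
    cf (m - a) 0 (psum (run g2 b' (est kf g2 N)) M).
Proof.
rewrite cf_kC cf0M (ew_run kf g1 b (xwords P)) (ew_xwords kf g1 P).
by rewrite (ew_run kf g2 b' (xwords N)) (ew_xwords kf g2 N).
Qed.

Definition cutK M (u w : seq bool) : K :=
  kC ((- 1) ^+ size w) * (psum (ew kf (yw (kC 1) fw) u) M * psum (ew kf (yw (kC (- 1)) fw) w) M).

Lemma cf_kw_psum c L m M : is_index L ->
  cf m 0 (psum (kw kf (yw (kC c) fw) L) M) =
  c ^+ m * sw (size L) m (fun e => psum (kw fw fw (add_index L e)) M).
Proof.
move=> hL; rewrite cf_psum sw_psum -psumZ; apply: eq_psum => n; exact: cf_kw.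
Qed.

Lemma cf_cut_zword (s : C) (g1 g2 : nat -> K) k i m M :
  cf m 0 (kC s * (psum (ew kf g1 (rev (zword (take i k)) ++ [::])) M *
    psum (ew kf g2 (behead (zword (drop i k) ++ [:: true]))) M)) =
  s * \sum_(a < m.+1) cf a 0 (psum (kw kf g1 (rev (take i k))) M) *
    cf (m - a) 0 (psum (kw kf g2 (drop i k)) M).
Proof.
rewrite cats0 cf_kC cf0M (ew_rev_zword kf g1 (take i k)).
by rewrite (ew_behead_zword kf g2 (drop i k)).
Qed.

Lemma sw_cut k m M : is_index k -> (0 < M)%N ->
  sw (size k) m (fun e => ZqM q (wS (gword (add_index k e))) M) =
  cf m 0 (\sum_(p <- cutl [::] (zword k ++ [:: true])) cutK M p.1 p.2).
Proof.
move=> hk M0; rewrite (cutl_zword (cutK M)) cf_sum.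
transitivity (sw (size k) m (fun e => \sum_(i < (size k).+1)
    cut q M (rev (zword (take i (add_index k e))) ++ [::])
      (behead (zword (drop i (add_index k e)) ++ [:: true])))).
  apply: eq_sw => e he _; rewrite ZqM_cuts //; last exact: is_index_add.
  by rewrite (cutl_zword (cut q M)) size_add_index.
rewrite sw_sum; apply: eq_bigr => i _.
have ik : (i <= size k)%N by rewrite -ltnS.
have /andP[ht hd] : is_index (take i k) && is_index (drop i k) by rewrite /is_index -all_cat cat_take_drop.
have hr : is_index (rev (take i k)) by rewrite /is_index all_rev.
pose g e := psum (kw fw fw (add_index (rev (take i k)) (rev e))) M.
pose h e := psum (kw fw fw (add_index (drop i k) e)) M.
have -> : cf m 0 (cutK M (rev (zword (take i k)) ++ [::]) (behead (zword (drop i k) ++ [:: true]))) =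
    (- 1) ^+ sumn (drop i k) * \sum_(a < m.+1) sw i a g * ((- 1) ^+ (m - a) * sw (size k - i) (m - a) h).
  rewrite /cutK cf_cut_zword.
  rewrite size_behead size_cat (size_zword hd) addn1; congr (_ * _); apply: eq_bigr => a _.
  congr (_ * _).
    rewrite cf_kw_psum // expr1n mul1r size_rev size_takel // /g.
    rewrite -(sw_rev i a (fun e => psum (kw fw fw (add_index (rev (take i k)) e)) M)).
    by [].
  by rewrite cf_kw_psum // size_drop.
pose h' e := (- 1) ^+ sumn e * h e.
transitivity ((- 1) ^+ sumn (drop i k) * sw (i + (size k - i)) m
    (fun e => g (take i e) * h' (drop i e))).
  rewrite -swZ subnKC //; apply: eq_sw => e he hs.
  have et : size (take i k) = size (take i e) by rewrite !size_takel // he.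
  have ed : size (drop i k) = size (drop i e) by rewrite !size_drop he.
  rewrite /cut cats0 ew_rev_zword ew_behead_zword size_behead size_cat addn1 /=.
  rewrite take_add_index drop_add_index size_zword; last exact: is_index_add.
  rewrite sumn_add_index // add_index_rev // /g /h' /h exprD.
  by ring.
congr (_ * _); rewrite sw_cat; apply: eq_bigr => a _; congr (_ * _).
by rewrite -swZ; apply: eq_sw => e _ he; rewrite /h' he.
Qed.

Fact sign_swap (s w x y : C) : s * w * (x * y) = w * (x * (s * y)).
Proof. by ring. Qed.

(* The sign counts the letters to the right of the cut, each of which has a negative weight. *)
Theorem lhs_series k A m M : is_index k -> (0 < M)%N -> zword k ++ [:: true] = rword A ->
  sw (size k) m (fun e => ZqM q (wS (gword (add_index k e))) M) =
  \sum_(i < size A) (- 1) ^+ wl (rruns A i) *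
    (if nth 0%N A i is a.+1 then
       cf (m + a) a (ve (1, kk) (lruns A i) M * ve (- 1, - kk) (rruns A i) M) else 0).
Proof.
move=> hk M0 e; rewrite sw_cut // e -[[::]]/(xwords [::]) (cutl_rword (cutK M)) cf_sum.
apply: eq_bigr => i _; case: (nth 0%N A i) => [|a]; first by rewrite big_ord0 cf0 mulr0.
rewrite cf_ve_mul cf_sum mulr_sumr; apply: eq_bigr => b _.
rewrite cats0 /cutK cf_cut_runs size_cat size_nseq size_xwords exprD /= !mulr_sumr.
by apply: eq_bigr => j _; exact: sign_swap.
Qed.

Lemma add_index_insert i j A e : (i < size A)%N -> size e = (size A).-1 ->
  add_index A (take i e ++ j :: drop i e) =
  add_index (take i A) (take i e) ++ (nth 0%N A i + j)%N :: add_index (rruns A i) (drop i e).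
Proof.
move=> iA he; rewrite -{1}(cat_take_drop i A) (drop_nth 0%N iA) add_index_cat //.
rewrite !size_takel ?he //; [by rewrite -ltnS prednK // (leq_ltn_trans _ iA) | exact: ltnW].
Qed.

Lemma cut_runs b b' P N M : cut q M (nseq b true ++ xwords P) (nseq b' true ++ xwords N) =
  (- 1) ^+ (b' + wl N) *
  (psum (run fw b (est fw fw P)) M * psum (run fw b' (est fw fw N)) M).
Proof. by rewrite /cut !ew_run !ew_xwords size_cat size_nseq size_xwords. Qed.

Lemma wl_add N e : size N = size e -> wl (add_index N e) = (wl N + sumn e)%N.
Proof. by move=> h; rewrite /wl sumn_add_index // size_add_index //; lia. Qed.

Lemma sw_cut_runs A i j m b b' M : (i < size A)%N ->
  sw (size A).-1 m (fun e =>
    cut q M (nseq b true ++ xwords (rev (add_index (take i A) (take i e))))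
      (nseq b' true ++ xwords (add_index (rruns A i) (drop i e)))) =
  (- 1) ^+ wl (rruns A i) *
  \sum_(a < m.+1) cf a 0 (psum (run kf b (ust kf kf (kz * kC 1) (lruns A i))) M) *
    ((- 1) ^+ b' * cf (m - a) 0 (psum (run kf b' (ust kf kf (kz * kC (- 1)) (rruns A i))) M)).
Proof.
move=> iA; have eA : (size A).-1 = (i + size (rruns A i))%N by rewrite size_drop; lia.
pose g e := psum (run fw b (est fw fw (add_index (lruns A i) (rev e)))) M.
pose h e := psum (run fw b' (est fw fw (add_index (rruns A i) e))) M.
pose h' e := (- 1) ^+ sumn e * h e.
transitivity ((- 1) ^+ wl (rruns A i) * ((- 1) ^+ b' * sw (i + size (rruns A i)) m
    (fun e => g (take i e) * h' (drop i e)))).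
  rewrite -!swZ eA; apply: eq_sw => e he hs.
  have et : size (take i A) = size (take i e).
    by rewrite !size_takel // ?he; [exact: leq_addr | exact: ltnW].
  have ed : size (rruns A i) = size (drop i e) by rewrite [RHS]size_drop he addKn.
  rewrite cut_runs wl_add // add_index_rev // /h' /g /h !exprD.
  by ring.
rewrite sw_cat; congr (_ * _); rewrite mulr_sumr; apply: eq_bigr => a _.
have -> : sw i a g = cf a 0 (psum (run kf b (ust kf kf (kz * kC 1) (lruns A i))) M).
  rewrite cf_run_ust expr1n mul1r size_rev size_takel; last exact: ltnW.
  exact: (sw_rev i a (fun e => psum (run fw b (est fw fw (add_index (lruns A i) e))) M)).
have -> : sw (size (rruns A i)) (m - a) h' =
    cf (m - a) 0 (psum (run kf b' (ust kf kf (kz * kC (- 1)) (rruns A i))) M).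
  by rewrite cf_run_ust -swZ; apply: eq_sw => e _ he; rewrite /h' he.
exact: mulrCA.
Qed.

(** The increment j of the run that is cut is split off: j = 0 gives the coefficient at the original
    length, and the terms with j >= 1 together make up [ext] in degree m - 1. *)
Theorem rhs_series A (kap : seq nat -> seq nat) m M : (0 < M)%N ->
  (forall e, size e = size A -> is_index (kap e) /\ zword (kap e) ++ [:: true] = rword (add_index A e)) ->
  sw (size A) m (fun e => ZqM q (wS (gword (kap e))) M) =
  \sum_(i < size A) (- 1) ^+ wl (rruns A i) *
    ((if nth 0%N A i is a.+1 then
       cf (m + a) a (vu (1, kk) (lruns A i) M * vu (- 1, - kk) (rruns A i) M) else 0) +
     (if m is m'.+1 then
       ext (nth 0%N A i) m' (vu (1, kk) (lruns A i) M * vu (- 1, - kk) (rruns A i) M) else 0)).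
Proof.
move=> M0 hk.
transitivity (sw (size A) m (fun e => \sum_(i < size A) \sum_(b < nth 0%N (add_index A e) i)
  cut q M (nseq b true ++ xwords (lruns (add_index A e) i))
    (nseq ((nth 0%N (add_index A e) i).-1 - b) true ++ xwords (rruns (add_index A e) i)))).
  apply: eq_sw => e he _; have [h1 h2] := hk e he.
  rewrite ZqM_cuts // h2 -[[::]]/(xwords [::]) (cutl_rword (cut q M)) size_add_index //.
  by apply: eq_bigr => i _; apply: eq_bigr => b _; rewrite cats0.
rewrite sw_sum; apply: eq_bigr => i _; move: (nat_of_ord i) (ltn_ord i) => {}i iA.
set CU := vu _ _ M * _.
have -> : (if nth 0%N A i is a.+1 then cf (m + a) a CU else 0) +
    (if m is m'.+1 then ext (nth 0%N A i) m' CU else 0) =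
    \sum_(j < m.+1) (if (nth 0%N A i + j)%N is a.+1 then cf (m - j + a) a CU else 0).
  rewrite big_ord_recl /= addn0 subn0; congr (_ + _).
  case: (m) => [|m']; first by rewrite big_ord0.
  by apply: eq_bigr => j _; rewrite /bump /= addnS subSS /= [(nth 0%N A i + j)%N]addnC addnA subnK // -ltnS.
rewrite (_ : sw (size A) m = @sw R (i + (size A - i.+1).+1) m); last by congr sw; lia.
rewrite sw_mid mulr_sumr; apply: eq_bigr => j _.
have -> : (i + (size A - i.+1))%N = (size A).-1 by lia.
transitivity (sw (size A).-1 (m - j) (fun e => \sum_(b < nth 0%N A i + j)
    cut q M (nseq b true ++ xwords (rev (add_index (take i A) (take i e))))
      (nseq ((nth 0%N A i + j).-1 - b) true ++ xwords (add_index (rruns A i) (drop i e))))).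
  apply: eq_sw => e he _; rewrite add_index_insert // /lruns.
  have et : size (take i A) = size (take i e).
    by rewrite !size_takel // ?he; lia.
  have es : size (add_index (take i A) (take i e)) = i by rewrite size_add_index // size_takel // ltnW.
  have -> : nth 0%N (add_index (take i A) (take i e) ++ (nth 0%N A i + j)%N :: add_index (rruns A i) (drop i e)) i
    = (nth 0%N A i + j)%N by rewrite nth_cat es ltnn subnn.
  rewrite take_cat es ltnn subnn take0 cats0.
  have -> : rruns (add_index (take i A) (take i e) ++ (nth 0%N A i + j)%N :: add_index (rruns A i) (drop i e)) i
    = add_index (rruns A i) (drop i e).
    by rewrite {1}/rruns drop_cat es ltnNge leqnSn /= subSn // subnn /= drop0.
  by [].
rewrite sw_sum; case: (nth 0%N A i + j)%N => [|a]; first by rewrite big_ord0 mulr0.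
rewrite cf_vu_mul mulr_sumr; apply: eq_bigr => b _.
exact: sw_cut_runs.
Qed.

End Sides.
(** * Hoffman duality and runs *)

Section Duality.
Implicit Types (k l e A : seq nat) (w : seq bool).

Lemma zword_cons c l : zword (c :: l) = true :: (nseq c.-1 false ++ zword l).
Proof. by []. Qed.

Lemma index_of_wordP w : head false w ->
  zword (index_of_word w) = w /\ is_index (index_of_word w).
Proof.
rewrite /index_of_word; set F := foldr _ _.
have h v : v = nseq (F v).1 false ++ zword (F v).2 /\ is_index (F v).2.
  by elim: v => // -[] v [IH1 IH2] /=; split => //; rewrite {1}IH1.
case: w => // -[] // w _; have [h1 h2] := h w.
by split; [rewrite [in RHS]h1 | exact: h2].
Qed.

Lemma dualP k : is_index k -> k != [::] ->
  [/\ zword (hoffman_dual k) = true :: map negb (behead (zword k)),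
    is_index (hoffman_dual k) & hoffman_dual k != [::]].
Proof.
case: k => // c k _ _; rewrite /hoffman_dual zword_cons.
have [h1 h2] := @index_of_wordP (true :: map negb (nseq c.-1 false ++ zword k)) isT.
split=> //; apply: contraTneq isT => e; by rewrite e in h1.
Qed.

Lemma dual_dual k : is_index k -> k != [::] ->
  zword (hoffman_dual (hoffman_dual k)) = zword k.
Proof.
move=> hk k0; have [e1 hd d0] := dualP hk k0; have [-> _ _] := dualP hd d0.
rewrite e1 /= -map_comp (eq_map (g := id)) ?map_id => [|b]; last exact: negbK.
by case: k k0 {hk e1 hd d0}.
Qed.

Lemma count_zword k : count id (zword k) = size k.
Proof.
by elim: k => // c l IH; rewrite zword_cons /= count_cat IH count_nseq mul0n.
Qed.

(** Swapping letters turns y x^(k_1 - 1) y x^(k_2 - 1) ... into runs of [y] of lengths k_i - 1. The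
    last gains one from the appended [y], and the first gains one in [runs] from the leading [y],
    which duality does not swap. Thus adding e to the index adds e to the runs. *)
Fixpoint runs_tl k : seq nat :=
  match k with
  | [::] => [::]
  | [:: c] => [:: c]
  | c :: l => c.-1 :: runs_tl l
  end.

Definition runs k := if runs_tl k is a :: L then a.+1 :: L else [::].

Lemma runs_tl_cons c d l : runs_tl [:: c, d & l] = c.-1 :: runs_tl (d :: l).
Proof. by []. Qed.

Lemma runs_tl_behead c l : exists a L, runs_tl (c :: l) = a :: L.
Proof. by case: l => [|d l]; [exists c, [::] | exists c.-1, (runs_tl (d :: l))]. Qed.

Lemma rword_runs_tl c l : is_index (c :: l) ->
  rword (runs_tl (c :: l)) = map negb (behead (zword (c :: l))) ++ [:: true].
Proof.
elim: l c => [|d l IH] c /andP[c0 hl].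
  rewrite zword_cons /= !cats0 map_nseq.
  by case: c c0 => // c _; rewrite nseq_shift cats0.
rewrite runs_tl_cons zword_cons [behead _]/= map_cat map_nseq -catA.
have := IH d hl; rewrite zword_cons [behead _]/= [map negb (true :: _)]/=.
by have [a [L ->]] := runs_tl_behead d l; rewrite [(_ :: _) ++ _]/= => <-.
Qed.

Lemma rword_runs k : is_index k -> k != [::] ->
  rword (runs k) = zword (hoffman_dual k) ++ [:: true].
Proof.
move=> hk k0; have [-> _ _] := dualP hk k0; case: k hk k0 => // c l hk _.
have := rword_runs_tl hk; rewrite /runs; have [a [L ->]] := runs_tl_behead c l.
by rewrite /= => <-.
Qed.

Lemma runs_tl_add k e : size k = size e -> is_index k ->
  runs_tl (add_index k e) = add_index (runs_tl k) e.
Proof.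
rewrite /add_index; elim: k e => [|c [|d l] IH] [|b [|b' e]] // [h] /andP[c0 hl].
have := IH (b' :: e) (congr1 S h) hl.
rewrite ![map _ (zip (_ :: _) (_ :: _))]/= !runs_tl_cons => ->.
rewrite [RHS]/=; congr (_ :: _).
by case: c c0.
Qed.

Lemma runs_add k e : size k = size e -> is_index k ->
  runs (add_index k e) = add_index (runs k) e.
Proof.
move=> h hk; rewrite /runs runs_tl_add //.
case: k e h hk => [|c l] [|b e] // h hk; have [a [L ->]] := runs_tl_behead c l.
by [].
Qed.

Lemma size_runs k : size (runs k) = size k.
Proof.
have h : size (runs_tl k) = size k.
  elim: k => [|c [|d l] IH] //.
  by rewrite runs_tl_cons /= IH.
by move: h; rewrite /runs; case: (runs_tl k).
Qed.

Lemma runs_head k : k != [::] -> (0 < head 0 (runs k))%N.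
Proof. by case: k => // c l _; rewrite /runs; have [a [L ->]] := runs_tl_behead c l. Qed.

Lemma runs_last k : is_index k -> k != [::] -> (0 < last 0 (runs k))%N.
Proof.
case: k => // c l hk _.
have h : (0 < last 0 (runs_tl (c :: l)))%N.
  elim: l c hk => [|d l IH] c /andP[c0 hl] //; rewrite runs_tl_cons.
  by have := IH d hl; have [a [L ->]] := runs_tl_behead d l.
move: h; rewrite /runs; have [a [L ->]] := runs_tl_behead c l.
by case: L.
Qed.

Lemma size_dual k : is_index k -> k != [::] -> false \in zword k -> (1 < size (hoffman_dual k))%N.
Proof.
move=> hk k0 hf; have [e _ _] := dualP hk k0; rewrite -count_zword e /= ltnS.
case: k k0 hf {hk e} => // c l _; rewrite zword_cons inE /= => hf.
by rewrite count_map -has_count; apply/hasP; exists false.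
Qed.

Lemma admissible_false k : k != [::] -> admissible k -> false \in zword k.
Proof.
case/lastP: k => // l c _; rewrite /admissible.
have -> : match rcons l c with [::] => true | _ :: _ => (1 < last 0 (rcons l c))%N end = (1 < c)%N.
  by case: l => [|a l] //=; rewrite last_rcons.
move=> c1; rewrite /zword map_rcons flatten_rcons mem_cat; apply/orP; right.
by case: c c1 => [|[|c]] // _; rewrite !inE.
Qed.

Lemma admissible_add k e : size k = size e -> k != [::] -> admissible k -> admissible (add_index k e).
Proof.
have h x y l f : size l = size f -> (last x l <= last (x + y) (add_index l f))%N.
  elim: l f x y => [|a l IH] [|b f] x y //=; first by rewrite leq_addr.
  by move=> [hs]; exact: IH.
by case: k e => // c l [|b e] // [hs] _ /= hl; apply: leq_trans hl (h _ _ _ _ hs).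
Qed.

End Duality.

(** * Passage to the limit and conclusion *)

Section Main.
Variables (R : realType) (q : R[i]).
Local Notation C := R[i].
Local Notation K := (ser C).
Hypothesis q01 : 0 < `|q| < 1.
Implicit Types (k A e : seq nat) (m r : nat) (u v : nat -> C).
Notation NPval := (NPval q).
Notation Mval := (Mval q).

Lemma cvgC_eq1 u v (l : C) : (forall M, (0 < M)%N -> v M = u M) -> cvgC u l -> cvgC v l.
Proof.
move=> h /cvgCP c; apply/cvgCP => eps e0; have [N hN] := c eps e0.
exists N.+1 => n hn; rewrite h; last by apply: leq_ltn_trans hn.
by apply: hN; exact: ltnW.
Qed.

Lemma cvg_sw r m (F : seq nat -> nat -> C) (l : seq nat -> C) :
  (forall e, size e = r -> cvgC (F e) (l e)) ->
  cvgC (fun M => sw r m (fun e => F e M)) (sw r m l).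
Proof.
elim: r m F l => [|r IH] m F l h /=; first by apply: cvgCM (cvgC_cst _) _; exact: h.
by apply: cvgC_sum => j; apply: IH => e he; apply: h; rewrite /= he.
Qed.

(* The coefficient at which the cuts inside a run of length [a] are read. *)
Definition run_cf m a (x : K) : C := if a is b.+1 then cf (m + b) b x else 0.

Lemma run_cfB m a (x y : K) : run_cf m a (x - y) = run_cf m a x - run_cf m a y.
Proof. by case: a => [|b]; rewrite /run_cf ?subr0 // cfB. Qed.

Lemma cvg_run_cf m a (phi : nat -> K) l : cvgK phi l -> cvgC (fun M => run_cf m a (phi M)) (run_cf m a l).
Proof. by case: a => [|b] h; [exact: cvgC_cst | exact: h]. Qed.

Lemma cvg_ext a d (phi : nat -> K) l : cvgK phi l -> cvgC (fun M => ext a d (phi M)) (ext a d l).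
Proof. by move=> h; apply: cvgC_sum => b; exact: h. Qed.

Lemma runs_dual k : is_index k -> k != [::] ->
  zword k ++ [:: true] = rword (runs (hoffman_dual k)).
Proof.
move=> hk k0; have [_ hd d0] := dualP hk k0.
by rewrite rword_runs // dual_dual.
Qed.

(** The case m = 0 of [lhs_series] together with the limits of [word_values]. It is needed because
    [limC] returns a default value for divergent sequences. *)
Lemma ZqS_cvg k : is_index k -> k != [::] -> (1 < size (hoffman_dual k))%N ->
  cvgC (ZqM q (wS (gword k))) (ZqS q k).
Proof.
move=> hk k0 hs; have [_ hd d0] := dualP hk k0; pose A := runs (hoffman_dual k).
have sA : (1 < size A)%N by rewrite size_runs.
have [cu [ce [h _]]] := word_values q01 0 sA (runs_head d0) (runs_last hd d0).
pose l := \sum_(i < size A) (- 1) ^+ wl (rruns A i) * run_cf 0 (nth 0%N A i) (ce i).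
have c : cvgC (ZqM q (wS (gword k))) l.
  apply: (@cvgC_eq1 (fun M => \sum_(i < size A) (- 1) ^+ wl (rruns A i) * run_cf 0 (nth 0%N A i)
     (ve q (1, kk R) (lruns A i) M * ve q (- 1, - kk R) (rruns A i) M))).
    move=> M M0; rewrite -(lhs_series q 0 hk M0 (runs_dual hk k0)) sw_zero.
    congr (ZqM _ (wS (gword _)) _).
    by elim: (k) => // a l' IH; rewrite /add_index /= addn0 -/(add_index _ _) -IH.
  apply: cvgC_sum => i; apply: cvgCM (cvgC_cst _) _; apply: cvg_run_cf.
  by have [_ hc _] := h i.
by rewrite /ZqS (ZqE c).
Qed.

(** Both sides are limits of sums over the runs of the same word z_k y. Their difference consists of
    coefficients of [cu i - ce i], which lie in [Mval], and of the [ext] terms, which [word_values]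
    handles together. *)
Theorem ohno_values k m : is_index k -> k != [::] -> admissible k -> (0 < m)%N ->
  NPval (sw (size k) m (fun e => ZqS q (add_index k e)) -
    sw (size (hoffman_dual k)) m
      (fun e => ZqS q (hoffman_dual (add_index (hoffman_dual k) e)))).
Proof.
move=> hk k0 ka m0; have [_ hd d0] := dualP hk k0.
set k' := hoffman_dual k in hd d0 *; pose A := runs k'.
have sk' : (1 < size k')%N by apply: size_dual => //; exact: admissible_false.
have sA : size A = size k' by rewrite size_runs.
have [cu [ce [h hx]]] : exists cu ce : nat -> K, [/\ forall i,
    [/\ cvgK (fun M => vu q (1, kk R) (lruns A i) M * vu q (- 1, - kk R) (rruns A i) M) (cu i),
      cvgK (fun M => ve q (1, kk R) (lruns A i) M * ve q (- 1, - kk R) (rruns A i) M) (ce i)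
      & KV Mval (cu i - ce i)] &
    NPval (\sum_(i < size A) (- 1) ^+ wl (rruns A i) * ext (nth 0%N A i) m.-1 (cu i))].
  by apply: word_values; rewrite ?sA //; [exact: runs_head | exact: runs_last].
have nz (l e : seq nat) : size l = size e -> l != [::] -> add_index l e != [::].
  by case: l e => // a l [|b e].
have L1 : sw (size k) m (fun e => ZqS q (add_index k e)) =
    \sum_(i < size A) (- 1) ^+ wl (rruns A i) * run_cf m (nth 0%N A i) (ce i).
  apply: (@cvgC_unique _ (fun M => sw (size k) m (fun e => ZqM q (wS (gword (add_index k e))) M))).
    apply: cvg_sw => e he; have hi := is_index_add (esym he) hk; have hn := nz k e (esym he) k0.
    apply: ZqS_cvg => //; apply: size_dual => //; apply: admissible_false => //.
    exact: admissible_add.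
  apply: (@cvgC_eq1 (fun M => \sum_(i < size A) (- 1) ^+ wl (rruns A i) * run_cf m (nth 0%N A i)
     (ve q (1, kk R) (lruns A i) M * ve q (- 1, - kk R) (rruns A i) M))).
    by move=> M M0; rewrite (lhs_series q m hk M0 (runs_dual hk k0)).
  apply: cvgC_sum => i; apply: cvgCM (cvgC_cst _) _; apply: cvg_run_cf.
  by have [_ hc _] := h i.
have L2 : sw (size k') m (fun e => ZqS q (hoffman_dual (add_index k' e))) =
    \sum_(i < size A) (- 1) ^+ wl (rruns A i) *
      (run_cf m (nth 0%N A i) (cu i) + ext (nth 0%N A i) m.-1 (cu i)).
  apply: (@cvgC_unique _ (fun M => sw (size k') m
      (fun e => ZqM q (wS (gword (hoffman_dual (add_index k' e)))) M))).
    apply: cvg_sw => e he; have hi := is_index_add (esym he) hd; have hn := nz k' e (esym he) d0.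
    have [_ hdi hdn] := dualP hi hn; apply: ZqS_cvg => //.
    by rewrite -count_zword dual_dual // count_zword size_add_index.
  apply: (@cvgC_eq1 (fun M => \sum_(i < size A) (- 1) ^+ wl (rruns A i) * (run_cf m (nth 0%N A i)
     (vu q (1, kk R) (lruns A i) M * vu q (- 1, - kk R) (rruns A i) M) +
     ext (nth 0%N A i) m.-1 (vu q (1, kk R) (lruns A i) M * vu q (- 1, - kk R) (rruns A i) M)))).
    move=> M M0; rewrite -sA (@rhs_series R q A (fun e => hoffman_dual (add_index k' e)) m M M0).
      by case: (m) m0.
    move=> e; rewrite sA => he; have hi := is_index_add (esym he) hd; have hn := nz k' e (esym he) d0.
    have [_ hdi hdn] := dualP hi hn; split=> //.
    by rewrite -rword_runs // runs_add.
  apply: cvgC_sum => i; apply: cvgCM (cvgC_cst _) _; have [hc _ _] := h i.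
  by apply: cvgCD; [exact: cvg_run_cf | exact: cvg_ext].
have sgn n : (- 1) ^+ n = ev q ((- 1) ^+ n) :> C.
  by elim: n => [|n IH]; rewrite ?expr0 ?ev1 // !exprS evM -IH evN ev1.
have hs : NPval (\sum_(i < size A) (- 1) ^+ wl (rruns A i) * run_cf m (nth 0%N A i) (cu i - ce i)).
  elim/big_ind: _ => [|x y|i _]; [exact: NPval0 | exact: NPval_add | rewrite sgn].
  apply: NPval_scale; have [_ _ hM] := h i.
  by case: (nth _ _ _) => [|b]; [exact: NPval0 | apply: M_NP; exact: hM].
rewrite L1 L2.
set S1 := \sum_(i < _) _ in hs; set S2 := \sum_(i < _) _ in hx.
have -> : \sum_(i < size A) (- 1) ^+ wl (rruns A i) * run_cf m (nth 0%N A i) (ce i) -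
    \sum_(i < size A) (- 1) ^+ wl (rruns A i) *
      (run_cf m (nth 0%N A i) (cu i) + ext (nth 0%N A i) m.-1 (cu i)) = - (S1 + S2).
  rewrite /S1 /S2 -big_split -[LHS]sumrB -[RHS]sumrN; apply: eq_bigr => i _ /=.
  rewrite run_cfB; move: (run_cf _ _ _) (run_cf _ _ _) (ext _ _ _) => x y z; ring.
exact/NPval_opp/NPval_add.
Qed.

End Main.

Theorem theorem6p7 (R : realType) (q : R[i]) (k : seq nat) (m : nat) :
  0 < `|q| < 1 ->
  is_index k -> k != [::] -> admissible k ->
  (1 <= m)%N ->
  eq_mod_NP q
    (sum_wt (size k) m (fun e => ZqS q (add_index k e)))
    (sum_wt (size (hoffman_dual k)) m
       (fun e => ZqS q (hoffman_dual (add_index (hoffman_dual k) e)))).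
Proof.
by move=> q01 hk k0 ka m0; apply: (NPval_eq q01); rewrite !sum_wt_sw; exact: ohno_values.
Qed.
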